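(* Let $\alpha>0$, $1<p\le\infty$, $x\in\mathbb{R}$, and let $w_x$ be a function of modulus of continuity type such that the class $\Omega_{\alpha,p}(w_x)$ is nonempty. Let $A=(a_{n,k})_{n,k\ge0}$ be an infinite matrix of nonnegative real numbers such that $\sum_{k=0}^\infty a_{n,k}=1$ for every $n=0,1,2,\dots$, $\lim_{n\to\infty}a_{n,0}=0$, and for every $n$ the sequence $(a_{n,k})_{k=0}^\infty$ belongs to $MS$, i.e. is nonnegative and nonincreasing in $k$. If $f\in\Omega_{\alpha,p}(w_x)$ and $q>0$, then there is a constant $K>0$, not depending on $n$, such that for all $n=0,1,2,\dots$ $$\left\{\sum_{k=0}^\infty a_{n,k}\left|S_{\frac{\alpha k}{2}}f(x)-f(x)\right|^q\right\}^{1/q}\le K\left\{\sum_{k=0}^\infty a_{n,k}\left[w_x\!\left(\frac{\pi}{k+1}\right)+E_{\frac{\alpha k}{2}}(f)_{S^p}\right]^q\right\}^{1/q}.$$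
   Context: **Stepanov class.** For $1<p\le\infty$, $S^p$ is the class of all almost periodic functions on $\mathbb{R}$ in the sense of Stepanov, with the norm $\|f\|_{S^p}=\sup_{u}\left\{\frac1\pi\int_u^{u+\pi}|f(t)|^p\,dt\right\}^{1/p}$ for $1<p<\infty$ and $\|f\|_{S^\infty}=\sup_u|f(u)|$. **Fourier series.** The Fourier series of $f\in S^p$ is $\sum_{\nu=-\infty}^{\infty}A_\nu(f)e^{i\lambda_\nu x}$ with $A_\nu(f)=\lim_{L\to\infty}\frac1L\int_0^L f(t)e^{-i\lambda_\nu t}\,dt$, where it is assumed that $0=\lambda_0<\lambda_\nu<\lambda_{\nu+1}$ for $\nu\in\mathbb{N}=\{1,2,\dots\}$, $\lim_{\nu\to\infty}\lambda_\nu=\infty$, $\lambda_{-\nu}=-\lambda_\nu$ and $|A_\nu(f)|+|A_{-\nu}(f)|>0$. For $\gamma\ge0$ the partial sums are $S_\gamma f(x)=\sum_{|\lambda_\nu|\le\gamma}A_\nu(f)e^{i\lambda_\nu x}$. **The class $\Omega_{\alpha,p}$.** For fixed $\alpha>0$, $\Omega_{\alpha,p}$ is the set of functions of class $S^p$, bounded on $(-\infty,\infty)$, whose Fourier exponents (the numbers $\lambda_\nu$ in the Fourier series $\sum_{\nu=-\infty}^{\infty}A_\nu(f)e^{i\lambda_\nu x}$ of $f$, with $0=\lambda_0<\lambda_\nu<\lambda_{\nu+1}$ for $\nu\in\mathbb{N}$, $\lim_{\nu\to\infty}\lambda_\nu=\infty$, $\lambda_{-\nu}=-\lambda_\nu$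 and $|A_\nu(f)|+|A_{-\nu}(f)|>0$) satisfy $\lambda_{\nu+1}-\lambda_\nu\ge\alpha$ for all $\nu\in\mathbb{N}$. **Best approximation.** For $\sigma\ge0$, $B_\sigma$ is the set of entire functions of exponential type $\sigma$ (i.e. at most $\sigma$) bounded on the real axis, and $E_\sigma(f)_{S^p}=\inf_{g_\sigma\in B_\sigma}\|f-g_\sigma\|_{S^p}$. **Local moduli.** $\varphi_x(t)=f(x+t)+f(x-t)-2f(x)$ and, for $\delta>0$, $w_xf(\delta)_p=\left\{\frac1\delta\int_0^\delta|\varphi_x(t)|^p\,dt\right\}^{1/p}$ (for $p=\infty$, such $p$-th power integral means over $(0,\delta)$ are read as the essential supremum over $(0,\delta)$). **Function of modulus of continuity type.** A nondecreasing continuous function $w_x$ on $[0,+\infty)$ with $w_x(0)=0$ and $w_x(\delta_1+\delta_2)\le w_x(\delta_1)+w_x(\delta_2)$ for all $\delta_1,\delta_2\ge0$. **The class $\Omega_{\alpha,p}(w_x)$.** The set of all $f\in\Omega_{\alpha,p}$ for which there is a constant $C>0$ such that for all $\gamma,\delta>0$ (and both choices of sign) $$\left[\frac1\delta\int_0^\delta|\varphi_x(t)-\varphi_x(t\pm\gamma)|^p\,dt\right]^{1/p}\le C\,w_x(\gamma)\quad\text{and}\quad w_xf(\delta)_p\le C\,w_x(\delta).$$ **Constants.** The paper writes the estimate with $\ll$, where $I_1\ll I_2$ means $I_1\le KI_2$ for a positive constant $K$ that may depend on parameters (such as $\alpha,p,q$ and the constant $C$ of the class), but not on $n$. *)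

(* Defs.v *)
(* MathComp-Analysis; complex numbers are R[i] from mathcomp-real-closed. *)
From HB Require Import structures.
From mathcomp Require Import all_boot all_order all_algebra.
From mathcomp Require Import complex.
From mathcomp Require Import all_classical all_reals all_analysis ess_sup_inf.

Set Implicit Arguments.
Unset Strict Implicit.
Unset Printing Implicit Defensive.

Import Order.TTheory GRing.Theory Num.Theory.
Import numFieldNormedType.Exports.

Local Open Scope classical_set_scope.
Local Open Scope ring_scope.
Local Open Scope complex_scope.

Section stepanov.
Context {R : realType}.
Implicit Types (p : \bar R) (f g h phi : R -> R[i]) (w : R -> R).

Notation mu := (@lebesgue_measure R).
Notation normc := (@ComplexField.Normc.normc R).

(* [lebesgue_measure] lives on the Borel sets.  Measurability for the
   completed (Lebesgue) sigma-algebra is agreement almost everywhere with a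
   Borel function; the library integral with respect to [mu] of a function
   of this kind is its Lebesgue integral. *)
Definition lebesgue_measurable_fun f : Prop :=
  exists g, [/\ measurable_fun [set: R] (fun t => complex.Re (g t)),
    measurable_fun [set: R] (fun t => complex.Im (g t)) &
    \forall t \ae mu, f t = g t].

Local Open Scope ereal_scope.

(* The p-th power integral mean over [u, u + delta]; for p = +oo, the
   essential supremum over the open interval (extending a nonnegative function
   by 0 does not change it). *)
Definition pmean p (u delta : R) h : \bar R :=
  match p with
  | r%:E => ((delta^-1)%:E *
      \int[mu]_(t in `[u, (u + delta)%R]) (normc (h t) `^ r)%:E) `^ r^-1
  | +oo => ess_sup mu ((fun t => (normc (h t))%:E) \_ `]u, (u + delta)%R[)
  | -oo => 0
  end.

Definition stepanov_norm p f : \bar R :=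
  match p with
  | r%:E => ereal_sup (range (fun u : R => pmean r%:E u pi f))
  | +oo => ereal_sup (range (fun u : R => (normc (f u))%:E))
  | -oo => 0
  end.

Definition relatively_dense (T : set R) : Prop :=
  exists l : R, (0 < l)%R /\
    forall a : R, exists tau : R, (a <= tau <= a + l)%R /\ T tau.

Definition stepanov_translations p f (eps : R) : set R :=
  [set tau | stepanov_norm p (fun t => f (t + tau)%R - f t)%R <= eps%:E].

(* For p = +oo these are the uniformly (Bohr) almost periodic functions, which
   are continuous by definition. *)
Definition stepanov_class p : set (R -> R[i]) :=
  [set f | match p with
           | r%:E => lebesgue_measurable_fun f /\ forall u : R,
               \int[mu]_(t in `[u, (u + pi)%R]) (normc (f t) `^ r)%:E < +oo
           | +oo => continuous (fun t => f t : R[i]^o)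
           | -oo => False
           end /\
    forall eps : R, (0 < eps)%R -> relatively_dense (stepanov_translations p f eps)].

Local Close Scope ereal_scope.

Definition expi (t : R) : R[i] := cos t +i* sin t.

Definition cintegral (D : set R) f : R[i] :=
  (\int[mu]_(t in D) complex.Re (f t)) +i* (\int[mu]_(t in D) complex.Im (f t)).

(* Indexed by the exponent l rather than by its rank in the spectrum. *)
Definition fourier_coef f (l : R) : R[i] :=
  lim (((L^-1)%:C * cintegral `[0, L] (fun t => f t * expi (- (l * t))) : R[i]^o)
         @[L --> +oo%R]).

(* The last clause says that no term of the Fourier series is left out. *)
Definition fourier_exponents f (lam : int -> R) : Prop :=
  [/\ lam 0 = 0,
      forall n : nat, (0 < n)%N -> 0 < lam n%:Z < lam n.+1%:Z,
      lam n%:Z @[n --> \oo] --> +oo%R &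
      forall nu : int, lam (- nu) = - lam nu] /\
  (forall n : nat, (0 < n)%N ->
     0 < normc (fourier_coef f (lam n%:Z)) +
         normc (fourier_coef f (lam (- n%:Z)))) /\
  (forall l : R, fourier_coef f l != 0 -> exists nu : int, l = lam nu).

(* The index set is finite because lam is odd and tends to +oo. *)
Definition partial_sum f (lam : int -> R) (gamma x : R) : R[i] :=
  \sum_(nu \in [set nu : int | `|lam nu| <= gamma])
    fourier_coef f (lam nu) * expi (lam nu * x).

Definition Omega (alpha : R) p : set (R -> R[i]) :=
  [set f | [/\ stepanov_class p f,
    exists M : R, forall t, normc (f t) <= M &
    exists2 lam : int -> R, fourier_exponents f lam &
      forall n : nat, (0 < n)%N -> alpha <= lam n.+1%:Z - lam n%:Z]].

(* At most of type sigma *)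
Definition exponential_type (sigma : R) (g : R[i] -> R[i]) : Prop :=
  forall eps : R, 0 < eps -> exists C : R,
    forall z, normc (g z) <= C * expR ((sigma + eps) * normc z).

Definition entire (g : R[i] -> R[i]) : Prop :=
  forall z, derivable (g : R[i]^o -> R[i]^o) z 1.

Definition B_class (sigma : R) : set (R[i] -> R[i]) :=
  [set g | [/\ entire g, exponential_type sigma g &
    exists M : R, forall t : R, normc (g t%:C) <= M]].

Definition best_approx p (sigma : R) f : \bar R :=
  ereal_inf [set stepanov_norm p (fun t => f t - g t%:C) | g in B_class sigma].

Definition symm_diff2 f (x t : R) : R[i] := f (x + t) + f (x - t) - f x *+ 2.

Definition local_modulus p f (x delta : R) : \bar R :=
  pmean p 0 delta (symm_diff2 f x).

(* Only the values of w on [0, +oo[ matter. *)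
Definition modulus_type w : Prop :=
  [/\ {within `[0, +oo[, continuous w},
      w 0 = 0,
      forall d1 d2, 0 <= d1 -> d1 <= d2 -> w d1 <= w d2 &
      forall d1 d2, 0 <= d1 -> 0 <= d2 -> w (d1 + d2) <= w d1 + w d2].

Definition Omega_w (alpha : R) p (x : R) w : set (R -> R[i]) :=
  [set f | Omega alpha p f /\
    exists2 C : R, 0 < C & forall gamma delta : R, 0 < gamma -> 0 < delta ->
      let phi := symm_diff2 f x in
      [/\ (pmean p 0 delta (fun t => (phi t - phi (t + gamma))%R) <= (C * w gamma)%:E)%E,
          (pmean p 0 delta (fun t => (phi t - phi (t - gamma))%R) <= (C * w gamma)%:E)%E &
          (local_modulus p f x delta <= (C * w delta)%:E)%E]].

Definition MS (c : nat -> R) : Prop :=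
  (forall k, 0 <= c k) /\ (forall k, c k.+1 <= c k).

End stepanov.

(* Main.v *)
Require Import Defs.
From HB Require Import structures.
From mathcomp Require Import all_boot all_order all_algebra.
From mathcomp Require Import complex.
From mathcomp Require Import all_classical all_reals all_analysis ess_sup_inf measurable_realfun.
From mathcomp Require Import ring lra zify.

Set Implicit Arguments.
Unset Strict Implicit.
Unset Printing Implicit Defensive.

Import Order.TTheory GRing.Theory Num.Theory.
Import numFieldNormedType.Exports.

Local Open Scope classical_set_scope.
Local Open Scope ring_scope.
Local Open Scope complex_scope.

(** Write phi for the symmetric second difference of f at x and beta = alpha / 2.

    Representation. The kernel kappa_j = (cos (j beta t) - cos ((j+1) beta t)) / t^2 has
    as Fourier transform a trapezoid, constant on [-j beta, j beta] and zero outside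
    [-(j+1) beta, (j+1) beta] ([trapk_fourier]). Convolution of f with it therefore
    equals, up to a constant factor, the partial sum of order k beta, as soon as no
    exponent lies on the slopes of the trapezoid; since positive exponents are
    2 beta apart, this is the case for j = k or for j = k - 1 ([plateau]). Hence
    S f x - f x is a constant times the integral of phi kappa_j over the half line
    ([sum_representation]). The identity of the convolution with the trigonometric sum
    ([convolution_trig]) rests on the uniqueness theorem for uniformly almost periodic
    functions ([ap_uniqueness]), proved by sampling on a grid and finite Fourier
    analysis.

    One block. Fix m and let k run through [m, 2m). It suffices to bound the mean of the
    Q-th powers of these integrals, for a large integer Q >= q, by w(eta)^Q, where eta is
    a half period of the frequency 2 m beta ([block_estimate]). Near the origin this is
    immediate. Elsewhere, a shift by eta turns every wave of the block by an angle in
    [pi/2, pi) ([shift_average]), so phi may be replaced by its differences at distance eta,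
    which the hypothesis controls in mean by w(eta). Over one period one decomposes
    dyadically and cuts each piece at a suitable height: the high part is summable in
    L1, the low part is small in L2, where Bessel's inequality applies
    ([dyadic_wave_bound]). Beyond one period the decay t^-2 of the kernel suffices.

    Summation. Blocks add up to bounds for the partial sums of the q-th powers
    ([dyadic_partial], [strong_sum]), and summation by parts with the nonincreasing
    weights a_(n,k) gives the series, with a constant that does not depend on n
    ([weighted_series]). The terms w (pi / (k+1)) alone carry the right-hand side, to
    which the best approximations add nonnegative amounts ([best_approx_ge0]). If w
    vanishes at a positive point, phi is 0 almost everywhere and the partial sums equal f x
    ([degenerate_sum]).

    The conditions on phi are used with the exponent min(p, 2). All of
    this is done for a bounded Borel function equal to f almost everywhere; the integrals
    of f and of that function agree ([cintegral_ae], [pmean_mean]). *)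

(** * Bounded Borel functions *)

Section BoundedBorel.
Context {R : realType}.
Notation mu := (@lebesgue_measure R).
Implicit Types (u v : R -> R) (a b c d t : R).

(** Bounded Borel functions are closed under all operations below and integrable on
    every segment, so that no integrability has to be proved later. *)
Definition bounded_borel u : Prop :=
  measurable_fun [set: R] u /\ exists M : R, forall t, `|u t| <= M.

Lemma bb_cst c : bounded_borel (fun=> c).
Proof. by split; [exact: measurable_cst|exists `|c|]. Qed.

Lemma bbD u v : bounded_borel u -> bounded_borel v ->
  bounded_borel (fun t => u t + v t).
Proof.
move=> [mu1 [M hM]] [mv [N hN]]; split; first exact: measurable_funD.
by exists (M + N) => t; rewrite (le_trans (ler_normD _ _))// lerD.
Qed.

Lemma bbN u : bounded_borel u -> bounded_borel (fun t => - u t).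
Proof.
move=> [mu1 [M hM]]; split; first exact: measurableT_comp.
by exists M => t; rewrite normrN.
Qed.

Lemma bbB u v : bounded_borel u -> bounded_borel v ->
  bounded_borel (fun t => u t - v t).
Proof. by move=> bu bv; apply: bbD => //; exact: bbN. Qed.

Lemma bbM u v : bounded_borel u -> bounded_borel v ->
  bounded_borel (fun t => u t * v t).
Proof.
move=> [mu1 [M hM]] [mv [N hN]]; split; first exact: measurable_funM.
by exists (M * N) => t; rewrite normrM ler_pM.
Qed.

Lemma bb_norm u : bounded_borel u -> bounded_borel (fun t => `|u t|).
Proof.
move=> [mu1 [M hM]]; split; first exact: measurableT_comp.
by exists M => t; rewrite normr_id.
Qed.

Lemma bbX u n : bounded_borel u -> bounded_borel (fun t => u t ^+ n).
Proof.
move=> [mu1 [M hM]]; split; first exact: measurable_funX.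
by exists (M ^+ n) => t; rewrite normrX lerXn2r// ?nnegrE// (le_trans _ (hM t)).
Qed.

Lemma bb_sum (I : Type) (s : seq I) (P : pred I) (F : I -> R -> R) :
  (forall i, bounded_borel (F i)) -> bounded_borel (fun t => \sum_(i <- s | P i) F i t).
Proof.
move=> h; elim: s => [|i s ih].
  by under eq_fun do rewrite big_nil; exact: bb_cst.
under eq_fun do rewrite big_cons.
by case: (P i) => //; exact: bbD.
Qed.

Lemma bb_comp u (h : R -> R) : measurable_fun [set: R] h -> bounded_borel u ->
  bounded_borel (fun t => u (h t)).
Proof.
move=> mh [mu1 [M hM]]; split; last by exists M.
by apply: (@measurableT_comp _ _ _ _ _ _ u).
Qed.

Lemma bb_shift u c : bounded_borel u -> bounded_borel (fun t => u (t + c)).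
Proof. by apply: bb_comp; exact: measurable_funD. Qed.

Lemma bb_shiftl u c : bounded_borel u -> bounded_borel (fun t => u (c + t)).
Proof. by apply: bb_comp; exact: measurable_funD. Qed.

Lemma bb_refl u c : bounded_borel u -> bounded_borel (fun t => u (c - t)).
Proof. by apply: bb_comp; exact: measurable_funB. Qed.

Lemma bb_cos a b : bounded_borel (fun t => cos (a * t + b)).
Proof.
split; last first.
  by exists 1 => t; rewrite ler_norml cos_geN1 cos_le1.
apply: (@measurableT_comp _ _ _ _ _ _ (@cos R)).
  by apply: continuous_measurable_fun; exact: continuous_cos.
by apply: measurable_funD => //; exact: measurable_funM.
Qed.

Lemma bb_sin a b : bounded_borel (fun t => sin (a * t + b)).
Proof.
split; last first.
  by exists 1 => t; rewrite ler_norml sin_geN1 sin_le1.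
apply: (@measurableT_comp _ _ _ _ _ _ (@sin R)).
  by apply: continuous_measurable_fun; exact: continuous_sin.
by apply: measurable_funD => //; exact: measurable_funM.
Qed.

Lemma bb_indic (A : set R) : measurable A -> bounded_borel (\1_A : R -> R).
Proof.
move=> mA; split; first exact: measurable_indic.
by exists 1 => t; rewrite indicE; case: (_ \in _); rewrite ?normr1 ?normr0.
Qed.

Lemma bb_powR u (r : R) : 0 <= r -> bounded_borel u ->
  bounded_borel (fun t => `|u t| `^ r).
Proof.
move=> r0 bu; have [m1 [M hM]] := bb_norm bu.
split.
  by apply: (@measurableT_comp _ _ _ _ _ _ (@powR R ^~ r)) => //; exact: measurable_powR.
exists (M `^ r) => t.
rewrite ger0_norm ?powR_ge0// ge0_ler_powR//= ?nnegrE//.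
  by rewrite (le_trans _ (hM t)).
by move: (hM t); rewrite normr_id.
Qed.

(** * Integrals over segments *)

Definition integral_on a b u : R := \int[mu]_(t in `[a, b]) u t.

Local Notation itg := integral_on.

Lemma bb_integrable (a b : itv_bound R) u : bounded_borel u ->
  (mu [set` Interval a b] < +oo)%E ->
  mu.-integrable [set` Interval a b] (EFin \o u).
Proof.
move=> [m1 [M hM]] fin.
apply: (@le_integrable _ _ _ mu _ _ _ (EFin \o cst `|M|)) => //=.
- by apply/measurable_EFinP; exact: measurable_funS m1.
- by move=> t _; rewrite lee_fin/= normr_id (le_trans (hM t))// ler_norm.
- apply: measurable_bounded_integrable => //=.
  exists `| (`|M| : R) |; split; [exact: num_real|by move=> x Mx y _; exact: ltW].
Qed.

Lemma itv_finite (x y : bool) a b : (mu [set` Interval (BSide x a) (BSide y b)] < +oo)%E.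
Proof.
by rewrite lebesgue_measure_itv/=; case: ifP => _; rewrite ?ltry// -EFinB ltry.
Qed.

Lemma bb_itg a b u : bounded_borel u -> mu.-integrable `[a, b] (EFin \o u).
Proof.
by move=> bu; apply: bb_integrable => //; exact: itv_finite.
Qed.

Lemma itgD a b u v : bounded_borel u -> bounded_borel v ->
  itg a b (fun t => u t + v t) = itg a b u + itg a b v.
Proof. by move=> bu bv; rewrite /itg RintegralD//; exact: bb_itg. Qed.

Lemma itgB a b u v : bounded_borel u -> bounded_borel v ->
  itg a b (fun t => u t - v t) = itg a b u - itg a b v.
Proof. by move=> bu bv; rewrite /itg RintegralB//; exact: bb_itg. Qed.

Lemma itgZ a b c u : bounded_borel u -> itg a b (fun t => c * u t) = c * itg a b u.
Proof. by move=> bu; rewrite /itg RintegralZl//; exact: bb_itg. Qed.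

Lemma itgZr a b c u : bounded_borel u -> itg a b (fun t => u t * c) = itg a b u * c.
Proof. by move=> bu; rewrite /itg RintegralZr//; exact: bb_itg. Qed.

Lemma itgN a b u : bounded_borel u -> itg a b (fun t => - u t) = - itg a b u.
Proof.
move=> bu; rewrite -mulN1r -itgZ//; congr (itg a b _).
by apply/funext => t; rewrite mulN1r.
Qed.

Lemma itg_cst a b c : a <= b -> itg a b (fun=> c) = c * (b - a).
Proof.
move=> ab; rewrite /itg Rintegral_cst//.
rewrite /= lebesgue_measure_itv/= lte_fin.
move: ab; rewrite le_eqVlt => /predU1P[->|ab]; first by rewrite ltxx subrr.
by rewrite ab.
Qed.

Lemma itg0 a b : itg a b (fun=> 0) = 0.
Proof. by rewrite /itg Rintegral_cst// mul0r. Qed.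

Lemma itg_sum a b (I : Type) (s : seq I) (P : pred I) (F : I -> R -> R) :
  (forall i, bounded_borel (F i)) ->
  itg a b (fun t => \sum_(i <- s | P i) F i t) = \sum_(i <- s | P i) itg a b (F i).
Proof.
move=> h; elim: s => [|i s ih].
  by rewrite big_nil -[RHS](itg0 a b); congr itg; apply/funext => t; rewrite big_nil.
rewrite big_cons -ih; case: ifPn => Pi.
  rewrite -itgD//; last exact: bb_sum.
  by congr itg; apply/funext => t; rewrite big_cons Pi.
by congr itg; apply/funext => t; rewrite big_cons (negbTE Pi).
Qed.

Lemma eq_itg a b u v : (forall t, a <= t <= b -> u t = v t) -> itg a b u = itg a b v.
Proof.
by move=> uv; apply: eq_Rintegral => t; rewrite inE/= in_itv/= => /uv.
Qed.

Lemma le_itg a b u v : bounded_borel u -> bounded_borel v ->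
  (forall t, a <= t <= b -> u t <= v t) -> itg a b u <= itg a b v.
Proof.
by move=> bu bv uv; apply: le_Rintegral => //; exact: bb_itg.
Qed.

Lemma itg_ge0 a b u : (forall t, a <= t <= b -> 0 <= u t) -> 0 <= itg a b u.
Proof. by move=> h; apply: Rintegral_ge0 => t; rewrite /= in_itv/= => /h. Qed.

Lemma itg_norm a b u : bounded_borel u -> `|itg a b u| <= itg a b (fun t => `|u t|).
Proof. by move=> bu; apply: le_normr_Rintegral => //; exact: bb_itg. Qed.

Lemma itg_bound a b u M : bounded_borel u -> a <= b ->
  (forall t, a <= t <= b -> `|u t| <= M) -> `|itg a b u| <= M * (b - a).
Proof.
move=> bu ab h; rewrite (le_trans (itg_norm _ _ bu))// -itg_cst//.
by apply: le_itg => //; [exact: bb_norm|exact: bb_cst].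
Qed.

Lemma itg_point a u : itg a a u = 0.
Proof. by rewrite /itg set_itv1 Rintegral_set1. Qed.

Lemma itg_gt a b u : b < a -> itg a b u = 0.
Proof. by move=> ba; rewrite /itg set_itv_ge ?Rintegral_set0// bnd_simp -ltNge. Qed.

Lemma itg_cat b a c u : bounded_borel u -> a <= b -> b <= c ->
  itg a c u = itg a b u + itg b c u.
Proof.
move=> bu ab bc.
have := @Rintegral_itvB _ u (BLeft a) (BRight c) b (bb_itg a c bu).
rewrite !bnd_simp => /(_ ab bc); rewrite /itg => /eqP.
rewrite subr_eq => /eqP ->; rewrite addrC; congr (_ + _).
rewrite Rintegral_itv_obnd_cbnd//.
by apply: bb_integrable => //; exact: itv_finite.
Qed.

Lemma itg_mono a b c d u : bounded_borel u -> (forall t, c <= t <= d -> 0 <= u t) ->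
  c <= a -> b <= d -> itg a b u <= itg c d u.
Proof.
move=> bu u0 ca bd; have [ab|ba] := leP a b; last first.
  by rewrite itg_gt// itg_ge0.
rewrite (itg_cat bu ca (le_trans ab bd)) (itg_cat bu ab bd).
rewrite addrCA lerDl addr_ge0// itg_ge0// => t /andP[h1 h2]; apply: u0.
  by rewrite h1 (le_trans h2)// (le_trans ab).
by rewrite (le_trans ca) ?(le_trans ab).
Qed.

Lemma lebesgue_measure_shift c (A : set R) : measurable A ->
  pushforward mu ((fun t => t + c) : _ -> measurableTypeR R) A = mu A.
Proof.
move=> mA; apply/esym/lebesgue_measure_unique => //=.
  by rewrite -[X in measurable_fun X _]/setT; exact: measurable_funD.
move=> mX _ [[a b]] _ <-; rewrite /pushforward.
have -> : (fun t => t + c) @^-1` `]a, b]%classic = `]a - c, b - c]%classic.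
  by apply/seteqP; split => t /=; rewrite !in_itv/= ltrBlDr lerBrDr.
rewrite !lebesgue_measure_itv/= !lte_fin ltrD2r.
by case: ifP => // _; congr EFin; lra.
Qed.

Lemma itg_pushforward (h : R -> R) (D : set R) u : bounded_borel u ->
  measurable_fun [set: R] h -> measurable D -> mu.-integrable (h @^-1` D) (EFin \o u \o h) ->
  (forall A, measurable A -> pushforward mu (h : _ -> measurableTypeR R) A = mu A) ->
  \int[mu]_(t in D) u t = \int[mu]_(t in h @^-1` D) u (h t).
Proof.
move=> [mu1 _] mh mD ih hA; rewrite /Rintegral; congr fine.
transitivity (\int[pushforward mu (h : _ -> measurableTypeR R)]_(t in D) (u t)%:E)%E.
  by apply: eq_measure_integral => //= A mA AS; exact/esym/hA.
have muE : measurable_fun [set: R] (EFin \o u) by exact/measurable_EFinP.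
exact: (@integral_pushforward _ _ (measurableTypeR R) (measurableTypeR R) R h mh mu D (EFin \o u) muE ih mD).
Qed.

Lemma itg_shift a b c u : bounded_borel u ->
  itg a b (fun t => u (t + c)) = itg (a + c) (b + c) u.
Proof.
move=> bu; rewrite /itg.
have e : (fun t => t + c) @^-1` `[a + c, b + c]%classic = `[a, b]%classic.
  by apply/seteqP; split => t /=; rewrite !in_itv/= !lerD2r.
rewrite [RHS](@itg_pushforward (fun t => t + c))// ?e//.
- exact: measurable_funD.
- by apply: (@bb_itg a b (fun t => u (t + c))); exact: bb_shift.
- exact: lebesgue_measure_shift.
Qed.

Lemma itg_refl a b u : bounded_borel u ->
  itg a b (fun t => u (- t)) = itg (- b) (- a) u.
Proof.
move=> bu; rewrite /itg.
have e : -%R @^-1` `[- b, - a]%classic = `[a, b]%classic :> set R.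
  by apply/seteqP; split => t /=; rewrite !in_itv/= !lerN2 andbC.
rewrite [RHS](@itg_pushforward -%R)// ?e//.
- apply: (@bb_itg a b (fun t => u (- t))).
  have -> : (fun t => u (- t)) = (fun t => u (0 - t)) by apply/funext => t; rewrite sub0r.
  exact: bb_refl.
- exact: lebesgue_measureN.
Qed.

Lemma eq_itg_ae a b u v : bounded_borel u -> bounded_borel v ->
  (\forall t \ae mu, u t = v t) -> itg a b u = itg a b v.
Proof.
move=> [m1 _] [m2 _] uv; rewrite /itg /Rintegral; congr fine.
apply: ae_eq_integral => //.
- by apply/measurable_EFinP; exact: measurable_funS m1.
- by apply/measurable_EFinP; exact: measurable_funS m2.
- by apply: (@filterS _ _ (ae_filter_ringOfSetsType mu) _ _ _ uv) => t /= ->.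
Qed.

Lemma bb_cont u M : continuous u -> (forall t, `|u t| <= M) -> bounded_borel u.
Proof. by move=> cu hM; split; [exact: continuous_measurable_fun|exists M]. Qed.

Lemma itg_Fubini a b c d (K : R -> R -> R) (M : R) :
  measurable_fun [set: R * R] (fun z => K z.1 z.2) ->
  (forall x t, `|K x t| <= M) ->
  itg a b (fun x => itg c d (fun t => K x t)) =
  itg c d (fun t => itg a b (fun x => K x t)).
Proof.
move=> mK hM.
have b1 x : bounded_borel (K x).
  split; last by exists M.
  exact: (measurableT_comp mK (pair1_measurable x)).
have b2 t : bounded_borel (K ^~ t).
  split; last by exists M.
  exact: (measurableT_comp mK (pair2_measurable t)).
pose f (z : R * R) : \bar R := (K z.1 z.2 * (\1_`[a, b] z.1 * \1_`[c, d] z.2))%:E.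
have mf : measurable_fun [set: R * R] f.
  apply/measurable_EFinP; apply: measurable_funM => //.
  by apply: measurable_funM; apply: measurableT_comp => //; exact: measurable_indic.
have finI (l r : R) : (mu `[l, r] < +oo)%E by exact: itv_finite.
have If : (mu \x mu)%E.-integrable setT f.
  have -> : f = (EFin \o (fun z => K z.1 z.2)) \_ (`[a, b] `*` `[c, d]).
    apply/funext => -[x t]; rewrite patchE/= /f/= !indicE in_setX/=.
    by case: (x \in _); case: (t \in _); rewrite ?mulr1 ?mulr0 ?mul0r.
  apply: (integrable_mkcond _ _).1; first by apply: measurableX.
  apply: measurable_bounded_integrable => //=.
  - exact: measurableX.
  - by rewrite product_measure1E//; apply: lte_mul_pinfty => //; rewrite ?ge0_fin_numE//; exact: finI.
  - by apply: measurable_funS mK => //; exact: measurableT.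
  - by exists M; split; [exact: num_real|move=> y My z _ /=; rewrite (le_trans (hM _ _))// ltW].
have iE (l r : R) (u : R -> R) : bounded_borel u ->
    (\int[mu]_t (u t * \1_`[l, r] t)%:E = (itg l r u)%:E)%E.
  move=> bu; rewrite /itg /Rintegral fineK; last exact: integrable_fin_num (bb_itg _ _ bu).
  rewrite [RHS]integral_mkcond; apply: eq_integral => t _.
  by rewrite patchE indicE; case: ifP => _; rewrite ?mulr1 ?mulr0.
have H1 x : (\int[mu]_t f (x, t) = (itg c d (K x) * \1_`[a, b] x)%:E)%E.
  rewrite /f/= [in RHS]indicE; case: (boolP (x \in _)) => hx.
    by rewrite mulr1 -iE//; apply: eq_integral => t _; rewrite indicE hx mul1r.
  by rewrite mulr0; apply: integral0_eq => t _; rewrite indicE (negbTE hx) mul0r mulr0.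
have H2 t : (\int[mu]_x f (x, t) = (itg a b (K ^~ t) * \1_`[c, d] t)%:E)%E.
  rewrite /f/= [in RHS]indicE; case: (boolP (t \in _)) => ht.
    by rewrite mulr1 -iE//; apply: eq_integral => x _; rewrite [\1_`[c, d] t]indicE ht mulr1.
  by rewrite mulr0; apply: integral0_eq => x _; rewrite [\1_`[c, d] t]indicE (negbTE ht) !mulr0.
have E (l r : R) (u : R -> R) : itg l r u = fine (\int[mu]_t (u t * \1_`[l, r] t)%:E)%E.
  rewrite /itg /Rintegral; congr fine.
  rewrite integral_mkcond; apply: eq_integral => t _.
  by rewrite patchE indicE; case: ifP => _; rewrite ?mulr1 ?mulr0.
rewrite !E; congr fine.
under eq_integral do rewrite -H1.
by rewrite (Fubini If); under eq_integral do rewrite H2.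
Qed.

End BoundedBorel.

(** * Modulus and parts of complex numbers *)

Section ComplexIntegral.
Context {R : realType}.
Notation itg := (@integral_on R).
Notation normc := (@ComplexField.Normc.normc R).
Implicit Types (f g : R -> R[i]) (z : R[i]) (a b c d t l : R).

Lemma normcE z : normc z = `|(z : Rcomplex R)|.
Proof. by []. Qed.

Lemma normc_ge0 z : 0 <= normc z.
Proof. by rewrite normcE. Qed.

Lemma normcD z1 z2 : normc (z1 + z2) <= normc z1 + normc z2.
Proof. exact: le_normcD. Qed.

Lemma normcB z1 z2 : normc (z1 - z2) <= normc z1 + normc z2.
Proof. by rewrite -[normc z2]normcN; exact: le_normcD. Qed.

Lemma normcBC z1 z2 : normc (z1 - z2) = normc (z2 - z1).
Proof. by rewrite -normcN opprB. Qed.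

Lemma normc_tri z2 z1 z3 : normc (z1 - z3) <= normc (z1 - z2) + normc (z2 - z3).
Proof. by rewrite (_ : z1 - z3 = (z1 - z2) + (z2 - z3)) ?normcD//; ring. Qed.

Lemma normc_le z1 z2 : normc z1 <= normc z2 + normc (z1 - z2).
Proof. by rewrite -{1}[z1](addrNK z2) addrC normcD. Qed.

Lemma normcM z1 z2 : normc (z1 * z2) = normc z1 * normc z2.
Proof. exact: ComplexField.Normc.normcM. Qed.

Lemma normcR (x : R) : normc x%:C = `|x|.
Proof. by rewrite /ComplexField.Normc.normc/= expr0n/= addr0 sqrtr_sqr. Qed.

Lemma normcZ (x : R) z : normc (x%:C * z) = `|x| * normc z.
Proof. by rewrite normcM normcR. Qed.

Lemma normc_eq0 z : (normc z == 0) = (z == 0).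
Proof.
apply/eqP/eqP; first exact: ComplexField.Normc.eq0_normc.
by move=> ->; rewrite (normcR 0) normr0.
Qed.

Lemma normc_Re z : `|complex.Re z| <= normc z.
Proof.
case: z => x y /=; rewrite -sqrtr_sqr ler_wsqrtr// lerDl sqr_ge0//.
Qed.

Lemma normc_Im z : `|complex.Im z| <= normc z.
Proof.
case: z => x y /=; rewrite -sqrtr_sqr ler_wsqrtr// lerDr sqr_ge0//.
Qed.

Lemma complex_ReIm z : z = (complex.Re z)%:C + 'i * (complex.Im z)%:C.
Proof. exact: complexE. Qed.

Lemma normc_ReIm z : normc z <= `|complex.Re z| + `|complex.Im z|.
Proof.
rewrite {1}[z]complex_ReIm (le_trans (normcD _ _))// normcM !normcR.
rewrite (_ : normc 'i = 1) ?mul1r//.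
by rewrite /ComplexField.Normc.normc/= expr0n/= add0r expr1n sqrtr1.
Qed.

Lemma normc_sqr z : normc z ^+ 2 = complex.Re z ^+ 2 + complex.Im z ^+ 2.
Proof. by case: z => x y /=; rewrite sqr_sqrtr// addr_ge0// sqr_ge0. Qed.

Lemma cReM z1 z2 : complex.Re (z1 * z2) =
  complex.Re z1 * complex.Re z2 - complex.Im z1 * complex.Im z2.
Proof. by case: z1 z2 => [a b] [c d]. Qed.

Lemma cImM z1 z2 : complex.Im (z1 * z2) =
  complex.Re z1 * complex.Im z2 + complex.Im z1 * complex.Re z2.
Proof. by case: z1 z2 => [a b] [c d]. Qed.

Lemma cReD z1 z2 : complex.Re (z1 + z2) = complex.Re z1 + complex.Re z2.
Proof. by case: z1 z2 => [a b] [c d]. Qed.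

Lemma cImD z1 z2 : complex.Im (z1 + z2) = complex.Im z1 + complex.Im z2.
Proof. by case: z1 z2 => [a b] [c d]. Qed.

Lemma cReN z : complex.Re (- z) = - complex.Re z.
Proof. by case: z. Qed.

Lemma cImN z : complex.Im (- z) = - complex.Im z.
Proof. by case: z. Qed.

Lemma cReB z1 z2 : complex.Re (z1 - z2) = complex.Re z1 - complex.Re z2.
Proof. by rewrite cReD cReN. Qed.

Lemma cImB z1 z2 : complex.Im (z1 - z2) = complex.Im z1 - complex.Im z2.
Proof. by rewrite cImD cImN. Qed.

Lemma complex_eq z1 z2 : complex.Re z1 = complex.Re z2 -> complex.Im z1 = complex.Im z2 -> z1 = z2.
Proof. by case: z1 z2 => [a b] [c d] /= -> ->. Qed.

(** * Exponentials *)

Lemma expiD a b : expi (a + b) = expi a * expi b.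
Proof. by apply: complex_eq; rewrite ?cReM ?cImM /= ?cosD ?sinD; ring. Qed.

Lemma expi0 : expi (0 : R) = 1.
Proof. by rewrite /expi cos0 sin0. Qed.

Lemma normc_expi a : normc (expi a) = 1.
Proof. by rewrite /= cos2Dsin2 sqrtr1. Qed.

Lemma cos_lip a b : `|cos a - cos b| <= `|a - b|.
Proof.
wlog ab : a b / a < b.
  move=> h; have [/h//|/h|->] := ltgtP a b; first by rewrite distrC [`|b - a|]distrC.
  by rewrite !subrr.
have [c _ h] : exists2 c, c \in `]a, b[ & cos b - cos a = (fun x => - sin x) c * (b - a).
  apply: MVT => //.
  by apply: continuous_subspaceT => x; exact: continuous_cos.
rewrite -normrN opprB h normrM normrN [leRHS]distrC ler_piMl//.
by rewrite ler_norml sin_geN1 sin_le1.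
Qed.

Lemma sin_lip a b : `|sin a - sin b| <= `|a - b|.
Proof.
wlog ab : a b / a < b.
  move=> h; have [/h//|/h|->] := ltgtP a b; first by rewrite distrC [`|b - a|]distrC.
  by rewrite !subrr.
have [c _ h] : exists2 c, c \in `]a, b[ & sin b - sin a = cos c * (b - a).
  apply: MVT => //.
  by apply: continuous_subspaceT => x; exact: continuous_sin.
rewrite -normrN opprB h normrM [leRHS]distrC ler_piMl//.
by rewrite ler_norml cos_geN1 cos_le1.
Qed.

Lemma expi_lip a b : normc (expi a - expi b) <= 2 * `|a - b|.
Proof.
rewrite (le_trans (normc_ReIm _))// cReB cImB/=.
by have := cos_lip a b; have := sin_lip a b; lra.
Qed.

(** * Complex integrals over segments *)

Definition bounded_borelc f : Prop :=
  bounded_borel (fun t => complex.Re (f t)) /\ bounded_borel (fun t => complex.Im (f t)).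

Definition cintegral_on a b f : R[i] :=
  itg a b (fun t => complex.Re (f t)) +i* itg a b (fun t => complex.Im (f t)).

Local Notation bbc := bounded_borelc.
Local Notation citg := cintegral_on.

Lemma citgE a b f : citg a b f = cintegral `[a, b] f.
Proof. by []. Qed.

Lemma bbc_cst z : bbc (fun=> z).
Proof. by split; exact: bb_cst. Qed.

Lemma bbcD f g : bbc f -> bbc g -> bbc (fun t => f t + g t).
Proof.
move=> [f1 f2] [g1 g2]; split.
- by under eq_fun do rewrite cReD; exact: bbD.
- by under eq_fun do rewrite cImD; exact: bbD.
Qed.

Lemma bbcN f : bbc f -> bbc (fun t => - f t).
Proof.
move=> [f1 f2]; split.
- by under eq_fun do rewrite cReN; exact: bbN.
- by under eq_fun do rewrite cImN; exact: bbN.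
Qed.

Lemma bbcB f g : bbc f -> bbc g -> bbc (fun t => f t - g t).
Proof. by move=> bf bg; apply: bbcD => //; exact: bbcN. Qed.

Lemma bbcM f g : bbc f -> bbc g -> bbc (fun t => f t * g t).
Proof.
move=> [f1 f2] [g1 g2]; split.
- by under eq_fun do rewrite cReM; apply: bbB; exact: bbM.
- by under eq_fun do rewrite cImM; apply: bbD; exact: bbM.
Qed.

Lemma bbc_comp f (h : R -> R) : measurable_fun [set: R] h -> bbc f -> bbc (fun t => f (h t)).
Proof. by move=> mh [f1 f2]; split; [exact: (bb_comp mh f1)|exact: (bb_comp mh f2)]. Qed.

Lemma bbc_shift f c : bbc f -> bbc (fun t => f (t + c)).
Proof. by apply: bbc_comp; exact: measurable_funD. Qed.

Lemma bbc_shiftl f c : bbc f -> bbc (fun t => f (c + t)).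
Proof. by apply: bbc_comp; exact: measurable_funD. Qed.

Lemma bbc_expi a b : bbc (fun t => expi (a * t + b)).
Proof. by split => /=; [exact: bb_cos|exact: bb_sin]. Qed.

Lemma bbc_expiN l : bbc (fun t => expi (- (l * t))).
Proof.
have := bbc_expi (- l) 0; congr bbc; apply/funext => t.
by rewrite addr0 mulNr.
Qed.

Lemma bbc_real (u : R -> R) : bounded_borel u -> bbc (fun t => (u t)%:C).
Proof. by move=> bu; split => //=; exact: bb_cst. Qed.

Lemma bbc_norm f : bbc f -> bounded_borel (fun t => normc (f t)).
Proof.
move=> [[m1 [M hM]] [m2 [N hN]]]; split; last first.
  exists (M + N) => t; rewrite ger0_norm ?normc_ge0//.
  by rewrite (le_trans (normc_ReIm _))// lerD.
rewrite (_ : (fun t => _) =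
    (fun t => (complex.Re (f t) ^+ 2 + complex.Im (f t) ^+ 2) `^ (2^-1))).
  apply: (@measurableT_comp _ _ _ _ _ _ (@powR R ^~ _)); first exact: measurable_powR.
  by apply: measurable_funD; exact: measurable_funX.
apply/funext => t; rewrite powR12_sqrt ?addr_ge0 ?sqr_ge0//.
by case: (f t).
Qed.

Lemma citgD a b f g : bbc f -> bbc g ->
  citg a b (fun t => f t + g t) = citg a b f + citg a b g.
Proof.
move=> [f1 f2] [g1 g2]; apply: complex_eq; rewrite ?cReD ?cImD/= -itgD//;
by congr itg; apply/funext => t; rewrite ?cReD ?cImD.
Qed.

Lemma citgB a b f g : bbc f -> bbc g ->
  citg a b (fun t => f t - g t) = citg a b f - citg a b g.
Proof.
move=> [f1 f2] [g1 g2]; apply: complex_eq; rewrite ?cReB ?cImB/= -itgB//;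
by congr itg; apply/funext => t; rewrite ?cReB ?cImB.
Qed.

Lemma citgZ a b z f : bbc f -> citg a b (fun t => z * f t) = z * citg a b f.
Proof.
move=> [f1 f2]; apply: complex_eq; rewrite ?cReM ?cImM/= -!itgZ//.
- by rewrite -itgB; [congr itg; apply/funext => t; rewrite cReM|apply: bbM => //; exact: bb_cst..].
- by rewrite -itgD; [congr itg; apply/funext => t; rewrite cImM|apply: bbM => //; exact: bb_cst..].
Qed.

Lemma eq_citg a b f g : (forall t, a <= t <= b -> f t = g t) -> citg a b f = citg a b g.
Proof. by move=> fg; apply: complex_eq => /=; apply: eq_itg => t /fg ->. Qed.

Lemma citg_cat b a c f : bbc f -> a <= b -> b <= c -> citg a c f = citg a b f + citg b c f.
Proof.
by move=> [f1 f2] ab bc; apply: complex_eq; rewrite ?cReD ?cImD/= (itg_cat _ ab bc).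
Qed.

Lemma citg_shift a b c f : bbc f -> citg a b (fun t => f (t + c)) = citg (a + c) (b + c) f.
Proof. by move=> [f1 f2]; apply: complex_eq => /=; rewrite -itg_shift. Qed.

Lemma citg_cst a b z : a <= b -> citg a b (fun=> z) = (b - a)%:C * z.
Proof.
by move=> ab; apply: complex_eq; rewrite ?cReM ?cImM/= itg_cst//; ring.
Qed.

Lemma citg_norm a b f : bbc f -> normc (citg a b f) <= itg a b (fun t => normc (f t)).
Proof.
move=> bf; set z := citg a b f.
have [z0|z0] := eqVneq z 0.
  by rewrite z0 (normcR 0) normr0; apply: itg_ge0 => t _; exact: normc_ge0.
have nz : normc z != 0 by rewrite normc_eq0.
pose k : R[i] := ((normc z)^-1)%:C * conjc z.
have kz : k * z = (normc z)%:C.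
  have := normc_sqr z; move: nz; rewrite /k; case: (z) => x y /= nz0 h.
  apply: complex_eq; rewrite !(cReM, cImM)/=.
    transitivity ((Num.sqrt (x ^+ 2 + y ^+ 2))^-1 * (x ^+ 2 + y ^+ 2)); first by ring.
    by rewrite -[X in _ * X]h expr2 mulrA mulVf ?mul1r.
  by ring.
have nk : normc k = 1.
  rewrite /k normcZ (_ : normc (conjc z) = normc z); last first.
    by case: (z) => x y /=; rewrite sqrrN.
  by rewrite ger0_norm ?invr_ge0 ?normc_ge0// mulVf.
have -> : normc z = complex.Re (citg a b (fun t => k * f t)) by rewrite citgZ// kz.
have bkf : bbc (fun t => k * f t) by apply: bbcM => //; exact: bbc_cst.
apply: le_itg => //; [by case: bkf|exact: bbc_norm|].
move=> t _; rewrite (le_trans (ler_norm _))// (le_trans (normc_Re _))//.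
by rewrite normcM nk mul1r.
Qed.

Lemma citg_bound a b f M : bbc f -> a <= b ->
  (forall t, a <= t <= b -> normc (f t) <= M) -> normc (citg a b f) <= M * (b - a).
Proof.
move=> bf ab h; rewrite (le_trans (citg_norm _ _ bf))// -itg_cst//.
by apply: le_itg => //; [exact: bbc_norm|exact: bb_cst].
Qed.

Lemma citg_point a f : citg a a f = 0.
Proof. by apply: complex_eq => /=; rewrite itg_point. Qed.

Lemma citg_move a b a' b' f M : bbc f -> (forall t, normc (f t) <= M) ->
  a <= b -> a' <= b' ->
  normc (citg a b f - citg a' b' f) <= M * (`|a - a'| + `|b - b'|).
Proof.
move=> bf hM ab ab'.
pose c := Num.min a a'.
have ca : c <= a by rewrite ge_min lexx.
have ca' : c <= a' by rewrite ge_min lexx orbT.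
have E x y : c <= x -> x <= y -> citg x y f = citg c y f - citg c x f.
  by move=> cx xy; rewrite (citg_cat bf cx xy) addrC addKr.
have P x y : c <= x -> c <= y -> normc (citg c x f - citg c y f) <= M * `|x - y|.
  wlog xy : x y / x <= y.
    move=> h cx cy; have [xy|yx] := leP x y; first exact: h.
    by rewrite normcBC distrC; apply: h => //; exact: ltW.
  move=> cx cy; rewrite normcBC -E// distrC ger0_norm ?subr_ge0//.
  exact: citg_bound.
rewrite E// (E a')//.
have -> : citg c b f - citg c a f - (citg c b' f - citg c a' f) =
   (citg c b f - citg c b' f) - (citg c a f - citg c a' f) by ring.
rewrite (le_trans (normcB _ _))// mulrDr addrC lerD// P//.
  exact: le_trans ca ab.
exact: le_trans ca' ab'.
Qed.

End ComplexIntegral.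

(** * Mean values of almost periodic functions *)

Section MeanValue.
Context {R : realType}.
Notation itg := (@integral_on R).
Notation citg := (@cintegral_on R).
Notation bbc := (@bounded_borelc R).
Notation normc := (@ComplexField.Normc.normc R).
Implicit Types (f g : R -> R[i]) (z : R[i]) (a b c d t l : R).

Lemma cauchy_real (h : R -> R) :
  (forall e : R, 0 < e -> exists L0, forall L L', L0 <= L -> L0 <= L' -> `|h L - h L'| <= e) ->
  exists A, forall e : R, 0 < e -> exists L0, forall L, L0 <= L -> `|h L - A| <= e.
Proof.
move=> H.
have /cauchy_cvgP cvh : cauchy (h @ +oo).
  apply/cauchyP => e e0; have [|L0 hL0] := H (e / 2); first lra.
  exists (h L0); change (\forall x \near +oo, ball (h L0) e (h x)).
  near=> L; rewrite /ball/=.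
  have : `|h L0 - h L| <= e / 2.
    by apply: hL0 => //; near: L; apply: nbhs_pinfty_ge; exact: num_real.
  by move=> ?; lra.
exists (lim (h @ +oo)) => e e0; have [|L0 hL0] := H (e / 2); first lra.
exists L0 => L L0L.
have e2 : 0 < e / 2 by lra.
have hn : \forall x \near +oo, `|lim (h @ +oo) - h x| <= e / 2.
  by move/cvgrPdist_le : cvh; exact.
near (pinfty_nbhs R) => L'.
have h1 : `|lim (h @ +oo) - h L'| <= e / 2 by near: L'.
have h2 : `|h L - h L'| <= e / 2.
  by apply: hL0 => //; near: L'; apply: nbhs_pinfty_ge; exact: num_real.
rewrite (_ : _ - _ = (h L - h L') - (lim (h @ +oo) - h L')); last by ring.
by rewrite (le_trans (ler_normB _ _))//; lra.
Unshelve. all: by end_near. Qed.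

Lemma cauchy_complex (h : R -> R[i]) :
  (forall e : R, 0 < e -> exists L0, forall L L', L0 <= L -> L0 <= L' -> normc (h L - h L') <= e) ->
  exists A, forall e : R, 0 < e -> exists L0, forall L, L0 <= L -> normc (h L - A) <= e.
Proof.
move=> H.
have [|a ha] := @cauchy_real (fun L => complex.Re (h L)).
  move=> e /H[L0 hL0]; exists L0 => L L' h1 h2.
  by rewrite -cReB (le_trans (normc_Re _))// hL0.
have [|b hb] := @cauchy_real (fun L => complex.Im (h L)).
  move=> e /H[L0 hL0]; exists L0 => L L' h1 h2.
  by rewrite -cImB (le_trans (normc_Im _))// hL0.
exists (a +i* b) => e e0.
have [|L1 h1] := ha (e / 2); first lra.
have [|L2 h2] := hb (e / 2); first lra.
exists (Num.max L1 L2) => L; rewrite ge_max => /andP[/h1 {}h1 /h2 {}h2].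
by rewrite (le_trans (normc_ReIm _))// cReB cImB/=; lra.
Qed.

(** Almost periodicity in the mean over unit intervals, which membership in
    any Stepanov class implies; it does not depend on the values on a null set. *)
Definition ap_shift f (e tau : R) : Prop :=
  forall y, itg y (y + 1) (fun t => normc (f (t + tau) - f t)) <= e.

Definition mean_ap f : Prop := forall e : R, 0 < e -> relatively_dense [set tau | ap_shift f e tau].

Definition fint f l a b := citg a b (fun t => f t * expi (- (l * t))).

Variables (f : R -> R[i]) (M : R).
Hypothesis bf : bbc f.
Hypothesis fM : forall t, normc (f t) <= M.

Let M0 : 0 <= M. Proof. by rewrite (le_trans _ (fM 0))// normc_ge0. Qed.

Lemma bbc_fexp l : bbc (fun t => f t * expi (- (l * t))).
Proof. by apply: bbcM => //; exact: bbc_expiN. Qed.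

Let bfe := bbc_fexp.

Let feM l t : normc (f t * expi (- (l * t))) <= M.
Proof. by rewrite normcM normc_expi mulr1. Qed.

Lemma fint_cat l b a c : a <= b -> b <= c -> fint f l a c = fint f l a b + fint f l b c.
Proof. by move=> ab bc; exact: (citg_cat (bfe l)). Qed.

Lemma fint_bound l a b : a <= b -> normc (fint f l a b) <= M * (b - a).
Proof. by move=> ab; apply: citg_bound. Qed.

Lemma fint_move l a b a' b' : a <= b -> a' <= b' ->
  normc (fint f l a b - fint f l a' b') <= M * (`|a - a'| + `|b - b'|).
Proof. by move=> ab ab'; apply: citg_move. Qed.

Lemma bb_diff tau : bounded_borel (fun t => normc (f (t + tau) - f t)).
Proof. by apply: bbc_norm; apply: bbcB => //; exact: bbc_shift. Qed.

Lemma ap_shift_ge0 e tau : ap_shift f e tau -> 0 <= e.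
Proof. by move=> /(_ 0); apply: le_trans; apply: itg_ge0 => t _; exact: normc_ge0. Qed.

Lemma itg_unit_cover (u : R -> R) (e : R) a b : bounded_borel u -> (forall t, 0 <= u t) ->
  (forall y, itg y (y + 1) u <= e) -> a <= b -> itg a b u <= e * (b - a + 1).
Proof.
move=> bu u0 h ab.
have e0 : 0 <= e by rewrite (le_trans _ (h 0))// itg_ge0.
have H n : itg a (a + n%:R) u <= e * n%:R.
  elim: n => [|n ih]; first by rewrite addr0 itg_point mulr0.
  rewrite (@itg_cat _ (a + n%:R))//; last 2 first.
  - by rewrite lerDl.
  - by rewrite lerD2l ler_nat.
  rewrite -natr1 mulrDr mulr1 lerD// addrA; exact: h.
have ba0 : 0 <= b - a by rewrite subr_ge0.
have /andP[h1 h2] := truncn_itv ba0.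
set n := Num.truncn (b - a) in h1 h2.
apply: (@le_trans _ _ (itg a (a + n.+1%:R) u)).
  by apply: itg_mono => //; lra.
apply: (le_trans (H _)); rewrite ler_wpM2l// -natr1; lra.
Qed.

Lemma fint_shift l a b e tau : a <= b -> ap_shift f e tau ->
  normc (fint f l (a + tau) (b + tau) - expi (- (l * tau)) * fint f l a b) <= e * (b - a + 1).
Proof.
move=> ab ap.
rewrite /fint -citg_shift// -citgZ//.
have b1 : bbc (fun t => f (t + tau) * expi (- (l * (t + tau)))).
  exact: (bbc_shift tau (bfe l)).
have b2 : bbc (fun t => expi (- (l * tau)) * (f t * expi (- (l * t)))).
  by apply: bbcM => //; exact: bbc_cst.
rewrite -citgB//; apply: (le_trans (citg_norm _ _ (bbcB b1 b2))).
apply: (@le_trans _ _ (itg a b (fun t => normc (f (t + tau) - f t)))); last first.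
  apply: itg_unit_cover => //; first exact: bb_diff.
  by move=> t; exact: normc_ge0.
apply: le_itg; [exact: bbc_norm (bbcB b1 b2)|exact: bb_diff|] => t _.
have -> : - (l * (t + tau)) = - (l * tau) + - (l * t) by ring.
rewrite expiD mulrCA -mulrBr -mulrBl !normcM !normc_expi mulr1 mul1r//.
Qed.

Lemma fint_phase l e tau B : 0 <= B -> ap_shift f e tau ->
  normc (1 - expi (- (l * tau))) * normc (fint f l 0 B) <= e * (B + 1) + 2 * M * `|tau|.
Proof.
move=> B0 ap; have := fint_shift l B0 ap; rewrite add0r subr0 => h1.
have h2 : normc (fint f l 0 B - fint f l tau (B + tau)) <= M * (`|tau| + `|tau|).
  rewrite (le_trans (@fint_move _ _ _ _ _ _ _))//; first lra.
  by rewrite sub0r normrN opprD addNKr normrN.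
rewrite -normcM mulrBl mul1r.
rewrite (le_trans (@normc_tri _ (fint f l tau (B + tau)) _ _))//.
by move: h1 h2; lra.
Qed.

Hypothesis fap : mean_ap f.

(** A translation number near a moves the window [a, a+B] back to [0, B], turning the
    integral by a phase only; the constant K does not depend on the frequency. *)
Lemma fint_translate (e : R) : 0 < e -> exists2 K : R, 0 <= K &
  forall l a B, 0 <= B -> normc (fint f l a (a + B)) <= normc (fint f l 0 B) + e * B + K.
Proof.
move=> e0; have [d [d0 hd]] := fap e0.
exists (e + 2 * M * d); first by rewrite addr_ge0// ?mulr_ge0// ltW.
move=> l a B B0; have [tau [/andP[t1 t2] ap]] := hd a.
have := fint_shift l B0 ap; rewrite add0r subr0 => h1.
have h2 : normc (fint f l a (a + B) - fint f l tau (B + tau)) <= M * (d + d).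
  rewrite (le_trans (@fint_move _ _ _ _ _ _ _))//; [lra|lra|].
  by apply: ler_wpM2l => //; apply: lerD; rewrite ler_norml; apply/andP; split; lra.
have h3 := normc_le (fint f l a (a + B)) (fint f l tau (B + tau)).
have h4 := normc_le (fint f l tau (B + tau)) (expi (- (l * tau)) * fint f l 0 B).
by move: h4; rewrite normcM normc_expi mul1r => h4; lra.
Qed.

(** If the integrals over [0, B] do not become negligible, a translation number tau
    must nearly preserve the phase exp(i l tau); all windows of the same length
    then have nearly the same integral, and an almost additive function of the
    length is almost linear. *)
Lemma fint_linear l (eta : R) : 0 < eta ->
  (forall B0, exists2 B, B0 <= B & eta * B <= normc (fint f l 0 B)) ->
  forall e : R, 0 < e -> exists c : R[i], exists2 K : R, 0 <= K & forall L, 0 <= L ->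
    normc (fint f l 0 L - L%:C * c) <= e * L + K.
Proof.
move=> eta0 hB e e0.
have M0' : 0 <= M by exact: M0.
pose e1 := Num.min (e / 4) (e * eta / (4 * (M + 1))).
have e10 : 0 < e1 by rewrite lt_min !divr_gt0 ?mulr_gt0//; lra.
have [d [d0 hd]] := fap e10.
have phase tau : ap_shift f e1 tau -> normc (1 - expi (- (l * tau))) * eta <= e1.
  move=> ap; apply/ler_addgt0Pr => k k0; rewrite leNgt; apply/negP => hk.
  set n := normc _ in hk.
  have [B hB1 hB2] := hB (Num.max 1 ((e1 + 2 * M * `|tau| + 1) / k)).
  move: hB1; rewrite ge_max => /andP[B1 hB1].
  have := @fint_phase l e1 tau B (le_trans ler01 B1) ap.
  rewrite -/n => h.
  have n0 : 0 <= n by exact: normc_ge0.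
  have : n * (eta * B) <= n * normc (fint f l 0 B) by exact: ler_wpM2l.
  move: hB1; rewrite ler_pdivrMr// => hB1.
  have : (e1 + k) * B < n * eta * B by rewrite ltr_pM2r//; lra.
  by move=> *; lra.
have tr a B : 0 <= B -> normc (fint f l a (a + B) - fint f l 0 B) <= e / 2 * B + (2 * M * d + e1).
  move=> B0; have [tau [/andP[t1 t2] ap]] := hd a.
  have := fint_shift l B0 ap; rewrite add0r subr0 => h1.
  have h2 : normc (fint f l a (a + B) - fint f l tau (B + tau)) <= M * (d + d).
    rewrite (le_trans (@fint_move _ _ _ _ _ _ _))//; [lra|lra|].
    by apply: ler_wpM2l => //; apply: lerD; rewrite ler_norml; apply/andP; split; lra.
  have h3 : normc (expi (- (l * tau)) * fint f l 0 B - fint f l 0 B) <= e / 4 * B.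
    rewrite -{2}[fint f l 0 B]mul1r -mulrBl normcM normcBC.
    have h := phase tau ap.
    have hf : normc (fint f l 0 B) <= M * B by have := fint_bound l B0; rewrite subr0.
    rewrite (le_trans (ler_wpM2l (normc_ge0 _) hf))// mulrA ler_wpM2r//.
    set n := normc _ in h *.
    have n0 : 0 <= n by exact: normc_ge0.
    have h' : n * eta <= e * eta / (4 * (M + 1)) by rewrite (le_trans h)// ge_min lexx orbT.
    have : n <= e / (4 * (M + 1)).
      by rewrite -(ler_pM2r eta0) (le_trans h')// mulrAC.
    rewrite ler_pdivlMr; last lra.
    by move=> ?; nra.
  have e14 : e1 <= e / 4 by rewrite ge_min lexx.
  rewrite (le_trans (@normc_tri _ (fint f l tau (B + tau)) _ _))//.
  have := @normc_tri _ (expi (- (l * tau)) * fint f l 0 B) (fint f l tau (B + tau)) (fint f l 0 B).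
  have : e1 * B <= e / 4 * B by rewrite ler_wpM2r.
  by move=> *; lra.
set K0 := 2 * M * d + e1 in tr.
have K00 : 0 <= K0 by rewrite addr_ge0 ?mulr_ge0 ?(ltW d0) ?(ltW e10).
pose B := 2 * K0 / e + 1.
have B0 : 0 < B by rewrite ltr_wpDl// divr_ge0 ?mulr_ge0// ltW.
have trB a : normc (fint f l a (a + B) - fint f l 0 B) <= e * B.
  apply: (le_trans (tr a B (ltW B0))).
  have : K0 <= e / 2 * B.
    rewrite /B mulrDr mulr1 (_ : e / 2 * (2 * K0 / e) = K0) ?lerDl ?divr_ge0 ?(ltW e0)//.
    by field; rewrite gt_eqF.
  by lra.
exists ((B^-1)%:C * fint f l 0 B), (2 * M * B); first by rewrite !mulr_ge0// ltW.
have H n : normc (fint f l 0 (n%:R * B) - n%:R%:C * fint f l 0 B) <= n%:R * (e * B).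
  elim: n => [|n ih].
    by rewrite !mul0r /fint citg_point subr0 (normcR 0) normr0.
  have nB : 0 <= n%:R * B by rewrite mulr_ge0// ltW.
  rewrite (@fint_cat _ (n%:R * B))//; last first.
    by rewrite ler_wpM2r ?ler_nat// ltW.
  rewrite -natr1 mulrDl mul1r rmorphD mulrDl rmorph1 mul1r.
  have -> : fint f l 0 (n%:R * B) + fint f l (n%:R * B) (n%:R * B + B) -
    ((n%:R)%:C * fint f l 0 B + fint f l 0 B) =
    (fint f l 0 (n%:R * B) - (n%:R)%:C * fint f l 0 B) +
    (fint f l (n%:R * B) (n%:R * B + B) - fint f l 0 B) by ring.
  rewrite (le_trans (normcD _ _))// mulrDl mul1r lerD//; exact: trB.
move=> L L0.
have LB0 : 0 <= L / B by rewrite divr_ge0// ltW.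
have /andP[h1 h2] := truncn_itv LB0.
set n := Num.truncn (L / B) in h1 h2.
move: h1 h2; rewrite ler_pdivlMr// ltr_pdivrMr// -natr1 mulrDl mul1r => h1 h2.
have nB : 0 <= n%:R * B by rewrite mulr_ge0// ltW.
rewrite (@fint_cat _ (n%:R * B))//.
have -> : fint f l 0 (n%:R * B) + fint f l (n%:R * B) L - L%:C * ((B^-1)%:C * fint f l 0 B) =
  (fint f l 0 (n%:R * B) - n%:R%:C * fint f l 0 B) + fint f l (n%:R * B) L
   - ((L - n%:R * B) / B)%:C * fint f l 0 B.
  rewrite (_ : (L - n%:R * B) / B = L / B - n%:R); last by field; rewrite gt_eqF.
  by rewrite rmorphB rmorphM; ring.
rewrite (le_trans (normcB _ _))// normcZ.
have g1 := H n.
have g2 : normc (fint f l (n%:R * B) L) <= M * B.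
  rewrite (le_trans (fint_bound _ _))// ler_wpM2l//; lra.
have g3 : normc (fint f l 0 B) <= M * B by have := fint_bound l (ltW B0); rewrite subr0.
have g4 : `|(L - n%:R * B) / B| <= 1.
  rewrite ger0_norm ?divr_ge0 ?(ltW B0)//; last lra.
  by rewrite ler_pdivrMr// mul1r; lra.
have g5 := normcD (fint f l 0 (n%:R * B) - n%:R%:C * fint f l 0 B) (fint f l (n%:R * B) L).
have g6 : `|(L - n%:R * B) / B| * normc (fint f l 0 B) <= M * B.
  by rewrite -[leRHS]mul1r ler_pM// normc_ge0.
have g7 : n%:R * (e * B) <= e * L by rewrite mulrCA ler_wpM2l// ltW.
by lra.
Qed.

(** Either the integrals over [0, B] are o(B), and the mean is 0, or [fint_linear]
    applies for every e and the means form a Cauchy family. *)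
Lemma mean_exists l : exists A : R[i], forall e : R, 0 < e -> exists L0, forall L, L0 <= L ->
  normc (fint f l 0 L - L%:C * A) <= e * L.
Proof.
have [[eta eta0 heta]|H] := pselect (exists2 eta : R, 0 < eta &
    forall B0, exists2 B, B0 <= B & eta * B <= normc (fint f l 0 B)); last first.
  exists 0 => e e0; apply: contrapT => H'; apply: H; exists e => // B0.
  apply: contrapT => H2; apply: H'; exists B0 => L hL; rewrite mulr0 subr0.
  by rewrite leNgt; apply/negP => h; apply: H2; exists L => //; exact: ltW.
have lin := fint_linear eta0 heta.
have [|A hA] := @cauchy_complex (fun L => (L^-1)%:C * fint f l 0 L).
  move=> e e0; have [|c [K K0 hK]] := lin (e / 4); first lra.
  have K' : 0 <= 4 * K / e by rewrite divr_ge0 ?mulr_ge0 ?(ltW e0).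
  exists (4 * K / e + 1).
  have H L : 4 * K / e + 1 <= L -> normc ((L^-1)%:C * fint f l 0 L - c) <= e / 2.
    move=> hL; have L0 : 0 < L by lra.
    have -> : (L^-1)%:C * fint f l 0 L - c = (L^-1)%:C * (fint f l 0 L - L%:C * c).
      by rewrite mulrBr mulrA -rmorphM mulVf ?mul1r// gt_eqF.
    rewrite normcZ ger0_norm ?invr_ge0 ?(ltW L0)// mulrC ler_pdivrMr//.
    rewrite (le_trans (hK _ (ltW L0)))//.
    have : K <= e / 4 * L.
      have : 4 * K / e <= L by lra.
      by rewrite ler_pdivrMr//; lra.
    by lra.
  move=> L L' /H h1 /H h2; rewrite (le_trans (@normc_tri _ c _ _))//.
  by rewrite [normc (c - _)]normcBC; lra.
exists A => e e0; have [L0 h] := hA e e0.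
exists (Num.max L0 1) => L; rewrite ge_max => /andP[h1 h2].
have Lp : 0 < L by lra.
have -> : fint f l 0 L - L%:C * A = L%:C * ((L^-1)%:C * fint f l 0 L - A).
  by rewrite mulrBr mulrA -rmorphM mulfV ?mul1r// gt_eqF.
by rewrite normcZ gtr0_norm// mulrC ler_wpM2r ?h// ltW.
Qed.

End MeanValue.

(** * Finite Fourier analysis *)

Section FiniteFourier.
Context {R : realType}.
Notation normc := (@ComplexField.Normc.normc R).
Implicit Types (z : R[i]).

Lemma conj_expi (t : R) : conjc (expi t) = expi (- t).
Proof. by apply: complex_eq => /=; rewrite ?cosN ?sinN. Qed.

Lemma conjcM (z1 z2 : R[i]) : conjc (z1 * z2) = conjc z1 * conjc z2.
Proof. by case: z1 z2 => [a b] [c d]; apply: complex_eq => /=; ring. Qed.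

Lemma conjc_sum (I : Type) (s : seq I) (P : pred I) (F : I -> R[i]) :
  conjc (\sum_(i <- s | P i) F i) = \sum_(i <- s | P i) conjc (F i).
Proof. exact: (raddf_sum (@conjc R)). Qed.

Lemma normc_conj z : normc (conjc z) = normc z.
Proof. by case: z => x y /=; rewrite sqrrN. Qed.

Lemma mul_conj z : z * conjc z = (normc z ^+ 2)%:C.
Proof.
by rewrite normc_sqr; apply: complex_eq; rewrite ?cReM ?cImM; case: z => x y /=; ring.
Qed.

Lemma normc_sum (I : Type) (s : seq I) (P : pred I) (F : I -> R[i]) :
  normc (\sum_(i <- s | P i) F i) <= \sum_(i <- s | P i) normc (F i).
Proof.
elim/big_rec2: _ => [|i y1 y2 _ h]; first by rewrite (normcR 0) normr0.
by rewrite (le_trans (normcD _ _))// lerD2l.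
Qed.

Lemma expi_mulrn (t : R) n : expi (t *+ n) = expi t ^+ n.
Proof. by elim: n => [|n ih]; rewrite ?expi0// mulrS exprS -ih expiD. Qed.

Lemma expi_pi2n (n : nat) : expi (pi *+ 2 *+ n) = 1 :> R[i].
Proof.
by rewrite expi_mulrn (_ : expi _ = 1) ?expr1n// /expi cos2pi sin2pi.
Qed.

Lemma expi_neq1 (t : R) : 0 < t -> t < pi *+ 2 -> expi t != 1.
Proof.
move=> t0 tpi; apply/eqP => /(congr1 (@complex.Re R)) /= c1.
have : 0 < sin (t / 2) by apply: sin_gt0_pi; lra.
have := cos_mulr2n (t / 2); have -> : (t / 2) *+ 2 = t by lra.
rewrite c1 => h; have := cos2Dsin2 (t / 2).
have -> : cos (t / 2) ^+ 2 = 1 by move: h; rewrite mulr2n; lra.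
move=> h2 s0; have : sin (t / 2) ^+ 2 = 0 by lra.
by move/eqP; rewrite sqrf_eq0 => /eqP h3; rewrite h3 ltxx in s0.
Qed.

Section dft.
Variable N : nat.
Hypothesis N0 : (0 < N)%N.

Definition dft_char (k j : nat) : R[i] := expi (pi *+ 2 / N%:R *+ (k * j)).

Let step (d : nat) : (0 < d)%N -> (d < N)%N -> \sum_(k < N) dft_char k d = 0.
Proof.
move=> d0 dN; pose z := expi (pi *+ 2 / N%:R *+ d : R).
have zN : z ^+ N = 1.
  rewrite /z -expi_mulrn -mulrnA mulnC mulrnA.
  have -> : pi *+ 2 / N%:R *+ N = pi *+ 2 :> R.
    by rewrite -mulr_natr mulfVK// pnatr_eq0 -lt0n.
  exact: expi_pi2n.
have z1 : z != 1.
  have NR : 0 < N%:R :> R by rewrite ltr0n.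
  apply: expi_neq1.
    by rewrite pmulrn_lgt0// divr_gt0// pmulrn_lgt0// pi_gt0.
  rewrite -mulr_natr mulrAC ltr_pdivrMr// ltr_pM2l ?ltr_nat//.
  by rewrite pmulrn_lgt0// pi_gt0.
rewrite (eq_bigr (fun k : 'I_N => z ^+ k)); last first.
  by move=> k _; rewrite /dft_char mulnC mulrnA expi_mulrn.
have := subrX1 z N; rewrite zN subrr => /esym/eqP.
by rewrite mulf_eq0 subr_eq0 (negbTE z1) => /eqP.
Qed.

Lemma dft_orth (i j : nat) : (i < N)%N -> (j < N)%N ->
  \sum_(k < N) dft_char k i * conjc (dft_char k j) = (N%:R *+ (i == j))%:C.
Proof.
wlog ij : i j / (j <= i)%N.
  move=> h iN jN; have [ji|/ltnW ij] := leqP j i; first exact: h.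
  rewrite eq_sym -[RHS]conjc_real -h//.
  rewrite conjc_sum; apply: eq_bigr => k _.
  by rewrite conjcM conjcK mulrC.
move=> iN jN.
have E k : dft_char k i * conjc (dft_char k j) = dft_char k (i - j).
  rewrite /dft_char conj_expi -expiD; congr expi.
  by rewrite mulnBr mulrnBr// leq_mul2l ij orbT.
under eq_bigr => k _ do rewrite E.
have [->|ij'] := eqVneq i j.
  rewrite subnn; under eq_bigr => k _ do rewrite /dft_char muln0 mulr0n expi0.
  by rewrite sumr_const card_ord mulr1n rmorph_nat.
rewrite mulr0n step//; last exact: leq_ltn_trans (leq_subr _ _) iN.
by rewrite subn_gt0 ltn_neqAle eq_sym ij' ij.
Qed.

Lemma dft_parseval (n : nat) (v : nat -> R[i]) : (n <= N)%N ->
  \sum_(k < N) normc (\sum_(t < n) v t * dft_char k t) ^+ 2 =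
  N%:R * \sum_(t < n) normc (v t) ^+ 2.
Proof.
move=> nN; apply: (@complexI R).
rewrite rmorphM !rmorph_sum/=.
transitivity (\sum_(k < N) \sum_(t < n) \sum_(s < n)
    (v t * conjc (v s)) * (dft_char k t * conjc (dft_char k s))).
  apply: eq_bigr => k _; rewrite -mul_conj conjc_sum mulr_suml.
  apply: eq_bigr => t _; rewrite mulr_sumr; apply: eq_bigr => s _.
  by rewrite conjcM; ring.
rewrite exchange_big mulr_sumr; apply: eq_bigr => t _/=.
rewrite exchange_big /= (bigD1 t)//= [X in _ + X]big1 ?addr0; last first.
  move=> s st; rewrite -mulr_sumr dft_orth ?(leq_trans (ltn_ord _) nN)//.
  by rewrite eq_sym -val_eqE/= in st; rewrite (negbTE st) mulr0n mulr0.
rewrite -mulr_sumr dft_orth ?(leq_trans (ltn_ord _) nN)// eqxx mulr1n.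
by rewrite mul_conj mulrC.
Qed.

End dft.

(** Convolution by g is diagonalised by the characters of Z/2n, so its norm on l2 is
    at most the supremum of the transform of g. Doubling the length keeps the sums
    t + s of two indices below the period. *)
Lemma convolution_bound (n : nat) (g : nat -> R[i]) (x : nat -> R) (G : R) : (0 < n)%N ->
  (forall k, (k < 2 * n)%N -> normc (\sum_(j < 2 * n) g j * conjc (dft_char (2 * n) k j)) <= G) ->
  \sum_(t < n) normc (\sum_(s < n) (x s)%:C * g (t + s)%N) ^+ 2 <= G ^+ 2 * \sum_(s < n) x s ^+ 2.
Proof.
move=> n0 hG; set N := (2 * n)%N in hG *.
have N0 : (0 < N)%N by rewrite muln_gt0.
have nN : (n <= N)%N by rewrite leq_pmull.
have NR : 0 < N%:R :> R by rewrite ltr0n.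
pose u (t : nat) := \sum_(s < n) (x s)%:C * g (t + s)%N.
pose S := \sum_(t < n) normc (u t) ^+ 2.
pose X := \sum_(s < n) x s ^+ 2.
rewrite -/S -/X.
pose V k := \sum_(t < n) conjc (u t) * dft_char N k t.
pose Y k := \sum_(s < n) (x s)%:C * dft_char N k s.
pose Z k := \sum_(j < N) g j * conjc (dft_char N k j).
have key : (N%:R * S)%:C = \sum_(k < N) V k * Y k * Z k.
  transitivity (\sum_(t < n) \sum_(s < n) \sum_(j < N) \sum_(k < N)
      (conjc (u t) * (x s)%:C * g j) * (dft_char N k (t + s) * conjc (dft_char N k j))).
    rewrite rmorphM rmorph_sum /= mulr_sumr; apply: eq_bigr => t _.
    rewrite -mul_conj mulrC {1}/u mulr_suml mulr_suml; apply: eq_bigr => s _.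
    have tsN : (t + s < N)%N by rewrite /N mul2n -addnn -addnS leq_add// ltnW.
    rewrite (bigD1 (Ordinal tsN))//= [X in _ + X]big1 ?addr0; last first.
      move=> j jts; rewrite -mulr_sumr dft_orth//.
      by rewrite eq_sym -val_eqE/= in jts; rewrite (negbTE jts) mulr0n mulr0.
    rewrite -mulr_sumr dft_orth// eqxx mulr1n; ring.
  transitivity (\sum_(k < N) \sum_(t < n) \sum_(s < n) \sum_(j < N)
      (conjc (u t) * (x s)%:C * g j) * (dft_char N k (t + s) * conjc (dft_char N k j))).
    rewrite [RHS]exchange_big; apply: eq_bigr => t _ /=.
    rewrite [RHS]exchange_big; apply: eq_bigr => s _ /=.
    by rewrite [RHS]exchange_big.
  apply: eq_bigr => k _; rewrite /V /Y /Z !mulr_suml; apply: eq_bigr => t _.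
  rewrite [X in _ = X * _]mulr_sumr mulr_suml; apply: eq_bigr => s _.
  rewrite mulr_sumr; apply: eq_bigr => j _.
  by rewrite /dft_char mulnDr mulrnDr expiD; ring.
have G0 : 0 <= G by rewrite (le_trans _ (hG 0%N N0))// normc_ge0.
have PV : \sum_(k < N) normc (V k) ^+ 2 = N%:R * S.
  rewrite /V (@dft_parseval N N0 n (fun t : nat => conjc (u t)) nN); congr (_ * _).
  by apply: eq_bigr => ? _; rewrite normc_conj.
have PY : \sum_(k < N) normc (Y k) ^+ 2 = N%:R * X.
  rewrite /Y (@dft_parseval N N0 n (fun t : nat => (x t)%:C) nN); congr (_ * _).
  by apply: eq_bigr => ? _; rewrite normcR real_normK ?num_real.
have S0 : 0 <= S by apply: sumr_ge0 => t _; rewrite sqr_ge0.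
have : N%:R * S <= \sum_(k < N) (normc (V k) ^+ 2 + G ^+ 2 * normc (Y k) ^+ 2) / 2.
  rewrite -[leLHS]ger0_norm ?mulr_ge0 ?(ltW NR)// -normcR key.
  rewrite (le_trans (normc_sum _ _ _))//; apply: ler_sum => k _; rewrite !normcM.
  have h := hG k (ltn_ord k); rewrite -/(Z k) in h.
  have v0 := normc_ge0 (V k); have y0 := normc_ge0 (Y k).
  apply: (@le_trans _ _ (normc (V k) * normc (Y k) * G)).
    by rewrite ler_wpM2l// mulr_ge0.
  have : 0 <= (normc (V k) - G * normc (Y k)) ^+ 2 by exact: sqr_ge0.
  rewrite sqrrB exprMn; lra.
rewrite -mulr_suml big_split /= -mulr_sumr PV PY => h.
rewrite -(ler_pM2l NR); nra.
Qed.

End FiniteFourier.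

Local Arguments conjc : simpl never.
Local Arguments expi : simpl never.
Local Arguments ComplexField.Normc.normc : simpl never.
Local Arguments fint : simpl never.

(** * Uniform smallness of the Fourier means *)

Section Uniqueness.
Context {R : realType}.
Notation citg := (@cintegral_on R).
Notation bbc := (@bounded_borelc R).
Notation normc := (@ComplexField.Normc.normc R).
Implicit Types (f g : R -> R[i]) (z : R[i]) (a b c d t l : R).

Variables (D : R -> R[i]) (M Lp : R).
Hypothesis bD : bbc D.
Hypothesis DM : forall t, normc (D t) <= M.
Hypothesis Lp0 : 0 < Lp.
Hypothesis DL : forall s t, normc (D s - D t) <= Lp * `|s - t|.
Hypothesis Dap : forall e : R, 0 < e ->
  relatively_dense [set tau | forall t, normc (D (t + tau) - D t) <= e].
Hypothesis Dcoef : forall l (e : R), 0 < e -> exists L0, forall L, L0 <= L ->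
  normc (fint D l 0 L) <= e * L.

Let M0 : 0 <= M. Proof. by rewrite (le_trans _ (DM 0))// normc_ge0. Qed.

Let Dmean : mean_ap D.
Proof.
move=> e e0; have [l [l0 hl]] := Dap e0; exists l; split => // a.
have [tau [ht h]] := hl a; exists tau; split => // y.
rewrite -[leRHS]mulr1 -[X in _ <= _ * X](_ : y + 1 - y = 1); last by ring.
rewrite -itg_cst ?lerDl//; apply: le_itg => //; [exact: bb_diff|exact: bb_cst].
Qed.

Lemma fint_near l l0 a B : 0 <= B ->
  normc (fint D l a (a + B)) <= normc (fint D l0 a (a + B)) + 2 * M * `|l - l0| * B * B.
Proof.
move=> B0.
have E : fint D l a (a + B) = expi (- ((l - l0) * a)) * citg a (a + B)
    (fun t => D t * expi (- (l0 * t)) * expi (- ((l - l0) * (t - a)))).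
  rewrite -citgZ; last first.
    apply: bbcM; first exact: bbc_fexp.
    have := bbc_expi (- (l - l0)) ((l - l0) * a); congr (bbc _).
    by apply/funext => t; congr expi; ring.
  congr citg; apply/funext => t.
  rewrite mulrCA -mulrA; congr (_ * _).
  rewrite -!expiD; congr expi; ring.
rewrite {}E normcM normc_expi mul1r.
set I1 := citg _ _ _; set I2 := fint D l0 _ _.
apply: (le_trans (normc_le I1 I2)); rewrite lerD2l.
have b1 : bbc (fun t => D t * expi (- (l0 * t)) * expi (- ((l - l0) * (t - a)))).
  apply: bbcM; first exact: bbc_fexp.
  have := bbc_expi (- (l - l0)) ((l - l0) * a); congr (bbc _).
  by apply/funext => t; congr expi; ring.
rewrite /I1 /I2 /fint -citgB//; last exact: bbc_fexp.
apply: (le_trans (@citg_bound _ _ _ _ (2 * M * `|l - l0| * B) _ _ _)).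
- by apply: bbcB => //; exact: bbc_fexp.
- by rewrite lerDl.
- move=> t /andP[t1 t2].
  rewrite -[X in _ - X]mulr1 -mulrBr !normcM normc_expi mulr1.
  have := expi_lip (- ((l - l0) * (t - a))) 0.
  rewrite expi0 subr0 normrN normrM => h.
  have hta : `|t - a| <= B by rewrite ger0_norm; lra.
  apply: (@le_trans _ _ (M * (2 * (`|l - l0| * `|t - a|)))).
    by rewrite ler_pM// normc_ge0.
  rewrite -!mulrA mulrCA ler_wpM2l// ler_wpM2l// ler_wpM2l//.
- by rewrite addrAC subrr add0r.
Qed.

(** Compactness of [-La, La]: near l0 the means over windows of a fixed length B are
    small together with that of l0, and long windows are unions of such. *)
Lemma fint_unif (La e : R) : 0 < e -> exists2 L0, 0 <= L0 & forall L, L0 <= L ->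
  forall l, `|l| <= La -> normc (fint D l 0 L) <= e * L.
Proof.
move=> e0; have M0' : 0 <= M by exact: M0.
have e8 : 0 < e / 8 by lra.
have [K K0 hK] := fint_translate bD DM Dmean e8.
have near_cov : near_covering `[- La, La]%classic.
  by apply/compact_near_coveringP; exact: segment_compact.
have : \forall L \near +oo, forall l, `[- La, La]%classic l -> normc (fint D l 0 L) <= e * L.
  apply: (near_cov R (pinfty_nbhs R) (fun L l => normc (fint D l 0 L) <= e * L)).
  move=> l0 _.
  have [L1 hL1] := Dcoef l0 e8.
  pose B := Num.max L1 (8 * K / e + 1).
  have K8 : 0 <= 8 * K / e by rewrite divr_ge0 ?mulr_ge0 ?(ltW e0).
  have B1 : 8 * K / e + 1 <= B by rewrite le_max lexx orbT.
  have B0 : 0 < B by lra.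
  have KB : K <= e / 8 * B.
    have : 8 * K / e <= B by lra.
    by rewrite ler_pdivrMr//; lra.
  have blk0 a : normc (fint D l0 a (a + B)) <= 3 * e / 8 * B.
    have := hK l0 a B (ltW B0).
    have : normc (fint D l0 0 B) <= e / 8 * B by apply: hL1; rewrite le_max lexx.
    by lra.
  pose dl := e / (16 * (M + 1) * B).
  have dl0 : 0 < dl by rewrite divr_gt0// !mulr_gt0//; lra.
  have blk l a : `|l - l0| <= dl -> normc (fint D l a (a + B)) <= e / 2 * B.
    move=> hl; have := @fint_near l l0 a B (ltW B0); have := blk0 a.
    have : 2 * M * `|l - l0| * B * B <= e / 8 * B.
      rewrite ler_wpM2r ?(ltW B0)//.
      apply: (@le_trans _ _ (2 * M * dl * B)).
        by rewrite ler_wpM2r ?(ltW B0)// ler_wpM2l// mulr_ge0.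
      have -> : 2 * M * dl * B = e / 8 * (M / (M + 1)).
        by rewrite /dl; field; rewrite !gt_eqF//; lra.
      rewrite -[leRHS]mulr1 ler_wpM2l//; first lra.
      by rewrite ler_pdivrMr; lra.
    by lra.
  have blks l n : `|l - l0| <= dl -> normc (fint D l 0 (n%:R * B)) <= e / 2 * (n%:R * B).
    move=> hl; elim: n => [|n ih].
      by rewrite !mul0r mulr0 /fint citg_point (normcR 0) normr0.
    rewrite -natr1 mulrDl mul1r (@fint_cat _ _ bD _ (n%:R * B)); last 2 first.
    - by rewrite mulr_ge0// ltW.
    - by rewrite lerDl ltW.
    by rewrite (le_trans (normcD _ _))// [leRHS]mulrDr lerD// blk.
  exists ([set l | `|l - l0| <= dl], [set L | 2 * M * B / e <= L]) => /=.
    split.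
      apply/nbhs_ballP; exists dl => //= l; rewrite /ball/= distrC; exact: ltW.
    by apply: nbhs_pinfty_ge; exact: num_real.
  move=> [l L] /= [hl hL].
  have L0 : 0 <= L by rewrite (le_trans _ hL)// divr_ge0 ?mulr_ge0 ?(ltW e0) ?(ltW B0).
  have LB0 : 0 <= L / B by rewrite divr_ge0// ltW.
  have /andP[h1 h2] := truncn_itv LB0.
  set n := Num.truncn (L / B) in h1 h2.
  move: h1 h2; rewrite ler_pdivlMr// ltr_pdivrMr// -natr1 mulrDl mul1r => h1 h2.
  have nB : 0 <= n%:R * B by rewrite mulr_ge0// ltW.
  rewrite (@fint_cat _ _ bD _ (n%:R * B))// (le_trans (normcD _ _))//.
  have := @fint_bound _ _ _ bD DM l _ _ h1.
  have : M * (L - n%:R * B) <= M * B by rewrite ler_wpM2l//; lra.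
  have := blks l n hl.
  move: hL; rewrite ler_pdivrMr//.
  have : e * (n%:R * B) <= e * L by rewrite ler_wpM2l// ltW.
  by lra.
move=> [L0 [_ hL0]]; exists (Num.max 0 (L0 + 1)); first by rewrite le_max lexx.
move=> L hL l hl; apply: hL0; last by rewrite /= in_itv/= -ler_norml.
by move: hL; rewrite ge_max => /andP[_]; lra.
Qed.

End Uniqueness.

(** * Sampling on a grid *)

Section Counting.
Context {R : realType}.

(** A property that holds on an interval of length rho in every window of length l
    holds for a fixed proportion of the points of a fine grid. *)
Lemma grid_count (G : R -> Prop) (l rho : R) (q r Q : nat) :
  0 < rho -> (0 < r)%N -> l + rho < q%:R * rho ->
  (forall a, 0 <= a -> exists tau, a <= tau <= a + l /\ forall s, tau <= s <= tau + rho -> G s) ->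
  (Q * r <= \sum_(0 <= j < Q * (q * r)) `[< G (j%:R * (rho / r%:R))%R >])%N.
Proof.
move=> rho0 r0 lq hG.
have rR : 0 < r%:R :> R by rewrite ltr0n.
set dl := rho / r%:R; have dl0 : 0 < dl by rewrite divr_gt0.
have rdl : r%:R * dl = rho by rewrite /dl mulrC divfK// gt_eqF.
elim: Q => [|Q ih]; first by rewrite !mul0n.
rewrite !mulSn addnC [(q * r + _)%N]addnC (@big_cat_nat _ _ _ (Q * (q * r)))//=; last exact: leq_addr.
rewrite leq_add//.
have a0 : 0 <= (Q * (q * r))%:R * dl by rewrite mulr_ge0// ltW.
have [tau [/andP[t1 t2] hs]] := hG _ a0.
have tau0 : 0 <= tau by rewrite (le_trans a0).
have td0 : 0 <= tau / dl by rewrite divr_ge0// ltW.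
have /andP[h1 h2] := truncn_itv td0.
pose j0 := (if tau == (Num.truncn (tau / dl))%:R * dl then Num.truncn (tau / dl) else (Num.truncn (tau / dl)).+1).
move: h1 h2; rewrite ler_pdivlMr// ltr_pdivrMr// => h1 h2.
have j1 : tau <= j0%:R * dl.
  by rewrite /j0; case: eqP => [h|_]; [rewrite -h|exact: ltW].
have j2 : j0%:R * dl < tau + dl.
  rewrite /j0; case: eqP => [<-|/eqP ne]; first by rewrite ltrDl.
  by rewrite -natr1 mulrDl mul1r ltrD2r lt_neqAle eq_sym ne.
have j3 : (Q * (q * r) <= j0)%N.
  by rewrite -(ler_nat R) -(ler_pM2r dl0) (le_trans t1).
have j4 : (j0 + r <= Q * (q * r) + q * r)%N.
  rewrite -ltnS -(ltr_nat R) -(ltr_pM2r dl0) natrD mulrDl rdl.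
  rewrite -addn1 natrD natrD !mulrDl mul1r natrM (natrM _ q r) -[q%:R * _ * _]mulrA rdl.
  by rewrite -natrM; lra.
rewrite (@big_cat_nat _ _ _ j0)//=; last by rewrite (leq_trans _ j4)// leq_addr.
rewrite (@big_cat_nat _ _ _ (j0 + r) j0)//=; last exact: leq_addr.
rewrite addnCA (leq_trans _ (leq_addr _ _))//.
rewrite -[X in (X <= _)%N](_ : \sum_(j0 <= j < j0 + r) 1 = r)%N; last first.
  by rewrite sum_nat_const_nat addKn muln1.
rewrite leq_eqVlt; apply/orP; left; apply/eqP; apply: eq_big_nat => j /andP[k1 k2].
suff -> : `[< G (j%:R * dl) >] by [].
apply/asboolP; apply: hs; apply/andP; split.
  by rewrite (le_trans j1)// ler_pM2r// ler_nat.
have : j.+1%:R * dl <= (j0 + r)%:R * dl by rewrite ler_pM2r// ler_nat.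
rewrite natrD mulrDl rdl -natr1 mulrDl; lra.
Qed.

End Counting.

Section Sampling.
Context {R : realType}.
Notation citg := (@cintegral_on R).
Notation bbc := (@bounded_borelc R).
Notation normc := (@ComplexField.Normc.normc R).
Implicit Types (l : R).

Variables (D : R -> R[i]) (M Lp : R).
Hypothesis bD : bbc D.
Hypothesis DM : forall t, normc (D t) <= M.
Hypothesis Lp0 : 0 < Lp.
Hypothesis DL : forall s t, normc (D s - D t) <= Lp * `|s - t|.

Let M0 : 0 <= M. Proof. by rewrite (le_trans _ (DM 0))// normc_ge0. Qed.

Lemma riemann_exp l (La dl : R) (N : nat) : `|l| <= La -> 0 < dl ->
  normc (fint D l 0 (N%:R * dl) - dl%:C * \sum_(j < N) D (j%:R * dl) * expi (- (l * (j%:R * dl))))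
    <= N%:R * (dl * (dl * (Lp + 2 * M * La))).
Proof.
move=> hl d0; have La0 : 0 <= La by rewrite (le_trans _ hl).
have M0' : 0 <= M by exact: M0.
elim: N => [|n ih].
  by rewrite big_ord0 !mul0r /fint citg_point mulr0 subr0 (normcR 0) normr0.
have nd0 : 0 <= n%:R * dl by rewrite mulr_ge0// ltW.
rewrite big_ord_recr -natr1 mulrDl mul1r (@fint_cat _ _ bD _ (n%:R * dl))//=; last first.
  by rewrite lerDl ltW.
rewrite mulrDr.
set A := fint _ _ _ _ in ih *; set B := fint _ _ _ _.
set C := dl%:C * _ in ih *; set E := dl%:C * _.
have -> : A + B - (C + E) = (A - C) + (B - E) by ring.
rewrite (le_trans (normcD _ _))// mulrDl mul1r lerD//.
have bh := bbc_fexp bD l.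
have -> : E = citg (n%:R * dl) (n%:R * dl + dl) (fun=> D (n%:R * dl) * expi (- (l * (n%:R * dl)))).
  by rewrite citg_cst ?lerDl ?(ltW d0)//; congr (_%:C * _); ring.
rewrite /B /fint -citgB//; last exact: bbc_cst.
apply: (le_trans (@citg_bound _ _ _ _ (dl * (Lp + 2 * M * La)) _ _ _)).
- by apply: bbcB => //; exact: bbc_cst.
- by rewrite lerDl ltW.
- move=> t /andP[t1 t2]; set s := n%:R * dl.
  have ts : `|t - s| <= dl by rewrite ger0_norm; rewrite /s; lra.
  have -> : D t * expi (- (l * t)) - D s * expi (- (l * s)) =
     (D t - D s) * expi (- (l * t)) + D s * (expi (- (l * t)) - expi (- (l * s))) by ring.
  rewrite (le_trans (normcD _ _))// !normcM normc_expi mulr1 mulrDr lerD//.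
    by rewrite (le_trans (DL _ _))// mulrC ler_wpM2r// ltW.
  apply: (@le_trans _ _ (M * (2 * (La * dl)))); last by lra.
  rewrite ler_pM// ?normc_ge0// (le_trans (expi_lip _ _))// ler_wpM2l//.
  have -> : - (l * t) - - (l * s) = - (l * (t - s)) by ring.
  by rewrite normrN normrM ler_pM.
- by rewrite addrAC subrr add0r mulrC.
Qed.

Lemma expi_far (x : R) : pi / 2 <= `|x| -> `|x| <= 3 * (pi / 2) -> 1 <= normc (1 - expi x).
Proof.
move=> h1 h2; rewrite (le_trans _ (normc_Re _))// cReB /expi /=.
have : cos x <= 0.
  have -> : cos x = cos `|x| by case: (ger0P x) => _; rewrite ?cosN.
  have -> : `|x| = (`|x| - pi) + pi by ring.
  rewrite cosDpi oppr_le0; apply: cos_ge0_pihalf.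
  by apply/andP; split; lra.
by move=> c0; rewrite ger0_norm; lra.
Qed.

Lemma shift_sum (F : nat -> R[i]) (N r : nat) : (forall j, normc (F j) <= M) ->
  normc (\sum_(j < N) F (j + r)%N - \sum_(j < N) F j) <= 2 * M * r%:R.
Proof.
move=> FM; elim: r => [|r ih].
  under eq_bigr do rewrite addn0.
  by rewrite subrr (normcR 0) normr0 mulr0.
have E : \sum_(j < N) F (j + r.+1)%N - \sum_(j < N) F (j + r)%N = F (N + r)%N - F r.
  rewrite -(big_mkord predT (fun j => F (j + r.+1)%N)) -(big_mkord predT (fun j => F (j + r)%N)).
  rewrite -sumrB (eq_bigr (fun j => F (j.+1 + r)%N - F (j + r)%N)); last first.
    by move=> j _; rewrite addnS addSn.
  by rewrite (telescope_sumr (fun j => F (j + r)%N)).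
rewrite (le_trans (@normc_tri _ (\sum_(j < N) F (j + r)%N) _ _))// E -[r.+1]addn1 natrD mulrDr mulr1 addrC lerD//.
by rewrite (le_trans (normcB _ _))//; have := FM (N + r)%N; have := FM r; lra.
Qed.

Hypothesis unif : forall La e : R, 0 < e -> exists2 L0, 0 <= L0 & forall L, L0 <= L ->
  forall l, `|l| <= La -> normc (fint D l 0 L) <= e * L.

(** Exponential sums of samples are small uniformly in the frequency. For low
    frequencies they are Riemann sums of the integral; for high ones, a shift by r
    samples barely changes D, by its Lipschitz continuity, but multiplies the sum by
    a number far from 1. *)
Lemma sample_sum (e : R) : 0 < e -> exists dl0 L0 : R, [/\ 0 < dl0, 0 <= L0 &
  forall dl N theta, 0 < dl <= dl0 -> L0 <= N%:R * dl -> `|theta| <= pi ->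
  normc (\sum_(j < N) D (j%:R * dl) * expi (- (theta * j%:R))) <= e * N%:R].
Proof.
move=> e0; have M0' : 0 <= M by exact: M0.
pose rho := e / (4 * Lp).
have rho0 : 0 < rho by rewrite divr_gt0// mulr_gt0.
pose La := pi / (2 * rho).
have La0 : 0 < La by rewrite divr_gt0 ?pi_gt0// mulr_gt0.
have [L1 L10 hL1] := unif La (divr_gt0 e0 (ltr0Sn R 1)).
pose C := Lp + 2 * M * La.
have C0 : 0 < C.
  have : 0 <= 2 * M * La by apply: mulr_ge0; [exact: mulr_ge0|exact: ltW].
  by move=> h; rewrite /C; exact: ltr_pwDl.
pose dl0 := Num.min rho (e / (2 * C)).
exists dl0, (Num.max L1 (8 * M * rho / e)); split.
- by rewrite lt_min rho0 divr_gt0// mulr_gt0.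
- by rewrite le_max L10.
move=> dl N th /andP[d0 dd] hN hth.
move: hN; rewrite ge_max => /andP[N1 N2].
move: dd; rewrite le_min => /andP[dd1 dd2].
(* La * dl separates the frequencies that the sampling step resolves. *)
have [low|high] := leP `|th| (La * dl).
  pose l := th / dl.
  have hl : `|l| <= La by rewrite /l normrM normfV [`|dl|]gtr0_norm// ler_pdivrMr.
  have := riemann_exp N hl d0.
  have -> : \sum_(j < N) D (j%:R * dl) * expi (- (l * (j%:R * dl))) =
            \sum_(j < N) D (j%:R * dl) * expi (- (th * j%:R)).
    apply: eq_bigr => j _; congr (_ * expi (- _)); rewrite /l; field; rewrite ?gt_eqF//.
  set S := \sum_(j < N) D (j%:R * dl) * expi (- (th * j%:R)) => h.
  have h1 := hL1 _ N1 _ hl.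
  have := normc_le (dl%:C * S) (fint D l 0 (N%:R * dl)).
  rewrite normcBC normcZ gtr0_norm// => h2.
  have h3 : dl * C <= e / 2.
    by move: dd2; rewrite ler_pdivlMr ?mulr_gt0//; lra.
  have h4 : N%:R * (dl * (dl * C)) <= N%:R * (dl * (e / 2)).
    by rewrite ler_wpM2l// ler_wpM2l// ltW.
  rewrite -(ler_pM2l d0); rewrite -/C in h; lra.
have th0 : 0 < `|th| by rewrite (le_lt_trans _ high)// mulr_ge0// ltW.
have pth : 0 <= pi / (2 * `|th|) by rewrite divr_ge0 ?pi_ge0// mulr_ge0// ltW.
have /andP[r1 r2] := truncn_itv pth.
set r := (Num.truncn (pi / (2 * `|th|))).+1 in r2.
have r3 : r%:R <= pi / (2 * `|th|) + 1 by rewrite /r -natr1 lerD2r.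
have thr : r%:R * `|th| <= pi / 2 + `|th|.
  apply: (@le_trans _ _ ((pi / (2 * `|th|) + 1) * `|th|)); first by rewrite ler_pM2r.
  by rewrite mulrDl mul1r lerD2r; rewrite invfM mulrA mulfVK ?gt_eqF.
have thr' : pi / 2 <= r%:R * `|th|.
  apply: (@le_trans _ _ (pi / (2 * `|th|) * `|th|)); last by rewrite ler_pM2r// ltW.
  by rewrite invfM mulrA mulfVK ?gt_eqF.
have rdl : r%:R * dl <= 2 * rho.
  apply: (@le_trans _ _ ((pi / (2 * `|th|) + 1) * dl)); first by rewrite ler_pM2r.
  have : pi / (2 * `|th|) * dl <= rho.
    rewrite mulrAC ler_pdivrMr ?mulr_gt0//.
    have : La * dl * (2 * rho) <= `|th| * (2 * rho) by apply: ler_wpM2r; [lra|exact: ltW].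
    have -> : La * dl * (2 * rho) = pi * dl by rewrite /La; field; rewrite ?gt_eqF//.
    by lra.
  by lra.
pose F (j : nat) := D (j%:R * dl) * expi (- (th * j%:R)).
have FM j : normc (F j) <= M by rewrite /F normcM normc_expi mulr1.
have hs := shift_sum N r FM.
set S := \sum_(j < N) F j in hs.
rewrite -/(F _) -/S.
pose z : R[i] := expi (- (th * r%:R)).
have hz : 1 <= normc (1 - z).
  by apply: expi_far; rewrite normrN normrM [`|r%:R|]ger0_norm// mulrC; lra.
have h2 : normc (\sum_(j < N) F (j + r)%N - z * S) <= N%:R * (Lp * (r%:R * dl)).
  rewrite mulr_sumr -sumrB (le_trans (normc_sum _ _ _))//.
  rewrite -[N in N%:R]card_ord -sum1_card natr_sum mulr_suml.
  apply: ler_sum => j _; rewrite mul1r.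
  have -> : F (j + r)%N - z * F j = (D ((j + r)%:R * dl) - D (j%:R * dl)) * expi (- (th * (j + r)%:R)).
    rewrite mulrBl /F /z mulrCA -expiD; congr (_ - _ * expi _).
    by rewrite natrD; ring.
  rewrite normcM normc_expi mulr1 (le_trans (DL _ _))//.
  by rewrite natrD mulrDl addrAC subrr add0r ger0_norm// mulr_ge0// ltW.
have h3 : normc ((1 - z) * S) <= 2 * M * r%:R + N%:R * (Lp * (r%:R * dl)).
  rewrite mulrBl mul1r (le_trans (@normc_tri _ (\sum_(j < N) F (j + r)%N) _ _))//.
  by rewrite lerD// normcBC.
have h4 : normc S <= normc ((1 - z) * S).
  by rewrite normcM ler_peMl ?normc_ge0.
rewrite (le_trans h4)// (le_trans h3)//.
have k1 : N%:R * (Lp * (r%:R * dl)) <= N%:R * (e / 2).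
  rewrite ler_wpM2l//; apply: (@le_trans _ _ (Lp * (2 * rho))).
    by rewrite ler_wpM2l// ltW.
  by rewrite /rho le_eqVlt; apply/orP; left; apply/eqP; field; rewrite ?gt_eqF//.
have k2 : 2 * M * r%:R <= e / 2 * N%:R.
  rewrite -(ler_pM2r d0); move: N2; rewrite ler_pdivrMr// => N2.
  have : 2 * M * (r%:R * dl) <= 2 * M * (2 * rho) by rewrite ler_wpM2l// mulr_ge0.
  by lra.
by lra.
Qed.

End Sampling.

(** * Uniqueness of almost periodic functions *)

Section Uniq.
Context {R : realType}.
Notation bbc := (@bounded_borelc R).
Notation normc := (@ComplexField.Normc.normc R).

Lemma dft_sample (F : nat -> R[i]) (N : nat) (G : R) : (0 < N)%N ->
  (forall theta : R, `|theta| <= pi -> normc (\sum_(j < N) F j * expi (- (theta * j%:R))) <= G) ->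
  forall k, (k < N)%N -> normc (\sum_(j < N) F j * conjc (dft_char N k j)) <= G.
Proof.
move=> N0 h k kN.
have NR : 0 < N%:R :> R by rewrite ltr0n.
have pi0 := pi_gt0 R.
pose th : R := pi *+ 2 / N%:R * k%:R.
have kR : k%:R <= N%:R :> R by rewrite ler_nat ltnW.
have E j : conjc (dft_char N k j) = expi (- (th * j%:R)) :> R[i].
  by rewrite /dft_char conj_expi -mulr_natr natrM mulrA.
have th0 : 0 <= th by rewrite mulr_ge0// divr_ge0// mulrn_wge0// ltW.
have thN : th * N%:R = pi * 2 * k%:R.
  by rewrite /th -mulr_natr; field; rewrite gt_eqF.
under eq_bigr do rewrite E.
have [lo|hi] := leP th pi; first by apply: h; rewrite ger0_norm.
have th2 : th <= 2 * pi.
  by rewrite -(ler_pM2r NR) thN [2 * pi]mulrC ler_wpM2l// mulr_ge0// ltW.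
have -> : \sum_(j < N) F j * expi (- (th * j%:R)) =
          \sum_(j < N) F j * expi (- ((th - pi *+ 2) * j%:R)).
  apply: eq_bigr => j _; congr (_ * _).
  have -> : - ((th - pi *+ 2) * j%:R) = - (th * j%:R) + pi *+ 2 *+ j.
    by rewrite -[pi *+ 2 *+ j]mulr_natr; ring.
  by rewrite expiD expi_pi2n mulr1.
by apply: h; rewrite ler_norml mulr2n; apply/andP; split; lra.
Qed.

Variables (D : R -> R[i]) (M Lp : R).
Hypothesis bD : bbc D.
Hypothesis DM : forall t, normc (D t) <= M.
Hypothesis Lp0 : 0 < Lp.
Hypothesis DL : forall s t, normc (D s - D t) <= Lp * `|s - t|.
Hypothesis Dap : forall e : R, 0 < e ->
  relatively_dense [set tau | forall t, normc (D (t + tau) - D t) <= e].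
Hypothesis Dcoef : forall l (e : R), 0 < e -> exists L0, forall L, L0 <= L ->
  normc (fint D l 0 L) <= e * L.

Let window (l rho : R) : 0 < l -> 0 < rho -> exists2 q, (0 < q)%N & l + rho < q%:R * rho.
Proof.
move=> l0 r0; exists (Num.truncn ((l + rho) / rho)).+1 => //.
have h : 0 <= (l + rho) / rho by rewrite divr_ge0//; lra.
by have /andP[_] := truncn_itv h; rewrite ltr_pdivrMr.
Qed.

(** Let c be the indicator of the almost periods among the grid points s. Averaging
    D (t + s) over c changes D by little, while by [convolution_bound] the average is
    small in l2, because the transform of the samples is small ([sample_sum]). Hence D
    is small in mean square; but if D x0 were not 0, D would be large on a fixed
    proportion of the grid ([grid_count]). *)
Theorem ap_uniqueness x0 : D x0 = 0.
Proof.
apply/eqP; rewrite -normc_eq0; apply: contraT => nz.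
have nx0 : 0 < normc (D x0) by rewrite lt_neqAle eq_sym nz normc_ge0.
pose e0 := normc (D x0) / 3.
have e00 : 0 < e0 by rewrite divr_gt0.
pose good2 (s : R) := e0 <= normc (D s).
have [l2 [l20 hl2]] := Dap e00.
pose rho2 := e0 / Lp; have rho20 : 0 < rho2 by rewrite divr_gt0.
have Lrho2 : Lp * rho2 = e0 by rewrite mulrC divfK// gt_eqF.
have hG2 a : 0 <= a -> exists tau, a <= tau <= a + l2 /\ forall s, tau <= s <= tau + rho2 -> good2 s.
  move=> _; have [tau [/andP[t1 t2] ht]] := hl2 (a - x0).
  exists (x0 + tau); split; first by apply/andP; split; lra.
  move=> s /andP[s1 s2]; rewrite /good2.
  have h1 := ht x0; have h2 := DL s (x0 + tau).
  have h3 := normc_le (D x0) (D s).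
  have h4 := @normc_tri _ (D (x0 + tau)) (D x0) (D s).
  rewrite normcBC in h1; rewrite normcBC in h2.
  have h5 : Lp * `|s - (x0 + tau)| <= Lp * rho2.
    by rewrite ler_wpM2l ?(ltW Lp0)// ger0_norm; lra.
  have h6 : normc (D x0) = 3 * e0 by rewrite /e0; lra.
  by lra.
have [q2 q20 hq2] := window l20 rho20.
(* eps is e0 / (8 q2): q2 is the inverse proportion of the points where D is large. *)
pose h := (8 * q2)%N.
have h0 : (0 < h)%N by rewrite muln_gt0.
have q2R : 0 < q2%:R :> R by rewrite ltr0n.
have hR : 0 < h%:R :> R by rewrite ltr0n.
pose eps := e0 / h%:R; have eps0 : 0 < eps by rewrite divr_gt0.
pose rho1 := rho2 / h%:R; have rho10 : 0 < rho1 by rewrite divr_gt0.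
have Lrho1 : Lp * rho1 = eps by rewrite mulrA Lrho2.
pose good1 (s : R) := forall t, normc (D (t + s) - D t) <= 2 * eps.
have [l1 [l10 hl1]] := Dap eps0.
have hG1 a : 0 <= a -> exists tau, a <= tau <= a + l1 /\ forall s, tau <= s <= tau + rho1 -> good1 s.
  move=> _; have [tau [t12 ht]] := hl1 a; exists tau; split => // s /andP[s1 s2] t.
  have h1 := ht t; have h2 := DL (t + s) (t + tau).
  have h5 : Lp * `|t + s - (t + tau)| <= Lp * rho1.
    by rewrite ler_wpM2l ?(ltW Lp0)// ger0_norm; lra.
  rewrite (le_trans (@normc_tri _ (D (t + tau)) _ _))//; lra.
have [q0 q00 hq0] := window l10 rho10.
have q0R : 0 < q0%:R :> R by rewrite ltr0n.
pose e := eps / q0%:R; have ee0 : 0 < e by rewrite divr_gt0.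
have [dl0 [L0 [dl00 L00 hsamp]]] := sample_sum bD DM Lp0 DL (fint_unif bD DM Dap Dcoef) ee0.
pose r := (Num.truncn (rho1 / dl0)).+1.
have rR : 0 < r%:R :> R by rewrite ltr0n.
pose dl := rho1 / r%:R.
have dlp : 0 < dl by rewrite divr_gt0.
have dldl0 : dl <= dl0.
  have hh : 0 <= rho1 / dl0 by rewrite divr_ge0// ltW.
  have /andP[_] := truncn_itv hh; rewrite -/r ltr_pdivrMr// => /ltW.
  by move=> hr; rewrite /dl ler_pdivrMr// mulrC.
have dl2 : dl = rho2 / (h * r)%:R by rewrite /dl /rho1 natrM invfM mulrA.
pose Q := (Num.truncn (L0 / dl)).+1.
pose n := (Q * (q0 * (q2 * (h * r))))%N.
have n0 : (0 < n)%N by rewrite !muln_gt0 ?q00 ?q20 ?h0.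
have nR : 0 < n%:R :> R by rewrite ltr0n.
have Qn : (Q <= n)%N by rewrite leq_pmulr// !muln_gt0 ?q00 ?q20 ?h0.
have hL0 : L0 <= (2 * n)%:R * dl.
  have hh : 0 <= L0 / dl by rewrite divr_ge0// ltW.
  have /andP[_] := truncn_itv hh; rewrite -/Q ltr_pdivrMr// => /ltW h1.
  rewrite (le_trans h1)// ler_pM2r// ler_nat (leq_trans Qn)// leq_pmull//.
pose c1 (j : nat) : nat := `[< good1 (j%:R * dl) >].
pose c2 (j : nat) : nat := `[< good2 (j%:R * dl) >].
pose X : nat := (\sum_(j < n) c1 j)%N.
pose Y : nat := (\sum_(j < n) c2 j)%N.
have XN : n%:R <= q0%:R * X%:R :> R.
  rewrite -natrM ler_nat.
  have := @grid_count _ good1 l1 rho1 q0 r (Q * (q2 * h)) rho10 isT hq0 hG1.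
  have -> : (Q * (q2 * h) * (q0 * r) = n)%N by rewrite /n; ring.
  rewrite big_mkord -/dl => hX.
  rewrite (_ : n = q0 * (Q * (q2 * h) * r))%N; last by rewrite /n; ring.
  by rewrite leq_mul2l hX orbT.
have YN : n%:R <= q2%:R * Y%:R :> R.
  rewrite -natrM ler_nat.
  have hr0 : (0 < h * r)%N by rewrite muln_gt0 h0.
  have := @grid_count _ good2 l2 rho2 q2 (h * r) (Q * q0) rho20 hr0 hq2 hG2.
  have -> : (Q * q0 * (q2 * (h * r)) = n)%N by rewrite /n; ring.
  rewrite big_mkord -dl2 => hX.
  rewrite (_ : n = q2 * (Q * q0 * (h * r)))%N; last by rewrite /n; ring.
  by rewrite leq_mul2l hX orbT.
pose g (j : nat) := D (j%:R * dl).
have hdft k : (k < 2 * n)%N -> normc (\sum_(j < 2 * n) g j * conjc (dft_char (2 * n) k j)) <= e * (2 * n)%:R.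
  apply: dft_sample; first by rewrite muln_gt0.
  by move=> th hth; apply: hsamp => //; rewrite dlp.
have conv := @convolution_bound R n g (fun s => (c1 s)%:R) _ n0 hdft.
have XE : \sum_(s < n) ((c1 s)%:R : R) ^+ 2 = X%:R.
  rewrite /X natr_sum; apply: eq_bigr => s _; rewrite /c1.
  by case: asboolP => _; rewrite ?expr1n ?expr0n.
rewrite XE in conv.
pose u (t : nat) := \sum_(s < n) ((c1 s)%:R : R)%:C * g (t + s)%N.
have key (t : nat) : X%:R * normc (g t) <= normc (u t) + 2 * eps * X%:R.
  have : normc (X%:R%:C * g t - u t) <= 2 * eps * X%:R.
    have -> : X%:R%:C * g t - u t = \sum_(s < n) ((c1 s)%:R : R)%:C * (g t - g (t + s)%N).
      rewrite /u /X natr_sum rmorph_sum mulr_suml -sumrB.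
      by apply: eq_bigr => s _; rewrite mulrBr.
    rewrite (le_trans (normc_sum _ _ _))// /X natr_sum mulr_sumr.
    apply: ler_sum => s _; rewrite normcZ /c1; case: asboolP => hs.
      rewrite normr1 mul1r mulr1 normcBC /g natrD mulrDl; exact: hs.
    by rewrite normr0 mul0r mulr0.
  have := normc_le (X%:R%:C * g t) (u t); rewrite normcZ ger0_norm//.
  by lra.
have key2 (t : nat) : X%:R ^+ 2 * normc (g t) ^+ 2 <= 2 * normc (u t) ^+ 2 + 8 * eps ^+ 2 * X%:R ^+ 2.
  have k1 := key t.
  have a0 : 0 <= X%:R * normc (g t) by rewrite mulr_ge0// normc_ge0.
  have b0 := normc_ge0 (u t).
  have : (X%:R * normc (g t)) ^+ 2 <= (normc (u t) + 2 * eps * X%:R) ^+ 2 by rewrite lerXn2r// nnegrE// (le_trans a0).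
  have : 0 <= (normc (u t) - 2 * eps * X%:R) ^+ 2 by exact: sqr_ge0.
  have -> : 8 * eps ^+ 2 * X%:R ^+ 2 = 2 * (2 * eps * X%:R) ^+ 2 by ring.
  rewrite -exprMn; move: (2 * eps * _) (X%:R * _) (normc _) => x1 x2 x3.
  by rewrite sqrrB sqrrD; lra.
have S1 : X%:R ^+ 2 * \sum_(t < n) normc (g t) ^+ 2 <=
    2 * ((e * (2 * n)%:R) ^+ 2 * X%:R) + 8 * eps ^+ 2 * X%:R ^+ 2 * n%:R.
  rewrite mulr_sumr.
  apply: (@le_trans _ _ (\sum_(t < n) (2 * normc (u t) ^+ 2 + 8 * eps ^+ 2 * X%:R ^+ 2))).
    by apply: ler_sum => t _; exact: key2.
  rewrite big_split /= -mulr_sumr sumr_const card_ord lerD//; first by rewrite ler_wpM2l.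
  by rewrite mulr_natr.
have S2 : e0 ^+ 2 * Y%:R <= \sum_(t < n) normc (g t) ^+ 2.
  rewrite /Y natr_sum mulr_sumr; apply: ler_sum => t _; rewrite /c2.
  case: asboolP => hs; last by rewrite mulr0 sqr_ge0.
  by rewrite mulr1 lerXn2r// nnegrE ?normc_ge0// ltW.
have X0 : 0 < X%:R :> R by rewrite -(pmulr_rgt0 _ q0R) (lt_le_trans nR).
have S3 : X%:R * (e0 ^+ 2 * Y%:R) <= 8 * e ^+ 2 * n%:R ^+ 2 + 8 * eps ^+ 2 * X%:R * n%:R.
  rewrite -(ler_pM2l X0).
  have h1 : X%:R ^+ 2 * (e0 ^+ 2 * Y%:R) <= X%:R ^+ 2 * \sum_(t < n) normc (g t) ^+ 2.
    by rewrite ler_wpM2l// sqr_ge0.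
  have h2 := le_trans h1 S1.
  move: h2; rewrite natrM; lra.
have S4 : 8 * e ^+ 2 * n%:R ^+ 2 <= 8 * eps ^+ 2 * X%:R * n%:R.
  have -> : eps = e * q0%:R by rewrite /e divfK// gt_eqF.
  have q01 : 1 <= q0%:R :> R by rewrite ler1n.
  have hn : n%:R ^+ 2 <= q0%:R ^+ 2 * X%:R * n%:R :> R.
    rewrite expr2 ler_wpM2r// (le_trans XN)// ler_wpM2r// expr2 ler_peMl//.
  have aux (E a b c : R) : E * c ^+ 2 <= E * (a ^+ 2 * b * c) -> 8 * E * c ^+ 2 <= 8 * (E * a ^+ 2) * b * c by lra.
  by rewrite [(e * _) ^+ 2]exprMn; apply: aux; rewrite ler_wpM2l// sqr_ge0.
have S5 : X%:R * (e0 ^+ 2 * Y%:R) <= 16 * eps ^+ 2 * X%:R * n%:R by lra.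
have S6 : e0 ^+ 2 * Y%:R <= 16 * eps ^+ 2 * n%:R by rewrite -(ler_pM2l X0); lra.
have e0E : e0 = 8 * q2%:R * eps.
  by rewrite /eps /h natrM; field; rewrite gt_eqF.
have eps2 : 0 < eps ^+ 2 by rewrite exprn_gt0.
have q21 : 1 <= q2%:R :> R by rewrite ler1n.
have S7 : 64 * q2%:R ^+ 2 * Y%:R <= 16 * n%:R :> R.
  by rewrite -(ler_pM2l eps2); move: S6; rewrite e0E !exprMn; lra.
have S8 : q2%:R * n%:R <= q2%:R ^+ 2 * Y%:R :> R by rewrite expr2 -mulrA ler_wpM2l.
have S9 : n%:R <= q2%:R * n%:R :> R by rewrite ler_peMl.
by lra.
Qed.

End Uniq.

(** * Elementary estimates of integrals *)

Section Kernel.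
Context {R : realType}.
Notation itg := (@integral_on R).
Notation bb := (@bounded_borel R).
Implicit Types (a b t s : R).

Lemma itg_FTC (f F : R -> R) a b : a <= b -> {within `[a, b], continuous f} ->
  (forall x, a <= x <= b -> is_derive x 1 F (f x)) -> itg a b f = F b - F a.
Proof.
rewrite le_eqVlt => /predU1P[<- _ _|ab cf dF]; first by rewrite itg_point subrr.
rewrite /integral_on /Rintegral (continuous_FTC2 ab cf (F := F))//.
- have cF x : a <= x <= b -> {for x, continuous F}.
    by move=> /dF[+ _] => /derivable1_diffP/differentiable_continuous.
  split.
  + by move=> x; rewrite in_itv/= => /andP[/ltW ax /ltW xb]; have [] := dF x; rewrite ?ax ?xb.
  + by apply: cvg_at_right_filter; apply: cF; rewrite lexx ltW.
  + by apply: cvg_at_left_filter; apply: cF; rewrite lexx ltW.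
- move=> x; rewrite in_itv/= => /andP[/ltW ax /ltW xb]; rewrite derive1E.
  have h : is_derive x 1 F (f x) by apply: dF; rewrite ax xb.
  by rewrite derive_val.
Qed.

Lemma eq_itg_nz a b (u v : R -> R) : bb u -> bb v -> (forall t, t != 0 -> u t = v t) ->
  itg a b u = itg a b v.
Proof.
move=> bu bv h; apply: eq_itg_ae => //.
exists [set 0]; split => //; first by rewrite lebesgue_measure_set1.
by move=> t /= ut; apply: contrapT => /eqP t0; apply: ut; exact: h.
Qed.

(** Cut the half line into unit cells: the weight C/(1+t^2) is summable over them. *)
Lemma itg_cell (u v : R -> R) (e C T : R) : bb u -> bb v ->
  (forall t, 0 <= u t) -> (forall t, 0 <= v t) -> 0 <= C ->
  (forall t, v t * (1 + t ^+ 2) <= C) -> (forall y, itg y (y + 1) u <= e) -> 0 <= T ->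
  itg 0 T (fun t => u t * v t) <= 3 * C * e.
Proof.
move=> bu bv u0 v0 C0 vC ue T0.
have e0 : 0 <= e by rewrite (le_trans _ (ue 0))// itg_ge0.
have buv : bb (fun t => u t * v t) by exact: bbM.
have H n : itg 0 n%:R (fun t => u t * v t) <= 3 * C * e * (1 - (n.+1%:R)^-1).
  elim: n => [|n ih]; first by rewrite itg_point invr1 subrr mulr0.
  rewrite (@itg_cat _ n%:R)//; last by rewrite ler_nat.
  have : itg n%:R n.+1%:R (fun t => u t * v t) <= C / (1 + n%:R ^+ 2) * e.
    apply: (@le_trans _ _ (itg n%:R n.+1%:R (fun t => C / (1 + n%:R ^+ 2) * u t))).
      apply: le_itg => //; first by apply: bbM => //; exact: bb_cst.
      move=> t /andP[t1 t2]; rewrite mulrC ler_wpM2r//.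
      have n2 : 0 < 1 + n%:R ^+ 2 :> R by rewrite ltr_pwDl// sqr_ge0.
      rewrite ler_pdivlMr//; apply: le_trans (vC t); rewrite ler_wpM2l// lerD2l.
      by rewrite lerXn2r// nnegrE// (le_trans _ t1).
    rewrite itgZ//; have := ue n%:R; rewrite natr1 => h.
    by rewrite ler_wpM2l// divr_ge0// addr_ge0// sqr_ge0.
  have : C / (1 + n%:R ^+ 2) * e <= 3 * C * e * ((n.+1%:R)^-1 - (n.+2%:R)^-1).
    have -> : C / (1 + n%:R ^+ 2) * e = C * e * (1 + n%:R ^+ 2)^-1 by ring.
    have -> : 3 * C * e * ((n.+1%:R)^-1 - (n.+2%:R)^-1) = C * e * (3 * ((n.+1%:R)^-1 - (n.+2%:R)^-1)) by ring.
    rewrite ler_wpM2l// ?mulr_ge0//.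
    have -> : (n.+1%:R)^-1 - (n.+2%:R)^-1 = (n.+1%:R * n.+2%:R)^-1 :> R.
      by rewrite -(natr1 n.+1) -(natr1 n); field; rewrite !gt_eqF// ?ltr_wpDl.
    have n2 : 0 < 1 + n%:R ^+ 2 :> R by rewrite ltr_pwDl// sqr_ge0.
    have n1 : 0 < n.+1%:R * n.+2%:R :> R by rewrite mulr_gt0.
    rewrite -(ler_pM2r n2) mulVf ?gt_eqF// -mulrA [_^-1 * _]mulrC mulrA ler_pdivlMr// mul1r.
    rewrite -(natr1 n.+1) -(natr1 n).
    case: n {ih n1 n2} => [|n]; first by rewrite expr0n/=; lra.
    have : 0 <= n%:R :> R by [].
    rewrite -natr1; nra.
  move=> h2 h1; apply: (le_trans (lerD ih (le_trans h1 h2))).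
  by rewrite -mulrDr addrA subrK.
have /andP[h1 h2] := truncn_itv T0.
set n := (Num.truncn T).+1 in h2.
apply: (@le_trans _ _ (itg 0 n%:R (fun t => u t * v t))).
  by apply: itg_mono => //; [move=> t _; exact: mulr_ge0|exact: ltW].
apply: (le_trans (H n)); rewrite ler_piMr ?mulr_ge0//. 
Qed.

Lemma itg_tail (u : R -> R) (C a b : R) : bb u -> 0 < a -> a <= b ->
  (forall t, a <= t -> `|u t| * t ^+ 2 <= C) -> itg a b (fun t => `|u t|) <= C / a.
Proof.
move=> bu a0 ab h.
have C0 : 0 <= C by rewrite (le_trans _ (h a _))// mulr_ge0// sqr_ge0.
pose w t := C * (Num.max a t) ^- 2.
have cw : continuous (fun t => (Num.max a t) ^- 2).
  move=> x; have m0 : Num.max a x != 0 by rewrite gt_eqF// lt_max a0.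
  have cm : Num.max a y @[y --> x] --> Num.max a x.
    by apply: (@continuous_max _ _ (fun=> a) id); [exact: cvg_cst|exact: cvg_id].
  apply: cvgV; first by rewrite expf_neq0.
  by rewrite expr2; under eq_fun do rewrite expr2; exact: cvgM.
have bw : bb w.
  apply: bbM; first exact: bb_cst.
  apply: (@bb_cont _ _ (a ^- 2) cw) => t.
  have at0 : 0 < Num.max a t by rewrite lt_max a0.
  rewrite ger0_norm ?invr_ge0 ?sqr_ge0// lef_pV2 ?posrE ?exprn_gt0//.
  by rewrite lerXn2r ?nnegrE ?(ltW a0) ?(ltW at0)// le_max lexx.
apply: (@le_trans _ _ (itg a b w)).
  apply: le_itg => //; first exact: bb_norm.
  move=> t /andP[at1 _]; rewrite /w max_r// ler_pdivlMr ?h//.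
  by rewrite exprn_gt0// (lt_le_trans a0).
have -> : itg a b w = (- (C / b)) - (- (C / a)).
  apply: (@itg_FTC w (fun t => - (C / t))) => //.
    by apply: continuous_subspaceT => x; apply: cvgM; [exact: cvg_cst|exact: cw].
  move=> x /andP[ax _]; have x0 : x != 0 by rewrite gt_eqF// (lt_le_trans a0).
  rewrite /w max_r//.
  have d1 : is_derive x 1 (fun t : R => t^-1) (- x ^- 2).
    have h1 : is_derive x 1 (id : R -> R) 1 by exact: is_derive_id.
    split; first by apply: derivableV.
    by rewrite deriveV// derive_val scaler1.
  have -> : (fun t => - (C / t)) = (- C) *: (fun t : R => t^-1).
    by apply/funext => t; rewrite -[RHS]/(- C * t^-1) mulNr.
  apply: is_derive_eq.
  by rewrite /GRing.scale/= mulrNN.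
have b0 : 0 < b by exact: lt_le_trans ab.
by rewrite opprK addrC lerBlDr lerDl divr_ge0// ltW.
Qed.

End Kernel.

(** * The Fejer kernel *)

Section FejerKernel.
Context {R : realType}.
Notation itg := (@integral_on R).
Notation bb := (@bounded_borel R).
Implicit Types (a b t s : R).

(** This is (1 - cos (a t)) / t^2 (see [fejerE]); written as a transform of the tent
    on [0, a], it is defined at t = 0 and is visibly bounded and Lipschitz. *)
Definition fejer a t : R := itg 0 a (fun m => (a - m) * \1_`[0, a] m * cos (m * t)).

Lemma indic_itvE a b t : a <= t <= b -> \1_`[a, b] t = 1 :> R.
Proof. by move=> h; rewrite indicE mem_set//= in_itv. Qed.

Lemma bb_tri a : bb (fun m => (a - m) * \1_`[0, a] m).
Proof.
split.
  by apply: measurable_funM; [exact: measurable_funB|exact: measurable_indic].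
exists `|a| => t; rewrite indicE.
case: (boolP (t \in _)) => h; rewrite ?mulr1 ?mulr0 ?normr0//.
move: h; rewrite inE/= in_itv/= => /andP[h1 h2].
by rewrite !ger0_norm; lra.
Qed.

Lemma bb_cosM t : bb (fun m => cos (m * t)).
Proof. by have := bb_cos t 0; congr bb; apply/funext => m; rewrite addr0 mulrC. Qed.

Lemma bb_fejer_integrand a t : bb (fun m => (a - m) * \1_`[0, a] m * cos (m * t)).
Proof. by apply: bbM; [exact: bb_tri|exact: bb_cosM]. Qed.

Let bfi := bb_fejer_integrand.

Lemma fejerE a t : 0 <= a -> fejer a t * t ^+ 2 = 1 - cos (a * t).
Proof.
move=> a0; rewrite /fejer -itgZr//.
pose F m := (a - m) * (t * sin (m * t)) - cos (m * t).
have -> : itg 0 a (fun m => (a - m) * \1_`[0, a] m * cos (m * t) * t ^+ 2) =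
          itg 0 a (fun m => (a - m) * cos (m * t) * t ^+ 2).
  by apply: eq_itg => m hm; rewrite indic_itvE ?mulr1.
have -> : itg 0 a (fun m => (a - m) * cos (m * t) * t ^+ 2) = F a - F 0; last first.
  by rewrite /F subrr !mul0r sin0 cos0 mulr0 mulr0; ring.
apply: itg_FTC => //.
- apply: continuous_subspaceT => x.
  apply: cvgM; last exact: cvg_cst.
  apply: cvgM; first by apply: cvgB; [exact: cvg_cst|exact: cvg_id].
  apply: (@cvg_comp _ _ _ (fun m => m * t) cos _ (nbhs (x * t))); last exact: continuous_cos.
  by apply: cvgM; [exact: cvg_id|exact: cvg_cst].
- move=> x _; rewrite /F.
  have dm : is_derive x 1 (fun m => m * t) t.
    have -> : (fun m => m * t) = t *: (id : R -> R) by apply/funext => m; rewrite /GRing.scale/= mulrC.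
    by apply: is_derive_eq; rewrite /GRing.scale/= mulr1.
  have ds : is_derive x 1 (fun m => sin (m * t)) (cos (x * t) * t).
    by apply: is_derive_eq; rewrite /GRing.scale/= mulrC.
  have dc : is_derive x 1 (fun m => cos (m * t)) (- sin (x * t) * t).
    by apply: is_derive_eq; rewrite /GRing.scale/= mulrC.
  apply: is_derive_eq.
  by rewrite /GRing.scale/=; ring.
Qed.

Lemma fejerN a t : fejer a (- t) = fejer a t.
Proof. by congr itg; apply/funext => m; rewrite mulrN cosN. Qed.

Let indic_bd a m : 0 <= m <= a -> `|(a - m) * \1_`[0, a] m| <= a.
Proof.
move=> hm; rewrite indic_itvE ?mulr1//.
by move/andP : hm => [h1 h2]; rewrite ger0_norm; lra.
Qed.

Lemma fejer_bound a t : 0 <= a -> `|fejer a t| <= a ^+ 2.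
Proof.
move=> a0; rewrite expr2 -[X in a * X]subr0; apply: itg_bound => // m hm.
by rewrite normrM -[leRHS]mulr1 ler_pM// ?indic_bd// ler_norml cos_geN1 cos_le1.
Qed.

Lemma fejer_lip a t s : 0 <= a -> `|fejer a t - fejer a s| <= a ^+ 3 * `|t - s|.
Proof.
move=> a0; rewrite /fejer -itgB//.
have -> : a ^+ 3 * `|t - s| = (a * (a * `|t - s|)) * (a - 0) by ring.
apply: itg_bound => //; first exact: bbB.
move=> m hm; rewrite -mulrBr normrM ler_pM// ?indic_bd//.
rewrite (le_trans (cos_lip _ _))// -mulrBr normrM ler_wpM2r//.
by move/andP : hm => [h1 h2]; rewrite ger0_norm.
Qed.

Lemma lip_continuous (u : R -> R) (C : R) : (forall t s, `|u t - u s| <= C * `|t - s|) -> continuous u.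
Proof.
move=> h x; apply/cvgrPdist_le => e e0.
have C0 : 0 <= C by have := h 1 0; rewrite subr0 normr1 mulr1; apply: le_trans.
have d0 : 0 < e / (C + 1) by rewrite divr_gt0// ltr_wpDl.
near=> y; rewrite (le_trans (h _ _))//.
have : `|x - y| <= e / (C + 1).
  by near: y; apply/nbhs_ballP; exists (e / (C + 1)) => //= z; rewrite /ball/= => /ltW.
rewrite ler_pdivlMr ?ltr_wpDl// => h1.
have := normr_ge0 (x - y); nra.
Unshelve. all: by end_near. Qed.

Lemma bb_fejer a : 0 <= a -> bb (fejer a).
Proof.
move=> a0; apply: (@bb_cont _ _ (a ^+ 2)); last by move=> t; exact: fejer_bound.
by apply: (@lip_continuous _ (a ^+ 3)) => t s; exact: fejer_lip.
Qed.

Lemma fejer_ge0 a t : 0 <= a -> t != 0 -> 0 <= fejer a t.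
Proof.
move=> a0 t0; have t2 : 0 < t ^+ 2 by rewrite exprn_even_gt0.
by rewrite -(pmulr_lge0 _ t2) fejerE// subr_ge0 cos_le1.
Qed.

Lemma itg_fejer_tail a s t : 0 <= a -> 0 < s -> s <= t -> `|itg s t (fejer a)| <= 2 / s.
Proof.
move=> a0 s0 st; apply: (le_trans (itg_norm _ _ (bb_fejer a0))).
apply: itg_tail => //; first exact: bb_fejer.
move=> u _; rewrite -[u ^+ 2]ger0_norm ?sqr_ge0// -normrM fejerE//.
rewrite ger0_norm ?subr_ge0 ?cos_le1//; have := cos_geN1 (a * u); lra.
Qed.

Lemma cvg_rate (h : R -> R) (C : R) : (forall s t, 0 < s -> s <= t -> `|h t - h s| <= C / s) ->
  exists A, forall t, 0 < t -> `|h t - A| <= C / t.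
Proof.
move=> H.
have C0 : 0 <= C by have := H 1 1 ltr01 (lexx _); rewrite subrr normr0 divr1.
have [A hA] : exists A, forall e : R, 0 < e -> exists L0, forall L, L0 <= L -> `|h L - A| <= e.
  have cvh : cauchy (h @ +oo).
    apply/cauchyP => e e0; pose L0 := C / e + 1.
    have L00 : 0 < L0 by rewrite ltr_wpDl// divr_ge0// ltW.
    exists (h L0); change (\forall x \near +oo, ball (h L0) e (h x)).
    near=> L; rewrite /ball/= distrC.
    have hL : L0 <= L by near: L; apply: nbhs_pinfty_ge; exact: num_real.
    rewrite (le_lt_trans (H _ _ L00 hL))// ltr_pdivrMr// mulrDr mulr1 mulrC divfK ?gt_eqF//.
    by rewrite ltrDl.
  have /cauchy_cvgP cvh' := cvh.
  exists (lim (h @ +oo)) => e e0.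
  have hn : \forall x \near +oo, `|lim (h @ +oo) - h x| <= e.
    by move/cvgrPdist_le : cvh'; exact.
  case: hn => L0 [_ hL0]; exists (L0 + 1) => L hL; rewrite distrC; apply: hL0.
  by rewrite (lt_le_trans _ hL)// ltrDl.
exists A => t t0; apply/ler_addgt0Pr => e e0.
have [L0 hL0] := hA e e0.
have h1 := hL0 (Num.max L0 t); rewrite le_max lexx in h1.
have h2 := H t (Num.max L0 t) t0; rewrite le_max lexx orbT in h2.
rewrite (_ : h t - A = (h (Num.max L0 t) - A) - (h (Num.max L0 t) - h t)); last by ring.
by rewrite (le_trans (ler_normB _ _))// addrC lerD// ?h1 ?h2.
Unshelve. all: by end_near. Qed.

Lemma itg_scale (G : R -> R) a T : 0 < a -> 0 <= T -> continuous G ->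
  itg 0 (a * T) G = itg 0 T (fun t => G (a * t) * a).
Proof.
move=> a0 T0 cG; rewrite /integral_on /Rintegral; congr fine.
have dF (x : R) : is_derive x 1 (fun t => a * t) a.
  have -> : (fun t => a * t) = a *: (id : R -> R) by apply/funext.
  by apply: is_derive_eq; rewrite /GRing.scale/= mulr1.
have F' : derive1 (fun t : R => a * t) = cst a.
  by apply/funext => x; rewrite derive1E derive_val.
have cF : continuous (fun t : R => a * t).
  by move=> x; apply: cvgM; [exact: cvg_cst|exact: cvg_id].
have := @integration_by_substitution_increasing R (fun t => a * t) G 0 T T0.
rewrite mulr0 F'; apply.
- by move=> x y _ _ xy; rewrite ltr_pM2l.
- by move=> x _; exact: cvg_cst.
- exact: is_cvg_cst.
- exact: is_cvg_cst.
- split.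
  + by move=> x _; have [] := dF x.
  + by apply: cvg_at_right_filter; exact: cF.
  + by apply: cvg_at_left_filter; exact: cF.
- exact: continuous_subspaceT.
Qed.

(** The substitution a t reduces to a = 1; the integral of the nonnegative kernel is
    positive because 1 - cos t >= 1 on [pi/2, pi]. *)
Lemma fejer_mass : exists2 c0 : R, 0 < c0 & forall a T, 0 <= a -> 0 < T ->
  `|itg 0 T (fejer a) - a * c0| <= 2 / T.
Proof.
have b1 : bb (fejer 1) by exact: bb_fejer.
have [|c0 hc0] := @cvg_rate (fun T => itg 0 T (fejer 1)) 2.
  move=> s t s0 st; rewrite (itg_cat b1 (ltW s0) st) addrAC subrr add0r.
  exact: itg_fejer_tail.
exists c0; last first.
  move=> a T; rewrite le_eqVlt => /predU1P[<- T0|a0 T0].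
    rewrite mul0r subr0 (_ : fejer 0 = fun=> 0) ?itg0 ?normr0 ?divr_ge0 ?(ltW T0)//.
    apply/funext => t; apply/eqP; rewrite -normr_le0.
    by have := @fejer_bound 0 t (lexx _); rewrite expr0n.
  have aT : 0 < a * T by rewrite mulr_gt0.
  have -> : itg 0 T (fejer a) = a * itg 0 (a * T) (fejer 1).
    rewrite itg_scale//; [|exact: ltW|by apply: (@lip_continuous _ (1 ^+ 3)) => t s; exact: fejer_lip].
    have ba : bb (fun t => fejer 1 (a * t) * a).
      apply: bbM; last exact: bb_cst.
      by apply: bb_comp b1; exact: measurable_funM.
    rewrite -itgZ//; apply: eq_itg_nz; [exact: bb_fejer (ltW a0)|by apply: bbM => //; exact: bb_cst|].
    move=> t t0; have t2 : t ^+ 2 != 0 by rewrite expf_neq0.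
    apply: (mulIf t2); rewrite fejerE ?(ltW a0)//.
    transitivity (fejer 1 (a * t) * (a * t) ^+ 2); first by rewrite fejerE// mul1r.
    by ring.
  rewrite -mulrBr normrM gtr0_norm//.
  apply: (le_trans (ler_wpM2l (ltW a0) (hc0 _ aT))).
  by rewrite le_eqVlt; apply/orP; left; apply/eqP; field; rewrite !gt_eqF.
have pi0 := pi_gt0 R.
have lb T : pi <= T -> 1 / (2 * pi) <= itg 0 T (fejer 1).
  move=> piT.
  have h0 : 0 <= pi / 2 :> R by lra.
  have h1 : pi / 2 <= pi :> R by lra.
  have nn s t : 0 <= itg s t (fejer 1).
    have -> : itg s t (fejer 1) = itg s t (fun u => `|fejer 1 u|).
      apply: eq_itg_nz => //; first exact: bb_norm.
      by move=> u u0; rewrite ger0_norm// fejer_ge0.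
    by apply: itg_ge0.
  rewrite (itg_cat b1 h0 (le_trans h1 piT)) (itg_cat b1 h1 piT).
  have : 1 / (2 * pi) <= itg (pi / 2) pi (fejer 1).
    have aux (P : R) : 0 < P -> 1 / (2 * P) = P ^- 2 * (P - P / 2).
      by move=> P0; field; rewrite gt_eqF.
    rewrite aux// -itg_cst//; apply: le_itg => //; first exact: bb_cst.
    move=> t /andP[t1 t2]; have t0 : 0 < t by rewrite (lt_le_trans _ t1)//; lra.
    rewrite -(ler_pM2r (exprn_gt0 2 t0)) fejerE// mul1r.
    apply: (@le_trans _ _ 1).
      by rewrite mulrC ler_pdivrMr ?exprn_gt0// mul1r lerXn2r// nnegrE ltW.
    have : cos t <= 0; last by lra.
    have -> : t = (t - pi) + pi by ring.
    rewrite cosDpi oppr_le0; apply: cos_ge0_pihalf.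
    by apply/andP; split; lra.
  by have := nn 0 (pi / 2); have := nn pi T; lra.
pose T : R := Num.max pi (8 * pi).
have T0 : 0 < T by rewrite lt_max pi0.
have h1 := lb T; rewrite le_max lexx in h1; have {}h1 := h1 isT.
have := hc0 T T0; rewrite ler_norml => /andP[_ h2].
have h3 : 2 / T <= 1 / (4 * pi).
  rewrite ler_pdivrMr// mulrC mul1r ler_pdivlMr ?mulr_gt0//.
  by rewrite le_max; apply/orP; right; lra.
have h4 : 1 / (4 * pi) < 1 / (2 * pi) :> R.
  by rewrite !mul1r ltf_pV2 ?posrE ?mulr_gt0//; lra.
lra.
Qed.

End FejerKernel.

(** * The trapezoid kernel *)

Section Trapezoid.
Context {R : realType}.
Notation itg := (@integral_on R).
Notation bb := (@bounded_borel R).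
Notation normc := (@ComplexField.Normc.normc R).
Implicit Types (t s : R).

Lemma itg_cell2 (u v : R -> R) (e C T : R) : bb u -> bb v ->
  (forall t, 0 <= u t) -> (forall t, 0 <= v t) -> 0 <= C ->
  (forall t, v t * (1 + t ^+ 2) <= C) -> (forall y, itg y (y + 1) u <= e) -> 0 <= T ->
  itg (- T) T (fun t => u t * v t) <= 6 * C * e.
Proof.
move=> bu bv u0 v0 C0 vC ue T0.
have buv : bb (fun t => u t * v t) by exact: bbM.
rewrite (@itg_cat _ 0)//; last by rewrite oppr_le0.
have -> : itg (- T) 0 (fun t => u t * v t) = itg 0 T (fun t => u (0 - t) * v (0 - t)).
  rewrite -[X in itg _ X _]oppr0 -itg_refl//.
  by congr itg; apply/funext => t; rewrite sub0r.
have h1 : itg 0 T (fun t => u (0 - t) * v (0 - t)) <= 3 * C * e.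
  apply: (@itg_cell _ (fun t => u (0 - t)) (fun t => v (0 - t))) => //.
  - exact: bb_refl.
  - exact: bb_refl.
  - by move=> t; have := vC (0 - t); rewrite sub0r sqrrN.
  - move=> y; have -> : (fun t => u (0 - t)) = (fun t => u (- t)) by apply/funext => t; rewrite sub0r.
    rewrite itg_refl//; have := ue (- (y + 1)); have -> // : - (y + 1) + 1 = - y by ring.
have h2 : itg 0 T (fun t => u t * v t) <= 3 * C * e by exact: itg_cell.
lra.
Qed.

Variables (g b : R).
Hypotheses (g0 : 0 <= g) (b0 : 0 < b).

Let gb0 : 0 <= g + b. Proof. by rewrite addr_ge0// ltW. Qed.

(** A difference of two Fejer kernels: its Fourier transform is a multiple of the
    trapezoid that is constant on [-g, g] and vanishes outside [-(g+b), g+b]. *)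
Definition trapk t : R := fejer (g + b) t - fejer g t.

Lemma trapkE t : trapk t * t ^+ 2 = cos (g * t) - cos ((g + b) * t).
Proof. by rewrite /trapk mulrBl !fejerE//; ring. Qed.

Lemma trapkN t : trapk (- t) = trapk t.
Proof. by rewrite /trapk !fejerN. Qed.

Lemma bb_trapk : bb trapk.
Proof. by apply: bbB; exact: bb_fejer. Qed.

Lemma trapk_bound t : `|trapk t| <= 2 * (g + b) ^+ 2.
Proof.
rewrite (le_trans (ler_normB _ _))//.
have h1 := fejer_bound t gb0; have h2 := fejer_bound t g0.
have : g ^+ 2 <= (g + b) ^+ 2 by rewrite lerXn2r// ?nnegrE// lerDl ltW.
lra.
Qed.

Lemma trapk_sqr t : `|trapk t| * t ^+ 2 <= 2.
Proof.
rewrite -[t ^+ 2]ger0_norm ?sqr_ge0// -normrM trapkE (le_trans (ler_normB _ _))//.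
by rewrite (_ : 2 = 1 + 1 :> R)// lerD// ler_norml cos_geN1 cos_le1.
Qed.

Definition trapkC : R := 2 * (g + b) ^+ 2 + 2.

Lemma trapk_decay t : `|trapk t| * (1 + t ^+ 2) <= trapkC.
Proof. by rewrite mulrDr mulr1 lerD ?trapk_bound ?trapk_sqr. Qed.

Lemma trapkC_gt0 : 0 < trapkC.
Proof. by rewrite ltr_wpDl// mulr_ge0// sqr_ge0. Qed.

Lemma trapk_diff : exists2 C : R, 0 <= C & forall t h, `|h| <= 1 ->
  `|trapk (t + h) - trapk t| * (1 + t ^+ 2) <= C * `|h|.
Proof.
have C0 := ltW trapkC_gt0.
exists (2 * (g + b) ^+ 3 + (g + (g + b)) + 3 * trapkC).
  by rewrite !addr_ge0// ?mulr_ge0// ?exprn_ge0// ltW.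
move=> t h h1.
have h0 := normr_ge0 h.
have e1 : `|trapk (t + h) - trapk t| <= 2 * (g + b) ^+ 3 * `|h|.
  have -> : trapk (t + h) - trapk t =
     (fejer (g + b) (t + h) - fejer (g + b) t) - (fejer g (t + h) - fejer g t) by rewrite /trapk; ring.
  rewrite (le_trans (ler_normB _ _))//.
  have := @fejer_lip _ (g + b) (t + h) t gb0.
  have := @fejer_lip _ g (t + h) t g0.
  rewrite addrAC subrr add0r.
  have : g ^+ 3 * `|h| <= (g + b) ^+ 3 * `|h|.
    by rewrite ler_wpM2r// lerXn2r// ?nnegrE// lerDl ltW.
  lra.
have e2 : `|trapk (t + h) - trapk t| * t ^+ 2 <= (g + (g + b) + 3 * trapkC) * `|h|.
  rewrite -[t ^+ 2]ger0_norm ?sqr_ge0// -normrM.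
  have -> : (trapk (t + h) - trapk t) * t ^+ 2 =
    ((cos (g * (t + h)) - cos (g * t)) - (cos ((g + b) * (t + h)) - cos ((g + b) * t)))
      - h * (trapk (t + h) * (2 * (t + h) - h)).
    have E1 := trapkE (t + h); have E2 := trapkE t.
    transitivity (trapk (t + h) * (t + h) ^+ 2 - trapk t * t ^+ 2 - h * (trapk (t + h) * (2 * (t + h) - h))).
      by ring.
    by rewrite E1 E2; ring.
  rewrite (le_trans (ler_normB _ _))// [leRHS]mulrDl lerD//.
    rewrite (le_trans (ler_normB _ _))// [leRHS]mulrDl lerD//.
      by rewrite (le_trans (cos_lip _ _))// -mulrBr addrAC subrr add0r normrM ger0_norm.
    by rewrite (le_trans (cos_lip _ _))// -mulrBr addrAC subrr add0r normrM ger0_norm.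
  rewrite normrM mulrC ler_wpM2r// normrM.
  set s := t + h; have d := trapk_decay s; have k0 := normr_ge0 (trapk s).
  have hs : `|2 * s - h| <= 3 * (1 + s ^+ 2).
    move: h1; move: s {d k0} => s; rewrite !ler_norml => /andP[? ?].
    by apply/andP; split; nra.
  apply: (le_trans (ler_wpM2l k0 hs)).
  by rewrite mulrCA ler_wpM2l.
rewrite mulrDr mulr1; lra.
Qed.

Variable c0 : R.
Hypothesis hc0 : forall a T, 0 <= a -> 0 < T -> `|itg 0 T (fejer a) - a * c0| <= 2 / T.

(** By the product formula for cosines, a sum of four integrals of Fejer kernels with
    parameters |g + b + l|, |g + b - l|, |g + l| and |g - l|. *)
Lemma trapk_fourier l T : 0 < T ->
  `|itg 0 T (fun t => trapk t * cos (l * t)) -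
    (`|g + b + l| + `|g + b - l| - `|g + l| - `|g - l|) / 2 * c0| <= 4 / T.
Proof.
move=> T0.
pose w t := (fejer `|g + b + l| t + fejer `|g + b - l| t - fejer `|g + l| t - fejer `|g - l| t) / 2.
have bf (a : R) : bb (fejer `|a|) by exact: bb_fejer.
have bw : bb w.
  by apply: bbM; [|exact: bb_cst]; apply: bbB => //; apply: bbB => //; apply: bbD.
have bk : bb (fun t => trapk t * cos (l * t)).
  apply: bbM; first exact: bb_trapk.
  by have := bb_cos l 0; congr bb; apply/funext => t; rewrite addr0.
have -> : itg 0 T (fun t => trapk t * cos (l * t)) = itg 0 T w.
  apply: eq_itg_nz => // t t0; have t2 : t ^+ 2 != 0 by rewrite expf_neq0.
  apply: (mulIf t2).
  have aux (A B C D x : R) : (A + B - C - D) * x = A * x + B * x - C * x - D * x by ring.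
  rewrite mulrAC trapkE /w mulrAC aux !fejerE//.
  have cosA (x : R) : cos (`|x| * t) = cos (x * t).
    by case: (ger0P x) => _ //; rewrite mulNr cosN.
  rewrite !cosA.
  have -> : (g + b + l) * t = (g + b) * t + l * t by ring.
  have -> : (g + b - l) * t = (g + b) * t - l * t by ring.
  have -> : (g + l) * t = g * t + l * t by ring.
  have -> : (g - l) * t = g * t - l * t by ring.
  by rewrite !cosD !sinN !cosN; field.
have wE : itg 0 T w = (itg 0 T (fejer `|g + b + l|) + itg 0 T (fejer `|g + b - l|)
    - itg 0 T (fejer `|g + l|) - itg 0 T (fejer `|g - l|)) / 2.
  rewrite /w itgZr; last by apply: bbB => //; apply: bbB => //; apply: bbD.
  by rewrite itgB//; [rewrite itgB//; [rewrite itgD//|exact: bbD]|apply: bbB => //; exact: bbD].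
rewrite {}wE {bw w bk}.
have n (x : R) := hc0 (normr_ge0 x) T0.
have aux (A B C D x y z u : R) : (A + B - C - D) / 2 - (x + y - z - u) / 2 * c0 =
  ((A - x * c0) + (B - y * c0) - (C - z * c0) - (D - u * c0)) / 2 by field.
have aux2 (A B C D e : R) : `|A| <= e -> `|B| <= e -> `|C| <= e -> `|D| <= e ->
    `|(A + B - C - D) / 2| <= 2 * e.
  rewrite !ler_norml => /andP[? ?] /andP[? ?] /andP[? ?] /andP[? ?].
  by apply/andP; split; lra.
rewrite aux (_ : 4 / T = 2 * (2 / T)); last by ring.
by apply: aux2; exact: n.
Qed.

Lemma trap_in l : `|l| <= g -> (`|g + b + l| + `|g + b - l| - `|g + l| - `|g - l|) / 2 = b.
Proof.
have b0' := ltW b0.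
by rewrite ler_norml => /andP[h1 h2]; rewrite !ger0_norm; lra.
Qed.

Lemma trap_out l : g + b <= `|l| -> (`|g + b + l| + `|g + b - l| - `|g + l| - `|g - l|) / 2 = 0.
Proof.
have b0' : (0 : R) <= b := ltW b0.
have g0' : (0 : R) <= g := g0.
case: (ger0P l) => l0 h.
  have l0' : (0 : R) <= l := l0.
  by rewrite (@ger0_norm _ (g + b + l)) ?(@ler0_norm _ (g + b - l)) ?(@ger0_norm _ (g + l)) ?(@ler0_norm _ (g - l)); lra.
have l0' : l <= (0 : R) := ltW l0.
by rewrite (@ler0_norm _ (g + b + l)) ?(@ger0_norm _ (g + b - l)) ?(@ler0_norm _ (g + l)) ?(@ger0_norm _ (g - l)); lra.
Qed.

End Trapezoid.

(** * Convolution of an almost periodic function with a kernel *)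

Section ComplexFubini.
Context {R : realType}.
Notation itg := (@integral_on R).
Notation citg := (@cintegral_on R).
Notation bbc := (@bounded_borelc R).
Notation normc := (@ComplexField.Normc.normc R).

Lemma citg_Fubini (a b c d : R) (K : R -> R -> R[i]) (M : R) :
  measurable_fun [set: R * R] (fun z => complex.Re (K z.1 z.2)) ->
  measurable_fun [set: R * R] (fun z => complex.Im (K z.1 z.2)) ->
  (forall x t, normc (K x t) <= M) ->
  citg a b (fun x => citg c d (fun t => K x t)) = citg c d (fun t => citg a b (fun x => K x t)).
Proof.
move=> m1 m2 hM; apply: complex_eq => /=.
- rewrite (@itg_Fubini _ a b c d (fun x t => complex.Re (K x t)) M)// => x t.
  by rewrite (le_trans (normc_Re _)).
- rewrite (@itg_Fubini _ a b c d (fun x t => complex.Im (K x t)) M)// => x t.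
  by rewrite (le_trans (normc_Im _)).
Qed.

Lemma cvg_ratec (h : R -> R[i]) (C : R) :
  (forall s t, 0 < s -> s <= t -> normc (h t - h s) <= C / s) ->
  exists A, forall t, 0 < t -> normc (h t - A) <= 2 * C / t.
Proof.
move=> H.
have [|a ha] := @cvg_rate _ (fun t => complex.Re (h t)) C.
  by move=> s t s0 st; rewrite -cReB (le_trans (normc_Re _))// H.
have [|b hb] := @cvg_rate _ (fun t => complex.Im (h t)) C.
  by move=> s t s0 st; rewrite -cImB (le_trans (normc_Im _))// H.
exists (a +i* b)%C => t t0; rewrite (le_trans (normc_ReIm _))// cReB cImB/=.
by have := ha t t0; have := hb t t0; rewrite -mulrA; lra.
Qed.

Lemma bbc_lip (u : R -> R[i]) (C M : R) : (forall t s, normc (u t - u s) <= C * `|t - s|) ->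
  (forall t, normc (u t) <= M) -> bbc u.
Proof.
move=> hl hM; split; apply: (@bb_cont _ _ M).
- apply: (@lip_continuous _ _ C) => t s; rewrite -cReB (le_trans (normc_Re _))//; exact: hl.
- by move=> t; rewrite (le_trans (normc_Re _)).
- apply: (@lip_continuous _ _ C) => t s; rewrite -cImB (le_trans (normc_Im _))//; exact: hl.
- by move=> t; rewrite (le_trans (normc_Im _)).
Qed.

Lemma citg_expi (a T : R) : a != 0 -> 0 <= T -> normc (citg 0 T (fun t => expi (a * t))) <= 4 / `|a|.
Proof.
move=> a0 T0.
have dm (x : R) : is_derive x 1 (fun m => a * m) a.
  have -> : (fun m => a * m) = a *: (id : R -> R) by apply/funext.
  by apply: is_derive_eq; rewrite /GRing.scale/= mulr1.
have cm : continuous (fun m : R => a * m).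
  by move=> x; apply: cvgM; [exact: cvg_cst|exact: cvg_id].
have e1 : itg 0 T (fun t => cos (a * t)) = sin (a * T) / a - sin (a * 0) / a.
  apply: (@itg_FTC _ _ (fun t => sin (a * t) / a)) => //.
    by apply: continuous_subspaceT => x; apply: (@cvg_comp _ _ _ (fun m => a * m) cos _ (nbhs (a * x))); [exact: cm|exact: continuous_cos].
  move=> x _; have ds : is_derive x 1 (fun m => sin (a * m)) (cos (a * x) * a).
    by apply: is_derive_eq; rewrite /GRing.scale/= mulrC.
  have -> : (fun t => sin (a * t) / a) = a^-1 *: (fun t : R => sin (a * t)).
    by apply/funext => t; rewrite -[RHS]/(a^-1 * sin (a * t)) mulrC.
  by apply: is_derive_eq; rewrite /GRing.scale/=; field.
have e2 : itg 0 T (fun t => sin (a * t)) = (- (cos (a * T) / a)) - (- (cos (a * 0) / a)).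
  apply: (@itg_FTC _ _ (fun t => - (cos (a * t) / a))) => //.
    by apply: continuous_subspaceT => x; apply: (@cvg_comp _ _ _ (fun m => a * m) sin _ (nbhs (a * x))); [exact: cm|exact: continuous_sin].
  move=> x _; have ds : is_derive x 1 (fun m => cos (a * m)) (- sin (a * x) * a).
    by apply: is_derive_eq; rewrite /GRing.scale/= mulrC.
  have -> : (fun t => - (cos (a * t) / a)) = (- a^-1) *: (fun t : R => cos (a * t)).
    by apply/funext => t; rewrite -[RHS]/(- a^-1 * cos (a * t)) mulNr mulrC.
  by apply: is_derive_eq; rewrite /GRing.scale/=; field.
rewrite (le_trans (normc_ReIm _))//= /expi/= e1 e2 -mulrBl opprK -[- (_ / _)]mulNr -mulrDl !normrM !normfV -mulrDl ler_wpM2r ?invr_ge0//.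
have aux (x y z w : R) : `|x| <= 1 -> `|y| <= 1 -> `|z| <= 1 -> `|w| <= 1 -> `|x - y| + `|- z + w| <= 4.
  move=> hx hy hz hw; rewrite (le_trans (lerD (ler_normB _ _) (ler_normD _ _)))// normrN; lra.
by apply: aux; rewrite ler_norml ?sin_geN1 ?sin_le1 ?cos_geN1 ?cos_le1.
Qed.

End ComplexFubini.

Section Representation.
Context {R : realType}.
Notation itg := (@integral_on R).
Notation citg := (@cintegral_on R).
Notation bbc := (@bounded_borelc R).
Notation bb := (@bounded_borel R).
Notation normc := (@ComplexField.Normc.normc R).

Variables (f : R -> R[i]) (M : R).
Hypothesis bf : bbc f.
Hypothesis fM : forall t, normc (f t) <= M.
Hypothesis fap : mean_ap f.
Variable A : R -> R[i].
Hypothesis hA : forall l (e : R), 0 < e -> exists L0, forall L, L0 <= L ->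
  normc (fint f l 0 L - L%:C * A l) <= e * L.

Let M0 : (0 : R) <= M. Proof. by rewrite (le_trans _ (fM 0))// normc_ge0. Qed.

(** A translation number multiplies the coefficient by a phase and moves it by at most
    e; hence translation numbers of f serve for its trigonometric sums too. *)
Lemma coef_phase l (e tau : R) : ap_shift f e tau -> normc (1 - expi (- (l * tau))) * normc (A l) <= e.
Proof.
move=> ap; apply/ler_addgt0Pr => d d0.
have M0' : (0 : R) <= M := M0.
have e0 : (0 : R) <= e := ap_shift_ge0 ap.
have [|L0 hL0] := hA l (e := d / 4); first lra.
pose K := e + 2 * M * `|tau|.
have K0 : (0 : R) <= K by rewrite addr_ge0// !mulr_ge0.
pose B := Num.max L0 (2 * K / d + 1).
have K8 : (0 : R) <= 2 * K / d by rewrite divr_ge0 ?mulr_ge0 ?(ltW d0).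
have B1 : 2 * K / d + 1 <= B by rewrite le_max lexx orbT.
have B0 : (0 : R) < B by lra.
have hB : normc (fint f l 0 B - B%:C * A l) <= d / 4 * B by apply: hL0; rewrite le_max lexx.
have h1 := @fint_phase _ f M bf fM l e tau B (ltW B0) ap.
set n := normc (1 - _) in h1 *.
have n0 : (0 : R) <= n by exact: normc_ge0.
have n2 : n <= 2.
  rewrite /n (le_trans (normcB _ _))// normc_expi (_ : normc 1 = 1)// ?(_ : 2 = 1 + 1 :> R)//.
  by rewrite (normcR 1) normr1.
have h2 := normc_le (B%:C * A l) (fint f l 0 B).
rewrite normcBC normcZ gtr0_norm// in h2.
have KB : K <= d / 2 * B.
  have : 2 * K / d <= B by lra.
  by rewrite ler_pdivrMr//; lra.
rewrite -(ler_pM2r B0).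
have h3 : n * (B * normc (A l)) <= n * (normc (fint f l 0 B) + d / 4 * B).
  by rewrite ler_wpM2l//; lra.
have h4 : n * (d / 4 * B) <= 2 * (d / 4 * B) by rewrite ler_wpM2r// !mulr_ge0// ltW.
have h5 : e * (B + 1) + 2 * M * `|tau| = e * B + K by rewrite /K; ring.
rewrite h5 in h1; rewrite mulrDr in h3; move: h1 h3 h4 KB; clear.
rewrite mulrA [n * _]mulrC; lra.
Qed.

Variables (kern : R -> R) (K1 : R) (Q : R -> R).
Hypothesis bk : bb kern.
Hypothesis kernN : forall t, kern (- t) = kern t.
Hypothesis K1_gt0 : (0 : R) < K1.
Hypothesis kern_decay : forall t, `|kern t| * (1 + t ^+ 2) <= K1.
Hypothesis kern_diff : exists2 C : R, 0 <= C & forall t h, `|h| <= 1 ->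
  `|kern (t + h) - kern t| * (1 + t ^+ 2) <= C * `|h|.
Hypothesis kern_fourier : forall l T : R, 0 < T ->
  `|itg 0 T (fun t => kern t * cos (l * t)) - Q l| <= 4 / T.

Let kern_bound t : `|kern t| <= K1.
Proof.
have := kern_decay t; have := normr_ge0 (kern t); have := sqr_ge0 t.
move: (kern t) (t ^+ 2) => k t2 h1 h2; rewrite mulrDr mulr1.
by have := mulr_ge0 h2 h1; lra.
Qed.

Let kern_sqr t : `|kern t| * t ^+ 2 <= K1.
Proof.
have := kern_decay t; have := normr_ge0 (kern t); rewrite mulrDr mulr1; lra.
Qed.

Definition conv_on T x : R[i] := citg (- T) T (fun t => f (x + t) * (kern t)%:C).

Let bfk x : bbc (fun t => f (x + t) * (kern t)%:C).
Proof. by apply: bbcM; [exact: bbc_shiftl|exact: bbc_real]. Qed.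

Let fkM x t : normc (f (x + t) * (kern t)%:C) <= M * `|kern t|.
Proof. by rewrite normcM normcR ler_wpM2r. Qed.

Lemma conv_rate x a c : 0 < a -> a <= c -> normc (conv_on c x - conv_on a x) <= 2 * K1 * M / a.
Proof.
move=> a0 ac; rewrite /conv_on.
have hc0 : 0 <= a by exact: ltW.
have h1 : - c <= - a by rewrite lerN2.
have h2 : - a <= c by rewrite (le_trans _ ac)// (le_trans _ hc0)// oppr_le0.
have h3 : - a <= a by rewrite (le_trans _ hc0)// oppr_le0.
rewrite (citg_cat (bfk x) h1 h2) (citg_cat (bfk x) h3 ac).
have -> : forall z1 z2 z3 : R[i], z1 + (z2 + z3) - z2 = z1 + z3 by move=> *; ring.
rewrite (le_trans (normcD _ _))//.
have bn : bb (fun t => M * `|kern t|) by apply: bbM; [exact: bb_cst|exact: bb_norm].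
have t1 : normc (citg a c (fun t => f (x + t) * (kern t)%:C)) <= M * (K1 / a).
  apply: (le_trans (citg_norm _ _ (bfk x))).
  apply: (@le_trans _ _ (itg a c (fun t => M * `|kern t|))).
    by apply: le_itg => //; exact: bbc_norm.
  rewrite itgZ ?ler_wpM2l//; last exact: bb_norm.
  by apply: itg_tail => // t _; exact: kern_sqr.
have t2 : normc (citg (- c) (- a) (fun t => f (x + t) * (kern t)%:C)) <= M * (K1 / a).
  apply: (le_trans (citg_norm _ _ (bfk x))).
  apply: (@le_trans _ _ (itg (- c) (- a) (fun t => M * `|kern t|))).
    by apply: le_itg => //; exact: bbc_norm.
  rewrite -itg_refl//.
  have -> : (fun t => M * `|kern (- t)|) = (fun t => M * `|kern t|).
    by apply/funext => t; rewrite kernN.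
  rewrite itgZ ?ler_wpM2l//; last exact: bb_norm.
  by apply: itg_tail => // t _; exact: kern_sqr.
lra.
Qed.

Lemma conv_exists : exists V : R -> R[i], forall x T, 0 < T -> normc (conv_on T x - V x) <= 4 * K1 * M / T.
Proof.
have h x : exists y, forall T, 0 < T -> normc (conv_on T x - y) <= 4 * K1 * M / T.
  have [y hy] := @cvg_ratec _ (fun T => conv_on T x) (2 * K1 * M) (@conv_rate x).
  by exists y => T /hy; rewrite (_ : 2 * (2 * K1 * M) = 4 * K1 * M)//; ring.
by exists (fun x => projT1 (cid (h x))) => x T T0; exact: (projT2 (cid (h x))).
Qed.

Variable V : R -> R[i].
Hypothesis hV : forall x T, 0 < T -> normc (conv_on T x - V x) <= 4 * K1 * M / T.

Lemma conv_lim (z : R -> R[i]) (y : R[i]) (C B : R) : 0 <= C ->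
  (forall T, 1 <= T -> normc (z T - y) <= C / T) ->
  (forall T, 1 <= T -> normc (z T) <= B) -> normc y <= B.
Proof.
move=> C0 h1 h2; apply/ler_addgt0Pr => e e0.
pose T := C / e + 1.
have T1 : 1 <= T by rewrite lerDr divr_ge0// ltW.
have T0 : 0 < T by exact: lt_le_trans T1.
have := normc_le y (z T); rewrite normcBC => h; apply: (le_trans h).
rewrite lerD ?h2// (le_trans (h1 _ T1))// ler_pdivrMr// /T mulrDr mulr1 mulrC divfK ?gt_eqF//.
by rewrite lerDl ltW.
Qed.

Lemma conv_bound x : normc (V x) <= 6 * K1 * M.
Proof.
have C0 := ltW K1_gt0.
apply: (@conv_lim (fun T => conv_on T x) _ (4 * K1 * M)); first by rewrite !mulr_ge0.
  by move=> T T1; apply: hV; exact: lt_le_trans T1.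
move=> T T1; have T0 : 0 <= T by exact: le_trans T1.
apply: (le_trans (citg_norm _ _ (bfk x))).
apply: (@le_trans _ _ (itg (- T) T (fun t => M * `|kern t|))).
  apply: le_itg => //; [exact: bbc_norm|].
  by apply: bbM; [exact: bb_cst|exact: bb_norm].
apply: itg_cell2; [exact: bb_cst|exact: bb_norm|by []|by []|exact: C0|exact: kern_decay| |exact: T0].
by move=> y; rewrite itg_cst ?lerDl// addrAC subrr add0r mulr1.
Qed.

(** Convolution with an integrable kernel turns almost periodicity in the mean into
    uniform almost periodicity. *)
Lemma conv_ap e tau x : ap_shift f e tau -> normc (V (x + tau) - V x) <= 6 * K1 * e.
Proof.
move=> ap; have C0 := ltW K1_gt0.
apply: (@conv_lim (fun T => conv_on T (x + tau) - conv_on T x) _ (8 * K1 * M)).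
- by rewrite !mulr_ge0.
- move=> T T1; have T0 : 0 < T by exact: lt_le_trans T1.
  have -> : conv_on T (x + tau) - conv_on T x - (V (x + tau) - V x) =
    (conv_on T (x + tau) - V (x + tau)) - (conv_on T x - V x) by ring.
  rewrite (le_trans (normcB _ _))//.
  by have := hV (x + tau) T0; have := hV x T0; lra.
move=> T T1; have T0 : 0 <= T by exact: le_trans T1.
rewrite /conv_on -citgB//.
apply: (le_trans (citg_norm _ _ (bbcB (bfk _) (bfk _)))).
have bd := bb_diff bf tau.
have bdx : bb (fun t => normc (f (x + t + tau) - f (x + t))).
  exact: (bb_shiftl x bd).
apply: (@le_trans _ _ (itg (- T) T (fun t => normc (f (x + t + tau) - f (x + t)) * `|kern t|))).
  apply: le_itg => //; [exact: bbc_norm (bbcB (bfk _) (bfk _))|by apply: bbM => //; exact: bb_norm|].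
  by move=> t _; rewrite -mulrBl normcM normcR addrAC.
apply: itg_cell2; [exact: bdx|exact: bb_norm|by move=> t; exact: normc_ge0|by []|exact: C0|exact: kern_decay| |exact: T0].
move=> y; have := ap (y + x).
have -> : y + x + 1 = y + 1 + x by ring.
rewrite -(itg_shift y (y + 1) x bd); congr (itg _ _ _ <= _).
by apply/funext => t; rewrite [t + x]addrC.
Qed.

Lemma lip_global (u : R -> R[i]) (C B : R) : 0 <= C ->
  (forall x h, `|h| <= 1 -> normc (u (x + h) - u x) <= C * `|h|) ->
  (forall x, normc (u x) <= B) -> forall x y, normc (u x - u y) <= (C + 2 * B + 1) * `|x - y|.
Proof.
move=> C0 near1 uB x y.
have B0 : 0 <= B by rewrite (le_trans _ (uB 0))// normc_ge0.
have [h|h] := leP `|x - y| 1.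
  have := near1 y (x - y) h; have -> : y + (x - y) = x by ring.
  move=> h2; apply: (le_trans h2).
  by rewrite ler_wpM2r//; lra.
have h0 : (1 : R) <= `|x - y| by exact: ltW.
rewrite (le_trans (normcB _ _))//.
apply: (@le_trans _ _ (C + 2 * B + 1)).
  by have := uB x; have := uB y; lra.
by rewrite ler_peMr//; lra.
Qed.

Lemma conv_on_lip : exists2 C : R, 0 <= C & forall T, 1 <= T -> forall x h, `|h| <= 1 ->
  normc (conv_on T (x + h) - conv_on T x) <= C * `|h|.
Proof.
have C0 := ltW K1_gt0.
have [CL CL0 hCL] := kern_diff.
exists (2 * M * K1 + 6 * M * CL); first by rewrite addr_ge0// !mulr_ge0.
move=> T T1 x h h1; have T0 : 0 <= T by exact: le_trans T1.
pose u t := f (x + t) * (kern (t + - h))%:C.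
have bu : bbc u.
  apply: bbcM; first exact: bbc_shiftl.
  by apply: bbc_real; exact: bb_shift.
have uM t : normc (u t) <= M * K1.
  by rewrite normcM normcR ler_pM ?normc_ge0//; exact: kern_bound.
have e1 : conv_on T (x + h) = citg (- T + h) (T + h) u.
  rewrite /conv_on -(citg_shift (- T) T h bu); apply: eq_citg => t _; rewrite /u addrK.
  by congr (f _ * _); ring.
have TT : - T <= T by rewrite -subr_ge0 opprK addr_ge0.
rewrite mulrDl; apply: (le_trans (normc_tri (citg (- T) T u) _ _)); apply: lerD.
  rewrite e1; have TTh : - T + h <= T + h by rewrite lerD2r.
  apply: (le_trans (citg_move bu uM TTh TT)).
  by rewrite !(addrAC _ h) !subrr !add0r le_eqVlt; apply/orP; left; apply/eqP; ring.
rewrite /conv_on -(citgB _ _ bu (bfk x)); apply: (le_trans (citg_norm _ _ (bbcB bu (bfk x)))).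
have bkd : bb (fun t => kern (t + - h) - kern t) by apply: bbB => //; exact: bb_shift.
apply: (@le_trans _ _ (itg (- T) T (fun t => M * `|kern (t + - h) - kern t|))).
  apply: le_itg; [exact: bbc_norm (bbcB bu (bfk x))|by apply: bbM; [exact: bb_cst|exact: bb_norm]|].
  by move=> t _; rewrite -mulrBr -rmorphB normcM normcR ler_wpM2r.
rewrite (_ : 6 * M * CL * `|h| = 6 * (CL * `|h|) * M); last by ring.
apply: itg_cell2; [exact: bb_cst|exact: bb_norm|by []|by []|exact: mulr_ge0| | |exact: T0].
- by move=> t; rewrite -[`|h|]normrN; apply: hCL; rewrite normrN.
- by move=> y; rewrite itg_cst ?lerDl// addrAC subrr add0r mulr1.
Qed.

Lemma conv_on_bound T x : 0 <= T -> normc (conv_on T x) <= 6 * K1 * M.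
Proof.
move=> T0; have C0 := ltW K1_gt0.
apply: (le_trans (citg_norm _ _ (bfk x))).
apply: (@le_trans _ _ (itg (- T) T (fun t => M * `|kern t|))).
  apply: le_itg => //; [exact: bbc_norm|].
  by apply: bbM; [exact: bb_cst|exact: bb_norm].
apply: itg_cell2; [exact: bb_cst|exact: bb_norm|by []|by []|exact: C0|exact: kern_decay| |exact: T0].
by move=> y; rewrite itg_cst ?lerDl// addrAC subrr add0r mulr1.
Qed.

Lemma bbc_conv_on T : 1 <= T -> bbc (conv_on T).
Proof.
move=> T1; have T0 : 0 <= T by exact: le_trans T1.
have [C C0 hC] := conv_on_lip.
apply: (@bbc_lip _ _ (C + 2 * (6 * K1 * M) + 1) (6 * K1 * M)).
  by apply: lip_global => //; [exact: hC|move=> x; exact: conv_on_bound].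
by move=> x; exact: conv_on_bound.
Qed.

Lemma conv_lip : exists2 C : R, 0 < C & forall x y, normc (V x - V y) <= C * `|x - y|.
Proof.
have C0 := ltW K1_gt0.
have [C CC0 hC] := conv_on_lip.
exists (C + 2 * (6 * K1 * M) + 1).
  by rewrite ltr_wpDl// addr_ge0// !mulr_ge0.
apply: lip_global => //; last exact: conv_bound.
move=> x h h1.
apply: (@conv_lim (fun T => conv_on T (x + h) - conv_on T x) _ (8 * K1 * M)).
- by rewrite !mulr_ge0.
- move=> T T1; have T0 : 0 < T by exact: lt_le_trans T1.
  have -> : conv_on T (x + h) - conv_on T x - (V (x + h) - V x) =
    (conv_on T (x + h) - V (x + h)) - (conv_on T x - V x) by ring.
  rewrite (le_trans (normcB _ _))//.
  by have := hV (x + h) T0; have := hV x T0; lra.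
by move=> T T1; exact: hC.
Qed.

Let bbcV : bbc V.
Proof.
have [C _ hC] := conv_lip.
exact: (bbc_lip hC conv_bound).
Qed.

Lemma kern_expi l T : 0 < T ->
  normc (citg (- T) T (fun t => (kern t)%:C * expi (l * t)) - (2 * Q l)%:C) <= 8 / T.
Proof.
move=> T0; have T0' := ltW T0.
have bc : bb (fun t => kern t * cos (l * t)).
  by apply: bbM => //; have := bb_cos l 0; congr bb; apply/funext => t; rewrite addr0.
have bs : bb (fun t => kern t * sin (l * t)).
  by apply: bbM => //; have := bb_sin l 0; congr bb; apply/funext => t; rewrite addr0.
have h1 : - T <= 0 by rewrite oppr_le0.
have e1 : itg (- T) T (fun t => kern t * cos (l * t)) = 2 * itg 0 T (fun t => kern t * cos (l * t)).
  rewrite (itg_cat bc h1 T0') (_ : itg (- T) 0 _ = itg 0 T (fun t => kern t * cos (l * t))); first by ring.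
  rewrite -[X in itg _ X _]oppr0 -itg_refl//.
  by congr itg; apply/funext => t; rewrite kernN mulrN cosN.
have e2 : itg (- T) T (fun t => kern t * sin (l * t)) = 0.
  rewrite (itg_cat bs h1 T0') (_ : itg (- T) 0 _ = - itg 0 T (fun t => kern t * sin (l * t))); first by ring.
  rewrite -[X in itg _ X _]oppr0 -itg_refl// -itgN//.
  by congr itg; apply/funext => t; rewrite kernN mulrN sinN mulrN.
have -> : citg (- T) T (fun t => (kern t)%:C * expi (l * t)) =
    (2 * itg 0 T (fun t => kern t * cos (l * t)))%:C.
  apply: complex_eq => /=.
    by rewrite -e1; congr itg; apply/funext => t; rewrite /expi /=; ring.
  by rewrite -[RHS]e2; congr itg; apply/funext => t; rewrite /expi /=; ring.
rewrite -rmorphB normcR -mulrBr normrM [`|2|]ger0_norm//.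
have := kern_fourier l T0; set w := `|_|; lra.
Qed.

Lemma conv_on_coef l T L : 1 <= T -> 0 <= L ->
  normc (fint (conv_on T) l 0 L - citg (- T) T (fun t => (kern t)%:C * expi (l * t)) * fint f l 0 L)
    <= 4 * K1 * M * T ^+ 2.
Proof.
move=> T1 L0; have T0 : 0 <= T by exact: le_trans T1.
have TT : - T <= T by rewrite -subr_ge0 opprK addr_ge0.
have K10 := ltW K1_gt0.
pose K x t := f (x + t) * (kern t)%:C * expi (- (l * x)).
have e1 : fint (conv_on T) l 0 L = citg 0 L (fun x => citg (- T) T (fun t => K x t)).
  apply: eq_citg => x _; rewrite /conv_on mulrC -citgZ//.
  by congr citg; apply/funext => t; rewrite mulrC.
have e2 : fint (conv_on T) l 0 L = citg (- T) T (fun t => citg 0 L (fun x => K x t)).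
  rewrite e1; have [[m1 _] [m2 _]] := bf; have [mk _] := bk.
  have mD : measurable_fun [set: R * R] (fun z : R * R => z.1 + z.2).
    by apply: measurable_funD; [exact: measurable_fst|exact: measurable_snd].
  have mf1 : measurable_fun [set: R * R] (fun z : R * R => complex.Re (f (z.1 + z.2))).
    exact: (measurableT_comp m1 mD).
  have mf2 : measurable_fun [set: R * R] (fun z : R * R => complex.Im (f (z.1 + z.2))).
    exact: (measurableT_comp m2 mD).
  have mk2 : measurable_fun [set: R * R] (fun z : R * R => kern z.2).
    exact: (measurableT_comp mk measurable_snd).
  have [[mc _] [ms _]] := @bbc_expiN R l.
  have mc1 : measurable_fun [set: R * R] (fun z : R * R => complex.Re (expi (- (l * z.1)))).
    exact: (measurableT_comp mc measurable_fst).
  have ms1 : measurable_fun [set: R * R] (fun z : R * R => complex.Im (expi (- (l * z.1)))).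
    exact: (measurableT_comp ms measurable_fst).
  apply: (@citg_Fubini _ _ _ _ _ _ (M * K1)).
  - under eq_fun do rewrite /K cReM cReM cImM /= !mulr0 subr0 add0r.
    by apply: measurable_funB; apply: measurable_funM => //; apply: measurable_funM.
  - under eq_fun do rewrite /K cImM cReM cImM /= !mulr0 subr0 add0r.
    by apply: measurable_funD; apply: measurable_funM => //; apply: measurable_funM.
  - move=> x t; rewrite /K !normcM normc_expi mulr1 normcR.
    by rewrite ler_pM ?normc_ge0//; exact: kern_bound.
have e3 : fint (conv_on T) l 0 L =
    citg (- T) T (fun t => (kern t)%:C * expi (l * t) * fint f l t (L + t)).
  rewrite e2; apply: eq_citg => t _.
  have -> : fint f l t (L + t) = citg 0 L (fun x => f (x + t) * expi (- (l * (x + t)))).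
    rewrite /fint -{1}[t]add0r; exact/esym/(citg_shift 0 L t (bbc_fexp bf l)).
  rewrite -citgZ; last exact: (bbc_shift t (bbc_fexp bf l)).
  congr citg; apply/funext => x; rewrite /K.
  have -> : expi (- (l * x)) = expi (l * t) * expi (- (l * (x + t))).
    by rewrite -expiD; congr expi; ring.
  by ring.
have bz : bbc (fun t => fint f l t (L + t)).
  apply: (@bbc_lip _ _ (2 * M) (M * L)).
    move=> t u; apply: (le_trans (@fint_move _ _ _ bf fM _ _ _ _ _ _ _)); rewrite ?lerDr//.
    rewrite (_ : L + t - (L + u) = t - u); last by ring.
    by rewrite le_eqVlt; apply/orP; left; apply/eqP; ring.
  move=> t; apply: (le_trans (@fint_bound _ _ _ bf fM _ _ _ _)); rewrite ?lerDr//.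
  by rewrite addrK.
have be : bbc (fun t => (kern t)%:C * expi (l * t)).
  apply: bbcM; first exact: bbc_real.
  by have := bbc_expi l 0; congr (bbc _); apply/funext => t; rewrite addr0.
have b1 : bbc (fun t => (kern t)%:C * expi (l * t) * fint f l t (L + t)) by exact: bbcM.
have b2 : bbc (fun t => fint f l 0 L * ((kern t)%:C * expi (l * t))).
  by apply: bbcM => //; exact: bbc_cst.
rewrite e3 [X in _ - X]mulrC -(citgZ _ _ _ be) -(citgB _ _ b1 b2).
have -> : 4 * K1 * M * T ^+ 2 = (K1 * (2 * M * T)) * (T - - T) by ring.
apply: (citg_bound (bbcB b1 b2) TT) => t /andP[t1 t2].
rewrite [X in _ - X]mulrC -mulrBr !normcM normc_expi mulr1 normcR.
apply: ler_pM; [by []|exact: normc_ge0|exact: kern_bound|].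
have L1 : t <= L + t by rewrite lerDr.
apply: (le_trans (fint_move bf fM l L1 L0)).
rewrite subr0 addrAC subrr add0r.
have : `|t| <= T by rewrite ler_norml t1 t2.
move=> hT; rewrite (_ : 2 * M * T = M * (T + T)); last by ring.
by rewrite ler_wpM2l// lerD.
Qed.

(** Convolution multiplies the coefficient at l by the transform of the kernel there. *)
Lemma conv_coef l (e : R) : 0 < e -> exists L0, forall L, L0 <= L ->
  normc (fint V l 0 L - L%:C * ((2 * Q l)%:C * A l)) <= e * L.
Proof.
have aux (x y z w a1 b1 c1 d1 u : R) : x <= a1 -> y <= b1 -> z <= d1 -> w <= c1 -> b1 <= d1 ->
  a1 + c1 <= d1 -> 0 <= d1 -> 4 * d1 = u -> x + y + (z + w) <= u by lra.
move=> e0; have K10 := ltW K1_gt0; have M0' : (0 : R) <= M := M0.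
have A0 := normc_ge0 (A l).
pose C := 16 * K1 * M + 32 * normc (A l).
have C0 : (0 : R) <= C by rewrite addr_ge0// ?mulr_ge0.
pose T := C / e + 1.
have T1 : (1 : R) <= T by rewrite lerDr divr_ge0// ltW.
have T0 : (0 : R) < T by exact: lt_le_trans T1.
have CT : C / T <= e.
  by rewrite ler_pdivrMr// /T mulrDr mulr1 mulrC divfK ?gt_eqF// lerDl ltW.
pose d := e / (8 * K1 * T).
have d0 : (0 : R) < d by rewrite divr_gt0// !mulr_gt0.
have [L1 hL1] := hA l d0.
exists (Num.max (Num.max 0 L1) (16 * K1 * M * T ^+ 2 / e)) => L.
rewrite !ge_max => /andP[/andP[L0 hL] hL2].
have TT : - T <= T by rewrite -subr_ge0 opprK addr_ge0 ?(ltW T0).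
have bcT := bbc_conv_on T1.
set kT := citg (- T) T (fun t => (kern t)%:C * expi (l * t)).
have h1 : normc (fint V l 0 L - fint (conv_on T) l 0 L) <= 4 * K1 * M / T * L.
  have b1 := bbc_fexp bbcV l; have b2 := bbc_fexp bcT l.
  rewrite /fint -(citgB _ _ b1 b2) (_ : _ * L = 4 * K1 * M / T * (L - 0)); last by rewrite subr0.
  apply: (citg_bound (bbcB b1 b2) L0) => t _.
  by rewrite -mulrBl normcM normc_expi mulr1 normcBC; exact: hV.
have h2 := conv_on_coef l T1 L0; rewrite -/kT in h2.
have be : bbc (fun t => (kern t)%:C * expi (l * t)).
  apply: bbcM; first exact: bbc_real.
  by have := bbc_expi l 0; congr (bbc _); apply/funext => t; rewrite addr0.
have h3 : normc kT <= 2 * K1 * T.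
  have -> : 2 * K1 * T = K1 * (T - - T) by ring.
  apply: (citg_bound be TT) => t _; rewrite normcM normcR normc_expi mulr1; exact: kern_bound.
have h4 := kern_expi l T0; rewrite -/kT in h4.
have h5 := hL1 L hL.
set Z := fint f l 0 L in h2 h5.
have E : fint V l 0 L - L%:C * ((2 * Q l)%:C * A l) =
  (fint V l 0 L - fint (conv_on T) l 0 L) + (fint (conv_on T) l 0 L - kT * Z)
  + (kT * (Z - L%:C * A l) + L%:C * ((kT - (2 * Q l)%:C) * A l)) by ring.
rewrite E.
apply: (le_trans (normcD _ _)); apply: (le_trans (lerD (normcD _ _) (normcD _ _))).
rewrite !normcM normcR (ger0_norm L0).
have k1 : normc kT * normc (Z - L%:C * A l) <= 2 * K1 * T * (d * L).
  by rewrite ler_pM ?normc_ge0.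
have k2 : L * (normc (kT - (2 * Q l)%:C) * normc (A l)) <= L * (8 / T * normc (A l)).
  by rewrite ler_wpM2l// ler_wpM2r.
have k3 : 2 * K1 * T * (d * L) = e / 4 * L.
  by rewrite /d; field; rewrite !gt_eqF.
have k4 : 4 * K1 * M * T ^+ 2 <= e / 4 * L.
  by move: hL2; rewrite ler_pdivrMr//; lra.
have k5 : 4 * K1 * M / T * L + L * (8 / T * normc (A l)) <= e / 4 * L.
  have -> : 4 * K1 * M / T * L + L * (8 / T * normc (A l)) = C / T / 4 * L.
    by rewrite /C; field; rewrite gt_eqF.
  by rewrite ler_wpM2r// ler_wpM2r.
rewrite k3 in k1.
have k6 : 0 <= e / 4 * L by rewrite mulr_ge0// divr_ge0// ltW.
by apply: (aux _ _ _ _ _ _ _ _ _ h1 h2 k1 k2 k4 k5 k6); field.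
Qed.

End Representation.

(** * Trigonometric sums as convolutions *)

Section TrigSum.
Context {R : realType}.
Notation citg := (@cintegral_on R).
Notation bbc := (@bounded_borelc R).
Notation normc := (@ComplexField.Normc.normc R).
Variable A : R -> R[i].

Definition trig_sum (s : seq R) x : R[i] := \sum_(l <- s) A l * expi (l * x).

Lemma bbc_term l : bbc (fun x => A l * expi (l * x)).
Proof.
apply: bbcM; first exact: bbc_cst.
by have := bbc_expi l 0; congr (bbc _); apply/funext => t; rewrite addr0.
Qed.

Lemma bbc_trig s : bbc (trig_sum s).
Proof.
elim: s => [|l s ih].
  by rewrite (_ : trig_sum [::] = fun=> 0); [exact: bbc_cst|apply/funext => x; rewrite /trig_sum big_nil].
rewrite (_ : trig_sum (l :: s) = fun x => A l * expi (l * x) + trig_sum s x).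
  by apply: bbcD => //; exact: bbc_term.
by apply/funext => x; rewrite /trig_sum big_cons.
Qed.

Lemma trig_bound s x : normc (trig_sum s x) <= \sum_(l <- s) normc (A l).
Proof.
by apply: (le_trans (normc_sum _ _ _)); apply: ler_sum => l _; rewrite normcM normc_expi mulr1.
Qed.

Lemma trig_lip s x y : normc (trig_sum s x - trig_sum s y) <= (\sum_(l <- s) normc (A l) * (2 * `|l|)) * `|x - y|.
Proof.
rewrite /trig_sum -sumrB mulr_suml; apply: (le_trans (normc_sum _ _ _)); apply: ler_sum => l _.
rewrite -mulrBr normcM -mulrA ler_wpM2l ?normc_ge0//.
by apply: (le_trans (expi_lip _ _)); rewrite -mulrBr normrM mulrA.
Qed.

Lemma trig_ap s e tau x : (forall l, normc (1 - expi (- (l * tau))) * normc (A l) <= e) ->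
  normc (trig_sum s (x + tau) - trig_sum s x) <= (size s)%:R * e.
Proof.
move=> h; rewrite /trig_sum -sumrB; apply: (le_trans (normc_sum _ _ _)).
apply: (@le_trans _ _ (\sum_(l <- s) e)); last first.
  by rewrite big_const_seq count_predT iter_addr_0 mulr_natl.
apply: ler_sum => l _.
have -> : A l * expi (l * (x + tau)) - A l * expi (l * x) =
  (1 - expi (- (l * tau))) * A l * expi (l * (x + tau)).
  have -> : expi (l * x) = expi (- (l * tau)) * expi (l * (x + tau)) by rewrite -expiD; congr expi; ring.
  by ring.
by rewrite !normcM normc_expi mulr1; exact: h.
Qed.

Lemma trig_fint s l : uniq s -> exists2 K : R, 0 <= K & forall L, 0 <= L ->
  normc (fint (trig_sum s) l 0 L - L%:C * (if l \in s then A l else 0)) <= K.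
Proof.
elim: s => [_|m s ih] /=.
  exists 0 => // L L0; rewrite mulr0 subr0 /fint.
  rewrite (_ : (fun t => _) = fun=> 0); last by apply/funext => t; rewrite /trig_sum big_nil mul0r.
  by rewrite citg_cst// mulr0 (normcR 0) normr0.
move=> /andP[ms us]; have [K K0 hK] := ih us.
have E L : fint (trig_sum (m :: s)) l 0 L =
    A m * citg 0 L (fun t => expi ((m - l) * t)) + fint (trig_sum s) l 0 L.
  have be : bbc (fun t => expi ((m - l) * t)).
    by have := bbc_expi (m - l) 0; congr (bbc _); apply/funext => t; rewrite addr0.
  rewrite -(citgZ _ _ _ be) /fint -citgD; last 2 first.
  - by apply: bbcM => //; exact: bbc_cst.
  - by apply: bbc_fexp; exact: bbc_trig.
  congr citg; apply/funext => t; rewrite /trig_sum big_cons mulrDl -mulrA -expiD.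
  by congr (_ * expi _ + _); ring.
have [lm|lm] := eqVneq l m.
  subst m; exists K => // L L0; rewrite E in_cons eqxx/=.
  rewrite (_ : citg 0 L _ = L%:C); last first.
    rewrite (_ : (fun t => expi ((l - l) * t)) = fun=> 1); last by apply/funext => t; rewrite subrr mul0r expi0.
    by rewrite citg_cst// subr0 mulr1.
  have := hK L L0; rewrite (negbTE ms) mulr0 subr0.
  by rewrite [A l * _]mulrC addrAC subrr add0r.
exists (normc (A m) * (4 / `|m - l|) + K).
  by rewrite addr_ge0// mulr_ge0 ?normc_ge0// divr_ge0.
move=> L L0; rewrite E in_cons (negbTE lm)/= -addrA (le_trans (normcD _ _))// lerD//; last exact: hK.
by rewrite normcM ler_wpM2l ?normc_ge0// citg_expi// subr_eq0 eq_sym.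
Qed.

End TrigSum.

Section RepresentationTheorem.
Context {R : realType}.
Notation itg := (@integral_on R).
Notation citg := (@cintegral_on R).
Notation bbc := (@bounded_borelc R).
Notation bb := (@bounded_borel R).
Notation normc := (@ComplexField.Normc.normc R).

Variables (f : R -> R[i]) (M : R).
Hypothesis bf : bbc f.
Hypothesis fM : forall t, normc (f t) <= M.
Hypothesis fap : mean_ap f.
Variable A : R -> R[i].
Hypothesis hA : forall l (e : R), 0 < e -> exists L0, forall L, L0 <= L ->
  normc (fint f l 0 L - L%:C * A l) <= e * L.

Variables (kern : R -> R) (K1 : R) (Q : R -> R).
Hypothesis bk : bb kern.
Hypothesis kernN : forall t, kern (- t) = kern t.
Hypothesis K1_gt0 : (0 : R) < K1.
Hypothesis kern_decay : forall t, `|kern t| * (1 + t ^+ 2) <= K1.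
Hypothesis kern_diff : exists2 C : R, 0 <= C & forall t h, `|h| <= 1 ->
  `|kern (t + h) - kern t| * (1 + t ^+ 2) <= C * `|h|.
Hypothesis kern_fourier : forall l T : R, 0 < T ->
  `|itg 0 T (fun t => kern t * cos (l * t)) - Q l| <= 4 / T.

Variables (s : seq R) (cc : R).
Hypothesis s_uniq : uniq s.
Hypothesis s_in : forall l, l \in s -> Q l = cc.
Hypothesis s_out : forall l, l \notin s -> A l = 0 \/ Q l = 0.

(** The convolution and the trigonometric sum have the same coefficients, and their
    difference is Lipschitz, bounded and almost periodic: [ap_uniqueness]. *)
Theorem convolution_trig x T : 0 < T ->
  normc (conv_on f kern T x - (2 * cc)%:C * trig_sum A s x) <= 4 * K1 * M / T.
Proof.
move=> T0.
have [V hV] := conv_exists bf fM bk kernN kern_decay.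
suff <- : V x = (2 * cc)%:C * trig_sum A s x by exact: hV.
have M0 : (0 : R) <= M by rewrite (le_trans _ (fM 0))// normc_ge0.
have [CV CV0 VL] := conv_lip bf fM bk K1_gt0 kern_decay kern_diff hV.
have VB := conv_bound bf fM bk K1_gt0 kern_decay hV.
pose k : R[i] := (2 * cc)%:C.
pose D y := V y - k * trig_sum A s y.
pose SA := \sum_(l <- s) normc (A l).
pose SL := \sum_(l <- s) normc (A l) * (2 * `|l|).
have SL0 : 0 <= SL by apply: sumr_ge0 => l _; rewrite !mulr_ge0// normc_ge0.
have SA0 : 0 <= SA by apply: sumr_ge0 => l _; rewrite normc_ge0.
have k0 := normc_ge0 k.
have DM y : normc (D y) <= 6 * K1 * M + normc k * SA.
  rewrite (le_trans (normcB _ _))// lerD ?VB// normcM ler_wpM2l//; exact: trig_bound.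
have DL y z : normc (D y - D z) <= (CV + normc k * SL) * `|y - z|.
  have -> : D y - D z = (V y - V z) - k * (trig_sum A s y - trig_sum A s z) by rewrite /D; ring.
  rewrite (le_trans (normcB _ _))// mulrDl lerD ?VL// normcM -mulrA ler_wpM2l//; exact: trig_lip.
have Lp0 : 0 < CV + normc k * SL by rewrite ltr_wpDr// mulr_ge0.
have bV : bbc V by exact: (bbc_lip VL VB).
have bt := bbc_trig A s.
have bkt : bbc (fun y => k * trig_sum A s y) by apply: bbcM => //; exact: bbc_cst.
have bD : bbc D by exact: bbcB.
have Dap (e : R) : 0 < e -> relatively_dense [set tau | forall t, normc (D (t + tau) - D t) <= e].
  move=> e0; pose w := 6 * K1 + normc k * (size s)%:R + 1.
  have w0 : 0 < w by rewrite ltr_wpDl// addr_ge0// mulr_ge0// ltW.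
  have d0 : 0 < e / w by rewrite divr_gt0.
  have [l [l0 hl]] := fap d0; exists l; split => // a.
  have [tau [ht ap]] := hl a; exists tau; split => // t /=.
  have -> : D (t + tau) - D t = (V (t + tau) - V t) - k * (trig_sum A s (t + tau) - trig_sum A s t) by rewrite /D; ring.
  apply: (le_trans (normcB _ _)).
  have h1 := conv_ap bf fM bk K1_gt0 kern_decay hV t ap.
  have h2 : normc (trig_sum A s (t + tau) - trig_sum A s t) <= (size s)%:R * (e / w).
    by apply: trig_ap => m; exact: (coef_phase bf fM hA).
  rewrite normcM; apply: (le_trans (lerD h1 (ler_wpM2l k0 h2))).
  have -> : 6 * K1 * (e / w) + normc k * ((size s)%:R * (e / w)) = (w - 1) * (e / w) by rewrite /w; ring.
  rewrite mulrA ler_pdivrMr// mulrC ler_wpM2l ?(ltW e0)//; lra.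
have Dcoef l (e : R) : 0 < e -> exists L0, forall L, L0 <= L -> normc (fint D l 0 L) <= e * L.
  move=> e0.
  have [L1 hL1] := conv_coef bf fM hA bk kernN K1_gt0 kern_decay kern_diff kern_fourier hV l (divr_gt0 e0 (ltr0Sn R 1)).
  have [K K0 hK] := trig_fint A l s_uniq.
  have kK : 0 <= 2 * (normc k * K) / e by rewrite divr_ge0 ?mulr_ge0// ltW.
  exists (Num.max (Num.max 0 L1) (2 * (normc k * K) / e)) => L.
  rewrite !ge_max => /andP[/andP[L0 h1] h2].
  have -> : fint D l 0 L = fint V l 0 L - k * fint (trig_sum A s) l 0 L.
    rewrite /fint -citgZ; last exact: bbc_fexp.
    rewrite -citgB; [|exact: bbc_fexp|by apply: bbcM; [exact: bbc_cst|exact: bbc_fexp]].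
    by congr citg; apply/funext => t; rewrite /D; ring.
  have E : (2 * Q l)%:C * A l = k * (if l \in s then A l else 0).
    case: ifPn => ls; first by rewrite s_in.
    by case: (s_out ls) => ->; rewrite ?mulr0// mul0r.
  have g1 := hL1 L h1; have g2 := hK L L0; rewrite E in g1.
  set B := (if _ then _ else _) in g1 g2.
  have -> : fint V l 0 L - k * fint (trig_sum A s) l 0 L =
     (fint V l 0 L - L%:C * (k * B)) - k * (fint (trig_sum A s) l 0 L - L%:C * B) by ring.
  apply: (le_trans (normcB _ _)); rewrite normcM.
  apply: (le_trans (lerD g1 (ler_wpM2l k0 g2))).
  move: h2; rewrite ler_pdivrMr//; move: (normc k * K) => z; lra.
have := ap_uniqueness bD DM Lp0 DL Dap Dcoef x.
by move/eqP; rewrite subr_eq0 => /eqP.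
Qed.

End RepresentationTheorem.

(** * Waves and Bessel's inequality *)

Section Bessel.
Context {R : realType}.
Notation itg := (@integral_on R).
Notation bb := (@bounded_borel R).
Implicit Types (t : R).

Lemma eq_itg_ne (c a b : R) (u v : R -> R) : bb u -> bb v -> (forall t, t != c -> u t = v t) ->
  itg a b u = itg a b v.
Proof.
move=> bu bv h; apply: eq_itg_ae => //.
exists [set c]; split => //; first by rewrite lebesgue_measure_set1.
by move=> t /= ut; apply: contrapT => /eqP t0; apply: ut; exact: h.
Qed.

Lemma itg_supp (u : R -> R) (x p q y : R) : bb u -> x <= p -> p <= q -> q <= y ->
  (forall t, t <= p -> u t = 0) -> (forall t, q <= t -> u t = 0) -> itg x y u = itg p q u.
Proof.
move=> bu xp pq qy h1 h2.
rewrite (itg_cat bu xp (le_trans pq qy)) (itg_cat bu pq qy).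
have -> : itg x p u = 0.
  by rewrite -[RHS](itg0 x p); apply: eq_itg => t /andP[_ /h1].
have -> : itg q y u = 0.
  by rewrite -[RHS](itg0 q y); apply: eq_itg => t /andP[/h2].
by rewrite add0r addr0.
Qed.

Variables (beta phi : R).
Hypothesis beta0 : 0 < beta.

Definition wave (k : nat) t : R := cos (k%:R * beta * t - phi).

Lemma bb_wave k : bb (wave k).
Proof. exact: bb_cos. Qed.

Lemma wave_bound k t : `|wave k t| <= 1.
Proof. by rewrite ler_norml cos_geN1 cos_le1. Qed.

Lemma sin_period (n : nat) x : sin (x + pi *+ 2 *+ n) = sin x :> R.
Proof.
elim: n => [|n ih]; first by rewrite addr0.
by rewrite mulrS addrCA addrC sinD2pi.
Qed.

Lemma itg_cos_period (n : nat) (c : R) : (0 < n)%N ->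
  itg 0 (2 * pi / beta) (fun t => cos (n%:R * beta * t + c)) = 0.
Proof.
move=> n0; pose a := n%:R * beta.
have a0 : a != 0 by rewrite mulf_neq0 ?pnatr_eq0 -?lt0n ?gt_eqF.
have P0 : 0 <= 2 * pi / beta :> R by rewrite divr_ge0 ?(ltW beta0)// mulr_ge0// pi_ge0.
have dm (x : R) : is_derive x 1 (fun t : R => a * t + c) a.
  have -> : (fun t : R => a * t + c) = a *: (id : R -> R) + cst c by apply/funext.
  by apply: is_derive_eq; rewrite /GRing.scale/= mulr1 addr0.
have cm : continuous (fun t : R => a * t + c).
  by move=> x; apply: cvgD; [apply: cvgM; [exact: cvg_cst|exact: cvg_id]|exact: cvg_cst].
have -> : itg 0 (2 * pi / beta) (fun t => cos (a * t + c)) =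
    sin (a * (2 * pi / beta) + c) / a - sin (a * 0 + c) / a.
  apply: (@itg_FTC _ _ (fun t => sin (a * t + c) / a)) => //.
    apply: continuous_subspaceT => x.
    by apply: (@cvg_comp _ _ _ (fun m => a * m + c) cos _ (nbhs (a * x + c))); [exact: cm|exact: continuous_cos].
  move=> x _; have ds : is_derive x 1 (fun t => sin (a * t + c)) (cos (a * x + c) * a).
    by apply: is_derive_eq; rewrite /GRing.scale/= mulrC.
  have -> : (fun t => sin (a * t + c) / a) = a^-1 *: (fun t : R => sin (a * t + c)).
    by apply/funext => t; rewrite -[RHS]/(a^-1 * sin (a * t + c)) mulrC.
  by apply: is_derive_eq; rewrite /GRing.scale/=; field.
rewrite mulr0 add0r.
have -> : a * (2 * pi / beta) + c = c + pi *+ 2 *+ n.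
  rewrite -mulr_natr -[pi *+ 2]mulr_natr /a; move: (pi : R) => p; field.
  by rewrite gt_eqF.
by rewrite sin_period subrr.
Qed.

Local Notation P := (2 * pi / beta).

Lemma wave_mul j k t : wave j t * wave k t =
  (cos ((j%:R - k%:R) * beta * t) + cos ((j + k)%:R * beta * t + - (2 * phi))) / 2.
Proof.
rewrite /wave.
have -> : (j%:R - k%:R) * beta * t = (j%:R * beta * t - phi) - (k%:R * beta * t - phi) by ring.
have -> : (j + k)%:R * beta * t + - (2 * phi) = (j%:R * beta * t - phi) + (k%:R * beta * t - phi).
  by rewrite natrD; ring.
move: (j%:R * beta * t - phi) (k%:R * beta * t - phi) => x y.
by rewrite cosB cosD; field.
Qed.

Lemma bb_cosx a : bb (fun t => cos (a * t)).
Proof. by have := bb_cos a 0; congr bb; apply/funext => t; rewrite addr0. Qed.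

Lemma wave_orth j k : (0 < j)%N -> (0 < k)%N -> itg 0 P (fun t => wave j t * wave k t) = (P / 2) *+ (j == k).
Proof.
move=> j0 k0; under [X in itg _ _ X]eq_fun do rewrite wave_mul.
have b2 := bb_cos ((j + k)%:R * beta) (- (2 * phi)).
rewrite itgZr; last by apply: bbD => //; exact: bb_cosx.
rewrite itgD//; last exact: bb_cosx.
rewrite itg_cos_period ?addn_gt0 ?j0// addr0.
have [->|jk] := eqVneq j k.
  rewrite mulr1n; congr (_ / 2).
  under [X in itg _ _ X]eq_fun do rewrite subrr !mul0r cos0.
  by rewrite itg_cst ?subr0 ?mul1r// divr_ge0 ?(ltW beta0)// mulr_ge0// pi_ge0.
rewrite mulr0n.
wlog kj : j k j0 k0 b2 jk / (k < j)%N.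
  move=> h; move: (jk); rewrite neq_ltn => /orP[lt|lt]; last exact: h.
  rewrite -[RHS](h k j)//; [|exact: bb_cos|by rewrite eq_sym].
  congr (itg _ _ _ / 2); apply/funext => t.
  by rewrite -cosN; congr cos; ring.
rewrite -natrB 1?ltnW//.
have := @itg_cos_period (j - k) 0; rewrite subn_gt0 => /(_ kj).
under [X in itg _ _ X]eq_fun do rewrite addr0.
by move=> ->; rewrite mul0r.
Qed.

(** Expand the square of u minus the sum of its components along the waves, which are
    orthogonal over a period. *)
Lemma bessel (n m : nat) (u : R -> R) : (0 < m)%N -> bb u ->
  \sum_(k < n) (itg 0 P (fun t => u t * wave (m + k) t)) ^+ 2 <= P / 2 * itg 0 P (fun t => u t ^+ 2).
Proof.
move=> m0 bu.
have P0 : 0 < P :> R by rewrite divr_gt0// mulr_gt0// pi_gt0.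
pose c (k : nat) := itg 0 P (fun t => u t * wave (m + k) t).
pose S := \sum_(k < n) c k ^+ 2.
rewrite -/S.
have bw k := bb_wave k.
pose v t := \sum_(k < n) (2 / P * c k) * wave (m + k) t.
have bcw (k : nat) : bb (fun t => (2 / P * c k) * wave (m + k) t) by apply: bbM; [exact: bb_cst|].
have bv : bb v by exact: (bb_sum _ _ (fun k : 'I_n => bcw k)).
have e1 : itg 0 P (fun t => u t * v t) = 2 / P * S.
  rewrite (_ : (fun t => u t * v t) = fun t => \sum_(k < n) (2 / P * c k) * (u t * wave (m + k) t)); last first.
    by apply/funext => t; rewrite /v mulr_sumr; apply: eq_bigr => k _; ring.
  rewrite itg_sum; last by move=> k; apply: bbM; [exact: bb_cst|exact: bbM].
  rewrite /S mulr_sumr; apply: eq_bigr => k _.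
  by rewrite itgZ ?expr2 ?mulrA//; exact: bbM.
have e2 : itg 0 P (fun t => v t ^+ 2) = 2 / P * S.
  rewrite (_ : (fun t => v t ^+ 2) = fun t => \sum_(k < n) \sum_(j < n)
      (2 / P * c k * (2 / P * c j)) * (wave (m + k) t * wave (m + j) t)); last first.
    apply/funext => t; rewrite expr2 /v mulr_suml; apply: eq_bigr => k _.
    by rewrite mulr_sumr; apply: eq_bigr => j _; ring.
  have bkj (k j : nat) : bb (fun t => (2 / P * c k * (2 / P * c j)) * (wave (m + k) t * wave (m + j) t)).
    by apply: bbM; [exact: bb_cst|exact: bbM].
  rewrite itg_sum; last by move=> k; exact: (bb_sum _ _ (fun j : 'I_n => bkj k j)).
  rewrite /S mulr_sumr; apply: eq_bigr => k _.
  rewrite itg_sum; last by move=> j; exact: bkj.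
  rewrite (bigD1 k)//= big1 ?addr0; last first.
    move=> j jk; rewrite itgZ; last exact: bbM.
    rewrite wave_orth ?addn_gt0 ?m0// eqn_add2l.
    by rewrite eq_sym -val_eqE/= in jk; rewrite (negbTE jk) mulr0n mulr0.
  rewrite itgZ; last exact: bbM.
  rewrite wave_orth ?addn_gt0 ?m0// eqxx mulr1n.
  have Pn : P != 0 :> R by rewrite gt_eqF.
  move: (P) Pn => p pn; move: (c k) => ck; field; exact: pn.
have b3 : bb (fun t => u t ^+ 2 - 2 * (u t * v t)).
  apply: bbB; [exact: bbX|apply: bbM; [exact: bb_cst|exact: bbM]].
have : 0 <= itg 0 P (fun t => (u t - v t) ^+ 2) by apply: itg_ge0 => t _; exact: sqr_ge0.
have -> : (fun t => (u t - v t) ^+ 2) = fun t => (u t ^+ 2 - 2 * (u t * v t)) + v t ^+ 2.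
  by apply/funext => t; ring.
rewrite itgD//; last exact: bbX.
rewrite itgB//; [|exact: bbX|apply: bbM; [exact: bb_cst|exact: bbM]].
rewrite itgZ; last exact: bbM.
rewrite e1 e2 => h.
have h2 : 2 / P * S <= itg 0 P (fun t => u t ^+ 2) by lra.
have -> : S = P / 2 * (2 / P * S).
  have Pn : P != 0 :> R by rewrite gt_eqF.
  move: (P) Pn => p pn; field; exact: pn.
by rewrite ler_wpM2l// divr_ge0// ltW.
Qed.

End Bessel.

(** * Dyadic decomposition of an oscillating integral *)

Section DyadicSum.
Context {R : realType}.

Lemma geom_le (x : R) n : 0 <= x -> x < 1 -> \sum_(i < n) x ^+ i <= (1 - x)^-1.
Proof.
move=> x0 x1; have d : 0 < 1 - x by rewrite subr_gt0.
rewrite -(ler_pM2l d) mulfV ?gt_eqF//.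
have := subrX1 x n; have := exprn_ge0 n x0; move: (x ^+ n) (\sum_(i < n) _) => y z.
lra.
Qed.

(** A convex combination of the x i, up to the total weight, is at most their maximum. *)
Lemma weighted_max (rho : R) (x : nat -> R) (I Q : nat) : 0 < rho -> rho < 1 ->
  (forall i, 0 <= x i) -> (0 < Q)%N ->
  (\sum_(i < I) rho ^+ i * x i) ^+ Q <= (1 - rho) ^- Q * \sum_(i < I) x i ^+ Q.
Proof.
move=> r0 r1 x0 Q0; have d : 0 < 1 - rho by rewrite subr_gt0.
have [mu [mu0 hmu1 hmu2]] : exists mu : R, [/\ 0 <= mu, forall i, (i < I)%N -> x i <= mu &
    mu ^+ Q <= \sum_(i < I) x i ^+ Q].
  elim: I => [|I [mu [mu0 h1 h2]]].
    by exists 0; split => //; rewrite big_ord0 expr0n -[_ == _]negbK -lt0n Q0.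
  exists (Num.max mu (x I)); split.
  - by rewrite le_max mu0.
  - move=> i; rewrite ltnS leq_eqVlt => /predU1P[->|/h1 h]; rewrite le_max ?lexx ?orbT ?h//.
  - rewrite big_ord_recr /=; have xQ := exprn_ge0 Q (x0 I).
    have sQ : 0 <= \sum_(i < I) x i ^+ Q by apply: sumr_ge0 => i _; exact: exprn_ge0.
    by case: (leP mu (x I)) => _; [rewrite lerDr|rewrite (le_trans h2)// lerDl].
rewrite -exprVn; apply: (@le_trans _ _ ((1 - rho)^-1 ^+ Q * mu ^+ Q)); last first.
  by rewrite ler_wpM2l// exprn_ge0// invr_ge0 ltW.
rewrite -exprMn lerXn2r ?nnegrE//.
- by apply: sumr_ge0 => i _; rewrite mulr_ge0// exprn_ge0// ltW.
- by rewrite mulr_ge0// invr_ge0 ltW.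
apply: (@le_trans _ _ (\sum_(i < I) rho ^+ i * mu)).
  by apply: ler_sum => i _; rewrite ler_wpM2l ?hmu1// exprn_ge0// ltW.
by rewrite -mulr_suml ler_wpM2r// geom_le// ltW.
Qed.

(** Interpolation between the uniform bound B and the geometrically small mean squares.
    Write y i = rho^i x i with rho < 1 so close to 1 that rho^Q still exceeds theta:
    the sum over i is then controlled by the largest x i, and the Q-th powers of
    the x i remain summable. *)
Lemma dyadic_sum (B D theta : R) (Q : nat) : 0 <= B -> 0 <= D -> 0 < theta -> theta < 1 -> (2 <= Q)%N ->
  exists2 C : R, 0 <= C & forall (y : nat -> nat -> R) (m I : nat),
    (forall i k, 0 <= y i k) -> (forall i k, y i k <= B) ->
    (forall i, \sum_(k < m) y i k ^+ 2 <= D * m%:R * theta ^+ i) ->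
    \sum_(k < m) (\sum_(i < I) y i k) ^+ Q <= C * m%:R.
Proof.
move=> B0 D0 t0 t1 Q2; have Q0 : (0 < Q)%N by exact: leq_trans Q2.
have QR : 0 < Q%:R :> R by rewrite ltr0n.
have Q1 : 1 <= Q%:R :> R by rewrite ler1n.
(* By Bernoulli's inequality rho^Q >= (1 + theta) / 2. *)
pose rho : R := 1 - (1 - theta) / (2 * Q%:R).
have e1 : 0 < (1 - theta) / (2 * Q%:R) by rewrite divr_gt0 ?subr_gt0// mulr_gt0.
have e2 : (1 - theta) / (2 * Q%:R) < 1.
  by rewrite ltr_pdivrMr ?mulr_gt0//; lra.
have r0 : 0 < rho by rewrite /rho; lra.
have r1 : rho < 1 by rewrite /rho; lra.
have bern (x : R) (n : nat) : 0 <= x -> x <= 1 -> 1 - n%:R * x <= (1 - x) ^+ n.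
  move=> x0 x1; elim: n => [|n ih]; first by rewrite mul0r subr0 expr0.
  rewrite exprS; have h : 0 <= 1 - x by lra.
  apply: le_trans (ler_wpM2l h ih); rewrite -natr1.
  have : 0 <= n%:R * x * x by rewrite !mulr_ge0.
  by move: (n%:R) => N; nra.
have rQ : (1 + theta) / 2 <= rho ^+ Q.
  have := bern _ Q (ltW e1) (ltW e2); rewrite -/rho.
  have -> : Q%:R * ((1 - theta) / (2 * Q%:R)) = (1 - theta) / 2 by field; rewrite gt_eqF.
  by lra.
have rQ0 : 0 < rho ^+ Q by rewrite exprn_gt0.
pose sg := theta / rho ^+ Q.
have sg0 : 0 <= sg by rewrite divr_ge0// ltW.
have sg1 : sg < 1 by rewrite ltr_pdivrMr// mul1r (lt_le_trans _ rQ)//; lra.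
pose C := (1 - rho) ^- Q * (B ^+ (Q - 2) * (D * (1 - sg)^-1)).
have d0 : 0 < 1 - rho by rewrite subr_gt0.
have d1 : 0 < 1 - sg by rewrite subr_gt0.
exists C.
  by rewrite /C !mulr_ge0 ?invr_ge0 ?exprn_ge0// ltW.
move=> y m I y0 yB y2.
pose x k i := rho ^- i * y i k.
have xE k : \sum_(i < I) y i k = \sum_(i < I) rho ^+ i * x k i.
  by apply: eq_bigr => i _; rewrite /x mulrA mulfV ?mul1r// gt_eqF// exprn_gt0.
have x0 k i : 0 <= x k i by rewrite mulr_ge0// invr_ge0 exprn_ge0// ltW.
apply: (@le_trans _ _ (\sum_(k < m) (1 - rho) ^- Q * \sum_(i < I) x k i ^+ Q)).
  by apply: ler_sum => k _; rewrite xE; exact: weighted_max.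
rewrite -mulr_sumr /C -!mulrA ler_wpM2l ?invr_ge0 ?exprn_ge0 ?(ltW d0)//.
rewrite exchange_big /=.
apply: (@le_trans _ _ (\sum_(i < I) B ^+ (Q - 2) * (D * m%:R * sg ^+ i))).
  apply: ler_sum => i _.
  have ri : 0 < rho ^+ i by rewrite exprn_gt0.
  apply: (@le_trans _ _ (\sum_(k < m) (rho ^- i) ^+ Q * (B ^+ (Q - 2) * y i k ^+ 2))).
    apply: ler_sum => k _; rewrite /x exprMn ler_wpM2l ?exprn_ge0 ?invr_ge0 ?(ltW ri)//.
    rewrite -{1}(subnK Q2) exprD ler_wpM2r ?sqr_ge0// lerXn2r// nnegrE//.
  rewrite -mulr_sumr -mulr_sumr mulrCA ler_wpM2l ?exprn_ge0//.
  apply: (@le_trans _ _ ((rho ^- i) ^+ Q * (D * m%:R * theta ^+ i))).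
    by rewrite ler_wpM2l// exprn_ge0// invr_ge0 ltW.
  rewrite /sg expr_div_n mulrCA ler_wpM2l ?mulr_ge0//.
  by rewrite exprVn -!exprM mulnC mulrC.
rewrite -mulr_sumr ler_wpM2l ?exprn_ge0// -mulr_sumr -!mulrA ler_wpM2l// mulrC ler_wpM2r//.
exact: geom_le.
Qed.

End DyadicSum.

Section Core.
Context {R : realType}.
Notation itg := (@integral_on R).
Notation bb := (@bounded_borel R).
Implicit Types (t : R).

Lemma itg_indic (u : R -> R) (x p q y : R) : bb u -> x <= p -> p <= q -> q <= y ->
  itg x y (fun t => u t * \1_`[p, q] t) = itg p q u.
Proof.
move=> bu xp pq qy.
have bi : bb (\1_`[p, q] : R -> R) by exact: bb_indic.
have b1 : bb (fun t => u t * \1_`[p, q] t) by exact: bbM.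
have out t : ~~ (p <= t <= q) -> u t * \1_`[p, q] t = 0.
  by move=> h; rewrite indicE memNset ?mulr0//= in_itv/=; exact/negP.
rewrite (itg_cat b1 xp (le_trans pq qy)) (itg_cat b1 pq qy).
have -> : itg x p (fun t => u t * \1_`[p, q] t) = 0.
  rewrite -[RHS](itg0 x p).
  transitivity (itg x p (fun t => u p * (\1_`[p, p] t : R))).
    apply: eq_itg => t /andP[_]; rewrite le_eqVlt => /predU1P[->|tp].
      by rewrite !indicE !mem_set ?mulr1//= in_itv/= lexx.
    rewrite out; last by rewrite leNgt tp.
    by rewrite indicE memNset ?mulr0//= in_itv/= leNgt tp.
  apply: (@eq_itg_ne _ p); [by apply: bbM; [exact: bb_cst|exact: bb_indic]|exact: bb_cst|].
  move=> t tp; rewrite indicE memNset ?mulr0//= in_itv/= -eq_le => /eqP pt.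
  by rewrite pt eqxx in tp.
have -> : itg q y (fun t => u t * \1_`[p, q] t) = 0.
  rewrite -[RHS](itg0 q y).
  transitivity (itg q y (fun t => u q * (\1_`[q, q] t : R))).
    apply: eq_itg => t /andP[+ _]; rewrite le_eqVlt => /predU1P[<-|tp].
      by rewrite !indicE !mem_set ?mulr1//= in_itv/= lexx ?pq.
    rewrite out; last by rewrite [t <= q]leNgt tp andbF.
    by rewrite indicE memNset ?mulr0//= in_itv/= [t <= q]leNgt tp andbF.
  apply: (@eq_itg_ne _ q); [by apply: bbM; [exact: bb_cst|exact: bb_indic]|exact: bb_cst|].
  move=> t tp; rewrite indicE memNset ?mulr0//= in_itv/= -eq_le => /eqP pt.
  by rewrite pt eqxx in tp.
rewrite add0r addr0; apply: eq_itg => t ht.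
by rewrite indicE mem_set ?mulr1//= in_itv.
Qed.

Lemma itg_dyadic (u : R -> R) (eta : R) (I : nat) : bb u -> 0 < eta ->
  itg eta (2 ^+ I * eta) u = \sum_(i < I) itg (2 ^+ i * eta) (2 ^+ i.+1 * eta) u.
Proof.
move=> bu e0; elim: I => [|I ih]; first by rewrite expr0 mul1r itg_point big_ord0.
rewrite big_ord_recr /= -ih -itg_cat//.
  by rewrite ler_peMl ?(ltW e0)// exprn_ege1// ler1n.
by rewrite ler_pM2r// exprS ler_peMl ?exprn_ge0// ler1n.
Qed.

(** Turns a bound for r-th power means into one for first power means: below la use
    the first term, above la the second. *)
Lemma young_split (r y la : R) : 1 < r -> 0 <= y -> 0 < la -> y <= la + la `^ (1 - r) * y `^ r.
Proof.
move=> r1 y0 la0; have [h|h] := leP y la.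
  by rewrite (le_trans h)// lerDl mulr_ge0// powR_ge0.
have y1 : 0 < y by exact: lt_trans h.
apply: (@le_trans _ _ (la `^ (1 - r) * y `^ r)); last by rewrite lerDr ltW.
have yE : y = y `^ (1 - r) * y `^ r.
  rewrite -powRD; last by apply/implyP => _; rewrite gt_eqF.
  by rewrite subrK powRr1// ltW.
rewrite {1}yE; apply: ler_wpM2r; first exact: powR_ge0.
rewrite -[1 - r]opprB !powRN lef_pV2 ?posrE ?powR_gt0//.
by apply: ge0_ler_powR; rewrite ?nnegrE ?(ltW la0) ?(ltW y1) ?(ltW h)//; rewrite subr_ge0 ltW.
Qed.

(** The heart of the matter, in place of the Hausdorff-Young inequality. On the
    i-th dyadic interval cut b at height 1. Where |b| is larger, |b| <= |b|^r and
    the L1 norms form a geometric series. Where it is smaller, b^2 <= |b|^r, and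
    Bessel's inequality bounds the sum over the m frequencies of the squares by a
    geometric sequence in i; each single integral is bounded as well, and
    [dyadic_sum] combines the two facts. *)
Theorem dyadic_wave_bound (r A : R) (Q : nat) : 1 < r -> r <= 2 -> 0 <= A -> (2 <= Q)%N ->
  exists2 C : R, 0 <= C & forall (beta phi eta : R) (m : nat) (b : R -> R),
    0 < beta -> 0 < eta -> (0 < m)%N -> 2 * pi / beta = 4 * m%:R * eta -> bb b ->
    (forall t, t <= eta -> b t = 0) -> (forall t, 2 * pi / beta <= t -> b t = 0) ->
    (forall i, itg (2 ^+ i * eta) (2 ^+ i.+1 * eta) (fun t => `|b t| `^ r) <= A * eta * (2 `^ (1 - r)) ^+ i) ->
    \sum_(k < m) `|itg 0 (2 * pi / beta) (fun t => b t * wave beta phi (m + k) t)| ^+ Q <= C * m%:R * eta ^+ Q.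
Proof.
move=> r1 r2 A0 Q2; pose th : R := 2 `^ (1 - r).
have th0 : 0 < th by rewrite powR_gt0.
have th1 : th < 1.
  rewrite /th -[1 - r]opprB powRN invf_lt1 ?powR_gt0//.
  have := @gt0_ltr_powR R (r - 1) _ 1 2; rewrite powR1; apply; rewrite ?nnegrE ?subr_gt0//.
  by rewrite ltr1n.
have thE i : (2 ^- i) `^ (1 - r) = th ^- i.
  rewrite /th -(powR_mulrn _ (ltW th0)) -powRN -powRrM.
  rewrite -(powR_invn i (ler0n R 2)) -powRrM; congr (_ `^ _); ring.
pose q1 : R := (1 - th)^-1.
have q10 : 0 < q1 by rewrite invr_gt0 subr_gt0.
have [C C0 hC] := @dyadic_sum R (1 + A) (2 * A) th Q (addr_ge0 ler01 A0) (mulr_ge0 (ler0n _ _) A0) th0 th1 Q2.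
exists (2 ^+ Q * (C + (A * q1) ^+ Q)).
  by rewrite mulr_ge0 ?exprn_ge0// addr_ge0// exprn_ge0// mulr_ge0// ltW.
move=> beta phi eta m b beta0 eta0 m0 hP bb_b b1 b2 hb.
set P := 2 * pi / beta in hP b2 *.
have mR : 0 < m%:R :> R by rewrite ltr0n.
have P0 : 0 < P by rewrite hP !mulr_gt0.
have etaP : eta <= P.
  rewrite hP ler_peMl ?(ltW eta0)//; have : 1 <= m%:R :> R by rewrite ler1n.
  by lra.
(* 4 m dyadic intervals are more than enough to cover a period, as 4 m <= 2^(4 m). *)
pose I := (4 * m)%N; pose q := 2 ^+ I * eta.
have Pq : P <= q.
  rewrite hP /q ler_pM2r// -natrM -/I -natrX ler_nat.
  by rewrite ltnW// ltn_expl.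
have eq_ : eta <= q by exact: le_trans Pq.
pose lo i := 2 ^+ i * eta.
have lo0 i : 0 < lo i by rewrite mulr_gt0// exprn_gt0.
have lolo i : lo i <= lo i.+1 by rewrite ler_pM2r// exprS ler_peMl ?exprn_ge0// ler1n.
have lodiff i : lo i.+1 - lo i = lo i by rewrite /lo exprS; ring.
pose e k := wave beta phi (m + k).
have be k : bb (e k) by exact: bb_wave.
pose cut : R -> R := \1_`[-1, 1].
pose bs t := b t * cut (b t).
pose bl t := b t - bs t.
have bbs : bb bs.
  by apply: bbM => //; apply: (@bb_comp _ cut b); [case: bb_b|exact: bb_indic].
have bbl : bb bl by exact: bbB.
have bbr : bb (fun t => `|b t| `^ r) by apply: bb_powR => //; lra.
have cutE t : (cut (b t) = 1 /\ `|b t| <= 1) \/ (cut (b t) = 0 /\ 1 < `|b t|).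
  rewrite /cut indicE; have [h|h] := leP `|b t| 1.
    by left; rewrite mem_set//= in_itv/= -ler_norml.
  by right; rewrite memNset//= in_itv/= -ler_norml; apply/negP; rewrite -ltNge.
have bs_le t : `|bs t| <= `|b t|.
  by rewrite /bs; case: (cutE t) => -[-> _]; rewrite ?mulr1// mulr0 normr0.
have bs_sq t : bs t ^+ 2 <= `|b t| `^ r.
  rewrite /bs; case: (cutE t) => -[-> h]; last by rewrite mulr0 expr0n powR_ge0.
  rewrite mulr1 -(real_normK (num_real (b t))) -powR_mulrn//.
  have [->|bt0] := eqVneq (b t) 0; first by rewrite normr0 !powR0 ?pnatr_eq0// gt_eqF//; lra.
  by apply: ger_powR; rewrite ?normr_gt0 ?bt0.
have bl_le t : `|bl t| <= `|b t| `^ r.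
  rewrite /bl /bs; case: (cutE t) => -[-> h]; first by rewrite mulr1 subrr normr0 powR_ge0.
  by rewrite mulr0 subr0; apply: le1r_powR; exact: ltW.
pose x i k := `|itg (lo i) (lo i.+1) (fun t => bs t * e k t)|.
have bse k : bb (fun t => bs t * e k t) by exact: bbM.
have e1 k t : `|e k t| <= 1 by exact: wave_bound.
have xB i k : x i k <= (1 + A) * eta.
  apply: (le_trans (itg_norm _ _ (bse k))).
  apply: (@le_trans _ _ (itg (lo i) (lo i.+1) (fun t => 2 ^- i + th ^- i * `|b t| `^ r))).
    apply: le_itg; [exact: bb_norm|by apply: bbD; [exact: bb_cst|apply: bbM => //; exact: bb_cst]|].
    move=> t _; rewrite normrM (le_trans (ler_piMr _ (e1 k t)))//.
    apply: (le_trans (bs_le t)); rewrite -thE; apply: young_split => //.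
  rewrite itgD; [|exact: bb_cst|by apply: bbM => //; exact: bb_cst].
  rewrite itg_cst ?lolo// itgZ// lodiff mulrDl mul1r lerD//.
    by rewrite /lo mulrA mulVf ?mul1r// expf_neq0.
  have thi : 0 < th ^+ i by rewrite exprn_gt0.
  rewrite mulrC ler_pdivrMr//; exact: hb.
have trunc i k : itg 0 P (fun t => (bs t * \1_`[lo i, lo i.+1] t) * e k t) =
    itg (lo i) (lo i.+1) (fun t => bs t * e k t).
  have L1 : 0 <= lo i by exact: ltW.
  pose y := P + lo i.+1.
  have L2 : lo i.+1 <= y by rewrite lerDr ltW.
  rewrite -(itg_indic (bse k) L1 (lolo i) L2).
  have bi : bb (\1_`[lo i, lo i.+1] : R -> R) by exact: bb_indic.
  have -> : (fun t => bs t * \1_`[lo i, lo i.+1] t * e k t) = (fun t => bs t * e k t * \1_`[lo i, lo i.+1] t).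
    by apply/funext => t; ring.
  have bi2 : bb (fun t => bs t * e k t * \1_`[lo i, lo i.+1] t) by exact: bbM.
  have Py : P <= y by rewrite lerDl ltW.
  rewrite [RHS](itg_cat bi2 (ltW P0) Py) (_ : itg P y _ = 0) ?addr0//.
  rewrite -[RHS](itg0 P y); apply: eq_itg => t /andP[Pt _].
  by rewrite /bs b2// !mul0r.
have x2 i : \sum_(k < m) x i k ^+ 2 <= 2 * A * m%:R * th ^+ i * eta ^+ 2.
  have bi : bb (\1_`[lo i, lo i.+1] : R -> R) by exact: bb_indic.
  have bu : bb (fun t => bs t * \1_`[lo i, lo i.+1] t) by exact: bbM.
  have h := bessel phi beta0 m m0 bu; rewrite -/P in h.
  rewrite (eq_bigr (fun k : 'I_m => (itg 0 P (fun t => bs t * \1_`[lo i, lo i.+1] t * wave beta phi (m + k) t)) ^+ 2)); last first.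
    by move=> k _; rewrite /x -trunc real_normK ?num_real.
  apply: (le_trans h).
  have h2 : itg 0 P (fun t => (bs t * \1_`[lo i, lo i.+1] t) ^+ 2) <= A * eta * th ^+ i.
    pose y := P + lo i.+1.
    have L1 : 0 <= lo i by exact: ltW.
    have L2 : lo i.+1 <= y by rewrite lerDr ltW.
    have Py : P <= y by rewrite lerDl ltW.
    apply: (@le_trans _ _ (itg 0 y (fun t => (bs t * \1_`[lo i, lo i.+1] t) ^+ 2))).
      by apply: itg_mono => //; [exact: bbX|move=> t _; exact: sqr_ge0].
    have -> : (fun t => (bs t * \1_`[lo i, lo i.+1] t) ^+ 2) = (fun t => bs t ^+ 2 * \1_`[lo i, lo i.+1] t).
      apply/funext => t; rewrite exprMn indicE.
      by case: (_ \in _); rewrite ?expr1n ?expr0n.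
    rewrite (itg_indic (bbX 2 bbs) L1 (lolo i) L2).
    apply: (le_trans _ (hb i)); apply: le_itg => //; exact: bbX.
  apply: (le_trans (ler_wpM2l _ h2)); first by rewrite divr_ge0// ltW.
  by rewrite hP le_eqVlt; apply/orP; left; apply/eqP; field.
pose z k := itg 0 P (fun t => b t * e k t).
have zle k : `|z k| <= \sum_(i < I) x i k + A * q1 * eta.
  have bbe : bb (fun t => b t * e k t) by exact: bbM.
  have ble : bb (fun t => bl t * e k t) by exact: bbM.
  have zq : z k = itg eta q (fun t => b t * e k t).
    rewrite /z (itg_supp bbe (ltW eta0) etaP (lexx _)); last 2 first.
    - by move=> t /b1 ->; rewrite mul0r.
    - by move=> t /b2 ->; rewrite mul0r.
    rewrite (itg_supp bbe (lexx _) etaP Pq)// => t.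
    - by move=> /b1 ->; rewrite mul0r.
    - by move=> /b2 ->; rewrite mul0r.
  have -> : z k = \sum_(i < I) itg (lo i) (lo i.+1) (fun t => bs t * e k t) + itg eta q (fun t => bl t * e k t).
    rewrite -(itg_dyadic I (bse k) eta0) zq -itgD//.
    by congr itg; apply/funext => t; rewrite /bl; ring.
  rewrite (le_trans (ler_normD _ _))// lerD//; first exact: ler_norm_sum.
  apply: (le_trans (itg_norm _ _ ble)).
  apply: (@le_trans _ _ (itg eta q (fun t => `|b t| `^ r))).
    apply: le_itg => //; first exact: bb_norm.
    by move=> t _; rewrite normrM (le_trans (ler_piMr _ (e1 k t))).
  rewrite (itg_dyadic I bbr eta0).
  apply: (@le_trans _ _ (\sum_(i < I) A * eta * th ^+ i)); first by apply: ler_sum => i _; exact: hb.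
  rewrite -mulr_sumr [leRHS]mulrAC ler_wpM2l ?mulr_ge0 ?(ltW eta0)//.
  by apply: geom_le => //; exact: ltW.
pose yy i k := x i k / eta.
have yy0 i k : 0 <= yy i k by apply: divr_ge0; [exact: normr_ge0|exact: ltW].
have yyB i k : yy i k <= 1 + A by rewrite /yy ler_pdivrMr //; exact: xB.
have yy2 i : \sum_(k < m) yy i k ^+ 2 <= 2 * A * m%:R * th ^+ i.
  rewrite (eq_bigr (fun k : 'I_m => eta ^- 2 * x i k ^+ 2)); last first.
    by move=> k _; rewrite /yy expr_div_n mulrC.
  by rewrite -mulr_sumr mulrC ler_pdivrMr ?exprn_gt0.
have := hC yy m I yy0 yyB yy2 => hS.
apply: (@le_trans _ _ (\sum_(k < m) 2 ^+ Q * ((\sum_(i < I) yy i k) ^+ Q + (A * q1) ^+ Q) * eta ^+ Q)).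
  apply: ler_sum => k _.
  have S0 : 0 <= \sum_(i < I) yy i k by apply: sumr_ge0 => i _; exact: yy0.
  have Aq0 : 0 <= A * q1 by rewrite mulr_ge0// ltW.
  apply: (@le_trans _ _ (((\sum_(i < I) yy i k + A * q1) * eta) ^+ Q)).
    rewrite lerXn2r ?nnegrE ?mulr_ge0 ?addr_ge0 ?(ltW eta0)//.
    apply: (le_trans (zle k)); rewrite mulrDl lerD2r mulr_suml.
    by apply: ler_sum => i _; rewrite /yy divfK// gt_eqF.
  rewrite exprMn ler_wpM2r ?exprn_ge0 ?(ltW eta0)//.
  move: S0 Aq0; move: (\sum_(i < I) _) (A * q1) => u v u0 v0.
  apply: (@le_trans _ _ ((2 * Num.max u v) ^+ Q)).
    rewrite lerXn2r ?nnegrE ?addr_ge0 ?mulr_ge0 ?le_max ?u0//.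
    have : u <= Num.max u v by rewrite le_max lexx.
    have : v <= Num.max u v by rewrite le_max lexx orbT.
    lra.
  rewrite exprMn ler_wpM2l ?exprn_ge0//.
  by case: (leP u v) => _; rewrite ?lerDr ?lerDl exprn_ge0.
rewrite -mulr_suml ler_wpM2r ?exprn_ge0 ?(ltW eta0)// -mulr_sumr -!mulrA ler_wpM2l ?exprn_ge0//.
by rewrite big_split /= mulrDl lerD// sumr_const card_ord mulr_natr.
Qed.

End Core.

(** * Weights and tails *)

Section Tools.
Context {R : realType}.
Notation itg := (@integral_on R).
Notation bb := (@bounded_borel R).

Lemma bb_maxV (c : R) : 0 < c -> bb (fun t => (Num.max c t)^-1).
Proof.
move=> c0; have h t : c <= Num.max c t by rewrite le_max lexx.
have h0 t : 0 < Num.max c t by exact: lt_le_trans (h t).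
apply: (@bb_cont _ _ c^-1); last first.
  by move=> t; rewrite ger0_norm ?invr_ge0 ?(ltW (h0 t))// lef_pV2 ?posrE.
apply: (@lip_continuous _ _ (c^-1 ^+ 2)) => t s.
have -> : (Num.max c t)^-1 - (Num.max c s)^-1 =
   (Num.max c s - Num.max c t) * ((Num.max c t)^-1 * (Num.max c s)^-1).
  by field; rewrite !gt_eqF.
rewrite normrM mulrC; apply: ler_pM => //.
  rewrite normrM expr2 !ger0_norm ?invr_ge0 ?(ltW (h0 _))//.
  by apply: ler_pM; rewrite ?invr_ge0 ?(ltW (h0 _))// lef_pV2 ?posrE.
rewrite distrC !maxEle; case: (leP c t) => a; case: (leP c s) => b //.
- by rewrite ger0_norm ?subr_ge0// (le_trans _ (ler_norm _))// lerB// ltW.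
- rewrite distrC ger0_norm ?subr_ge0// distrC (le_trans _ (ler_norm _))// lerB// ltW//.
- by rewrite subrr normr0.
Qed.

Lemma itg_open (u : R -> R) (a b : R) : bb u -> a <= b ->
  itg a b (fun t => u t * \1_`]a, b[ t) = itg a b u.
Proof.
move=> bu ab.
have E1 : itg a b (fun t => u t * \1_`]a, b[ t) = itg a b (fun t => u t * \1_`]a, b] t).
  apply: (@eq_itg_ne _ b); [by apply: bbM => //; exact: bb_indic..|].
  move=> t tb; congr (_ * _); rewrite !indicE; congr (_%:R); congr nat_of_bool.
  apply/idP/idP; rewrite !inE/= !in_itv/= => /andP[-> h]/=; first exact: ltW.
  by rewrite lt_neqAle tb.
rewrite E1 -[RHS](_ : itg a b (fun t => u t * \1_`[a, b] t) = _); last first.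
  by apply: eq_itg => t h; rewrite indic_itvE// mulr1.
apply: (@eq_itg_ne _ a); [by apply: bbM => //; exact: bb_indic..|].
move=> t tb; congr (_ * _); rewrite !indicE; congr (_%:R); congr nat_of_bool.
apply/idP/idP; rewrite !inE/= !in_itv/= => /andP[h ->]; rewrite andbT; first exact: ltW.
by rewrite lt_neqAle eq_sym tb.
Qed.

(** On the dyadic interval starting at 2^i P the weight is at most (2^i P)^-2 while the
    integral of h is of order 2^i P. *)
Lemma itg_sqr_tail (h : R -> R) (B P Y : R) : bb h -> (forall t, 0 <= h t) -> 0 < P -> 0 <= B ->
  (forall d, 0 < d -> itg 0 d h <= B * d) -> P <= Y ->
  itg P Y (fun t => h t * (Num.max P t)^-1 ^+ 2) <= 4 * B / P.
Proof.
move=> bh h0 P0 B0 hB PY.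
pose wt t := h t * (Num.max P t)^-1 ^+ 2.
have bwt : bb wt by apply: bbM => //; apply: bbX; exact: bb_maxV.
have wt0 t : 0 <= wt t by rewrite mulr_ge0// sqr_ge0.
pose n := Num.truncn (Y / P).
have Yn : Y <= 2 ^+ n.+1 * P.
  rewrite -ler_pdivrMr//; apply: (le_trans (ltW (truncnS_gt _))).
  by rewrite -natrX ler_nat ltnW// ltn_expl.
apply: (@le_trans _ _ (itg P (2 ^+ n.+1 * P) wt)).
  by apply: itg_mono => // t _; exact: wt0.
rewrite itg_dyadic//.
apply: (@le_trans _ _ (\sum_(i < n.+1) (2 * B / P) * (2^-1) ^+ i)).
  apply: ler_sum => i _.
  have p2 : 0 < (2 : R) ^+ i by rewrite exprn_gt0.
  apply: (@le_trans _ _ (itg (2 ^+ i * P) (2 ^+ i.+1 * P) (fun t => (2 ^+ i * P)^-1 ^+ 2 * h t))).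
    apply: le_itg => //; first by apply: bbM => //; exact: bb_cst.
    move=> t /andP[t1 _]; rewrite /wt mulrC ler_wpM2r//.
    have Pt : 2 ^+ i * P <= Num.max P t by rewrite le_max t1 orbT.
    have ip : 0 < 2 ^+ i * P by rewrite mulr_gt0.
    by rewrite lerXn2r ?nnegrE ?invr_ge0 ?(ltW ip) ?(le_trans (ltW ip) Pt)// lef_pV2 ?posrE// (lt_le_trans ip).
  rewrite itgZ//.
  apply: (@le_trans _ _ ((2 ^+ i * P)^-1 ^+ 2 * (B * (2 ^+ i.+1 * P)))).
    apply: ler_wpM2l; first exact: sqr_ge0.
    apply: (le_trans _ (hB _ _)); last by rewrite mulr_gt0// exprn_gt0.
    by apply: itg_mono => //; rewrite mulr_ge0// ltW.
  rewrite le_eqVlt; apply/orP; left; apply/eqP; rewrite [2 ^+ i.+1]exprS [2^-1 ^+ i]exprVn.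
  by move: p2; move: (2 ^+ i) => z z0; field; rewrite !gt_eqF.
rewrite -mulr_sumr.
have -> : 4 * B / P = (2 * B / P) * (1 - 2^-1)^-1 by field; rewrite gt_eqF.
apply: ler_wpM2l; first by rewrite divr_ge0 ?(ltW P0)// mulr_ge0.
by apply: geom_le; [rewrite invr_ge0|rewrite invf_lt1 ?ltr1n].
Qed.

Lemma powR_add3 (r x y z : R) : 0 <= r -> 0 <= x -> 0 <= y -> 0 <= z ->
  (x + y + z) `^ r <= 3 `^ r * (x `^ r + y `^ r + z `^ r).
Proof.
move=> r0 x0 y0 z0; pose u := Num.max x (Num.max y z).
have u0 : 0 <= u by rewrite le_max x0.
have xu : x <= u by rewrite le_max lexx.
have yu : y <= u by rewrite !le_max lexx orbT.
have zu : z <= u by rewrite !le_max lexx !orbT.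
apply: (@le_trans _ _ ((3 * u) `^ r)).
  apply: ge0_ler_powR; rewrite ?nnegrE ?addr_ge0 ?mulr_ge0//.
  by move: xu yu zu; clearbody u; clear; lra.
rewrite powRM// ler_wpM2l ?powR_ge0//.
have px := powR_ge0 x r; have py := powR_ge0 y r; have pz := powR_ge0 z r.
have : u = x \/ u = y \/ u = z.
  rewrite /u /Num.max; case: ifP => _; last by left.
  by case: ifP => _; right; [right|left].
move: px py pz => + + + [->|[->|->]]; move: (x `^ r) (y `^ r) (z `^ r) => {}x0 {}y0 {}z0; clear; lra.
Qed.
End Tools.

(** * Half-period shifts and moduli of continuity *)

Section Shift.
Context {R : realType}.
Notation itg := (@integral_on R).
Notation bb := (@bounded_borel R).

Lemma wave_shift (beta phi : R) (k : nat) (eta t : R) :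
  wave beta phi k (t + eta) + wave beta phi k (t - eta) = 2 * cos (k%:R * beta * eta) * wave beta phi k t.
Proof.
rewrite /wave.
have -> : k%:R * beta * (t + eta) - phi = (k%:R * beta * t - phi) + k%:R * beta * eta by ring.
have -> : k%:R * beta * (t - eta) - phi = (k%:R * beta * t - phi) - k%:R * beta * eta by ring.
by move: (_ * t - phi) (_ * eta) => y z; rewrite cosD cosB; ring.
Qed.

(** The sum of the two shifts of a wave by eta and -eta is the wave times twice the cosine
    of (m+k) beta eta, an angle in [pi/2, pi); as this cosine is nonpositive, the
    integral of a is controlled by that of its second difference. *)
Lemma shift_average (beta phi : R) (a : R -> R) (eta T : R) (m k : nat) : 0 < beta -> bb a -> 0 < eta -> eta <= T ->
  (forall t, t <= eta -> a t = 0) -> (forall t, T <= t -> a t = 0) ->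
  (0 < m)%N -> (k < m)%N -> eta = pi / (2 * beta * m%:R) ->
  `|itg 0 T (fun t => a t * wave beta phi (m + k) t)| <=
  `|itg 0 (T + eta) (fun t => (2 * a t - a (t - eta) - a (t + eta)) * wave beta phi (m + k) t)|.
Proof.
move=> beta0 ba eta0 eT a1 a2 m0 km etaE; set e := wave beta phi (m + k).
have be : bb e by exact: bb_wave.
have T0 : 0 <= T by rewrite (le_trans (ltW eta0)).
have bs1 : bb (fun t => a (t + - eta)) by exact: bb_shift.
have bs2 : bb (fun t => a (t + eta)) by exact: bb_shift.
have bs3 : bb (fun t => e (t + eta)) by exact: bb_shift.
have bs4 : bb (fun t => e (t + - eta)) by exact: bb_shift.
set X := itg 0 T (fun t => a t * e t).
have supp (u : R -> R) x y : bb u -> x <= eta -> T <= y ->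
    itg x y (fun t => a t * u t) = itg eta T (fun t => a t * u t).
  move=> bu xe Ty; apply: itg_supp => //; first by exact: bbM.
    by move=> t /a1 ->; rewrite mul0r.
  by move=> t /a2 ->; rewrite mul0r.
have XE : X = itg eta T (fun t => a t * e t) by rewrite /X supp// ltW.
have E0 : itg 0 (T + eta) (fun t => a t * e t) = X by rewrite XE supp ?ltW// ltrDl.
have E1 : itg 0 (T + eta) (fun t => a (t - eta) * e t) = itg eta T (fun t => a t * e (t + eta)).
  transitivity (itg (- eta) T (fun t => a t * e (t + eta))).
    have := itg_shift (0 : R) (T + eta) (- eta) (bbM ba bs3).
    rewrite add0r addrK => <-; apply: eq_itg => t _.
    by rewrite subrK.
  by rewrite supp//; move: eta0; clear; lra.
have E2 : itg 0 (T + eta) (fun t => a (t + eta) * e t) = itg eta T (fun t => a t * e (t - eta)).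
  transitivity (itg eta (T + eta + eta) (fun t => a t * e (t - eta))).
    have := itg_shift (0 : R) (T + eta) eta (bbM ba bs4).
    rewrite add0r => <-; apply: eq_itg => t _.
    by rewrite addrK.
  by rewrite supp//; move: eta0; clear; lra.
have -> : itg 0 (T + eta) (fun t => (2 * a t - a (t - eta) - a (t + eta)) * e t) =
    (2 - 2 * cos ((m + k)%:R * beta * eta)) * X.
  transitivity (2 * X - (itg eta T (fun t => a t * e (t + eta)) + itg eta T (fun t => a t * e (t - eta)))).
    rewrite -E1 -E2 -E0 -itgZ; last by exact: bbM.
    rewrite -itgD; [|exact: bbM..].
    rewrite -itgB; [|by apply: bbM; [exact: bb_cst|exact: bbM]|by apply: bbD; exact: bbM].
    by apply: eq_itg => t _; ring.
  rewrite -itgD; [|exact: bbM..].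
  transitivity (2 * X - itg eta T (fun t => (2 * cos ((m + k)%:R * beta * eta)) * (a t * e t))).
    by congr (_ - _); apply: eq_itg => t _; rewrite -mulrDr wave_shift mulrCA.
  by rewrite itgZ; [rewrite -XE mulrBl|exact: bbM].
have mR : 0 < m%:R :> R by rewrite ltr0n.
have c0 : cos ((m + k)%:R * beta * eta) <= 0.
  have -> : (m + k)%:R * beta * eta = pi / 2 + (k%:R / m%:R) * (pi / 2).
    rewrite etaE natrD; have := @pi_gt0 R; move: pi => p p0.
    by field; rewrite !gt_eqF.
  rewrite cosD cos_pihalf mul0r sub0r oppr_le0 sin_pihalf mul1r sin_ge0_pi//.
  have p0 := @pi_gt0 R.
  have km1 : k%:R / m%:R <= 1 :> R by rewrite ler_pdivrMr// mul1r ler_nat ltnW.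
  have km0 : 0 <= k%:R / m%:R :> R by rewrite divr_ge0.
  rewrite mulr_ge0 ?divr_ge0 ?(ltW p0)//=.
  apply: (@le_trans _ _ (1 * (pi / 2))); first by rewrite ler_wpM2r// divr_ge0// ltW.
  by move: p0; clear; move: pi => p; lra.
rewrite normrM ler_peMl// ger0_norm; move: c0; move: (cos _) => z; clear; lra.
Qed.
End Shift.

Section Modulus.
Context {R : realType}.
Variable w : R -> R.
Hypothesis w_gt0 : forall d : R, 0 < d -> 0 < w d.
Hypothesis w_sub : forall d e : R, 0 < d -> 0 < e -> w (d + e) <= w d + w e.

Lemma modulus_mul (n : nat) (d : R) : 0 < d -> w (n.+1%:R * d) <= n.+1%:R * w d.
Proof.
move=> d0; elim: n => [|n ih]; first by rewrite !mul1r.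
rewrite [n.+2%:R](_ : _ = n.+1%:R + 1); last by rewrite -addn1 natrD.
rewrite !mulrDl !mul1r; apply: (le_trans (w_sub _ d0)); first by rewrite mulr_gt0.
by rewrite lerD2r.
Qed.

(** A modulus of continuity that is positive on the half line decays at most linearly at 0. *)
Lemma modulus_linear (d : R) (m : nat) : 0 < d -> (0 < m)%N -> d / m%:R <= (d / w d) * w (d / m%:R).
Proof.
case: m => // m d0 _; have mR : 0 < m.+1%:R :> R by [].
have wd := w_gt0 d0.
have dm : 0 < d / m.+1%:R by rewrite divr_gt0.
have h := modulus_mul m dm; rewrite mulrCA mulfV ?gt_eqF// mulr1 in h.
have e : d / w d * w d = d by rewrite divfK ?gt_eqF.
rewrite ler_pdivrMr// -[leRHS]mulrA -[leLHS]e ler_wpM2l//; first by rewrite divr_ge0 ?(ltW wd) ?(ltW d0).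
by rewrite mulrC.
Qed.
End Modulus.

(** * One block of frequencies *)

Section MeanL1.
Context {R : realType}.
Notation itg := (@integral_on R).
Notation bb := (@bounded_borel R).

Lemma mean_L1 (u : R -> R) (B r d W : R) : bb u -> 1 < r -> 0 < d -> 0 < W ->
  itg 0 d (fun t => `|u t| `^ r) <= B * d * W `^ r -> itg 0 d (fun t => `|u t|) <= (1 + B) * W * d.
Proof.
move=> bu r1 d0 W0 h.
have r0 : 0 <= r by rewrite (le_trans ler01)// ltW.
have bur := bb_powR r0 bu.
apply: (@le_trans _ _ (itg 0 d (fun t => W + W `^ (1 - r) * `|u t| `^ r))).
  apply: le_itg; [exact: bb_norm|by apply: bbD; [exact: bb_cst|apply: bbM => //; exact: bb_cst]|].
  by move=> t _; exact: young_split.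
rewrite itgD; [|exact: bb_cst|by apply: bbM => //; exact: bb_cst].
rewrite itg_cst ?(ltW d0)// itgZ// subr0 -mulrA mulrDl mul1r lerD2l.
apply: (le_trans (ler_wpM2l (powR_ge0 _ _) h)).
rewrite mulrCA -powRD; last by apply/implyP => _; rewrite gt_eqF.
by rewrite subrK powRr1 ?(ltW W0)// mulrC mulrCA mulrA.
Qed.
End MeanL1.

Section WaveBlock.
Context {R : realType}.
Notation itg := (@integral_on R).
Notation bb := (@bounded_borel R).

Section Kernel.
Variables (s : R -> R) (beta : R).
Hypothesis bs : bb s.
Hypothesis s2 : forall t, `|s t| <= 2.
Hypothesis s_lip : forall t u, `|s t - s u| <= beta * `|t - u|.
Hypothesis s0 : s 0 = 0.

Definition ker eta t : R := s t * (Num.max eta t)^-1 ^+ 2.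

Lemma bb_ker eta : 0 < eta -> bb (ker eta).
Proof. by move=> e0; apply: bbM => //; apply: bbX; exact: bb_maxV. Qed.

Lemma kerE eta t : eta <= t -> ker eta t = s t * t^-1 ^+ 2.
Proof. by move=> h; rewrite /ker max_r. Qed.

Let s_lin t : 0 <= t -> `|s t| <= beta * t.
Proof. by move=> t0; have := s_lip t 0; rewrite s0 !subr0 (ger0_norm t0). Qed.

Lemma ker_le1 eta t : 0 < eta -> eta <= t -> `|ker eta t| <= beta / t.
Proof.
move=> e0 et; have t0 : 0 < t by exact: lt_le_trans et.
rewrite kerE// normrM [X in _ * X]ger0_norm ?sqr_ge0//.
apply: (le_trans (ler_wpM2r (sqr_ge0 _) (s_lin (ltW t0)))).
by rewrite le_eqVlt; apply/orP; left; apply/eqP; field; rewrite gt_eqF.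
Qed.

Lemma ker_le2 eta t : 0 < eta -> eta <= t -> `|ker eta t| <= 2 * t^-1 ^+ 2.
Proof.
move=> e0 et; rewrite kerE// normrM [X in _ * X]ger0_norm ?sqr_ge0//.
by rewrite ler_wpM2r ?sqr_ge0.
Qed.

Lemma ker_diff eta t u : 0 < eta -> eta <= t -> eta <= u -> t <= 2 * u ->
  `|ker eta t - ker eta u| <= 4 * beta * `|t - u| * t^-1 ^+ 2.
Proof.
move=> e0 et eu tu; have t0 : 0 < t by exact: lt_le_trans et.
have u0 : 0 < u by exact: lt_le_trans eu.
rewrite !kerE//.
have -> : s t * t^-1 ^+ 2 - s u * u^-1 ^+ 2 =
    (s t - s u) * t^-1 ^+ 2 + s u * ((u - t) * (u + t) * (u^-1 ^+ 2 * t^-1 ^+ 2)).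
  by field; rewrite !gt_eqF.
have be0 : 0 <= beta.
  by have := s_lin ler01; rewrite mulr1; apply: le_trans.
rewrite (le_trans (ler_normD _ _))//.
have -> : 4 * beta * `|t - u| * t^-1 ^+ 2 = beta * `|t - u| * t^-1 ^+ 2 + beta * u * (`|t - u| * (3 * u) * (u^-1 ^+ 2 * t^-1 ^+ 2)).
  by move: `|t - u| => z; field; rewrite !gt_eqF.
apply: lerD; first by rewrite normrM [X in _ * X]ger0_norm ?sqr_ge0// ler_wpM2r ?sqr_ge0.
rewrite normrM; apply: ler_pM => //; first exact: s_lin (ltW u0).
have q0 : 0 <= u^-1 ^+ 2 * t^-1 ^+ 2 by apply: mulr_ge0; exact: sqr_ge0.
rewrite normrM [X in _ * X]ger0_norm// ler_wpM2r//.
rewrite normrM [`|u - t|]distrC ler_wpM2l//.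
rewrite ger0_norm ?addr_ge0 ?(ltW t0) ?(ltW u0)//.
have -> : 3 * u = u + 2 * u by ring.
by rewrite lerD2l.
Qed.
End Kernel.
Variables (F w : R -> R) (MF B r beta : R).
Hypothesis bF : bb F.
Hypothesis FM : forall t, `|F t| <= MF.
Hypothesis w_gt0 : forall d : R, 0 < d -> (0 : R) < w d.
Hypothesis w_sub : forall d e : R, 0 < d -> 0 < e -> w (d + e) <= w d + w e.
Hypothesis r1 : (1 : R) < r.
Hypothesis r2 : r <= 2.
Hypothesis B0 : (0 : R) <= B.
Hypothesis F_diffp : forall g d : R, 0 < g -> 0 < d -> itg 0 d (fun t => `|F t - F (t + g)| `^ r) <= B * d * w g `^ r.
Hypothesis F_diffm : forall g d : R, 0 < g -> 0 < d -> itg 0 d (fun t => `|F t - F (t - g)| `^ r) <= B * d * w g `^ r.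
Hypothesis F_mean : forall d : R, 0 < d -> itg 0 d (fun t => `|F t| `^ r) <= B * d * w d `^ r.
Hypothesis beta0 : (0 : R) < beta.

Section SecDiff.
Variable s : R -> R.
Hypothesis bs : bb s.
Hypothesis s2 : forall t, `|s t| <= 2.
Hypothesis s_lip : forall t u, `|s t - s u| <= beta * `|t - u|.
Hypothesis s0 : s 0 = 0.

Local Notation K := (ker s).

Definition trunc_ker eta T t : R := F t * K eta t * \1_`]eta, T[ t.
(** The second difference that [shift_average] produces. It is estimated apart on
    [0, 2 eta], [2 eta, P], [P, T - 2 eta] and [T - 2 eta, T + eta], where P is a period
    of the waves. *)
Definition sec_diff eta T t : R := 2 * trunc_ker eta T t - trunc_ker eta T (t - eta) - trunc_ker eta T (t + eta).

Lemma bb_trunc_ker eta T : 0 < eta -> bb (trunc_ker eta T).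
Proof. by move=> e0; apply: bbM; [apply: bbM => //; exact: bb_ker|exact: bb_indic]. Qed.

Lemma bb_sec_diff eta T : 0 < eta -> bb (sec_diff eta T).
Proof.
move=> e0; have ba := bb_trunc_ker T e0.
apply: bbB; [apply: bbB; [by apply: bbM => //; exact: bb_cst|]|]; last exact: bb_shift.
exact: (bb_shift (- eta) ba).
Qed.

Lemma trunc_kerE eta T t : eta < t < T -> trunc_ker eta T t = F t * K eta t.
Proof. by move=> h; rewrite /trunc_ker indicE mem_set ?mulr1//= in_itv. Qed.

Lemma trunc_ker_lo eta T t : t <= eta -> trunc_ker eta T t = 0.
Proof.
move=> h; rewrite /trunc_ker indicE memNset ?mulr0//= in_itv/=.
by apply/negP; rewrite negb_and -leNgt h.
Qed.

Lemma trunc_ker_hi eta T t : T <= t -> trunc_ker eta T t = 0.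
Proof.
move=> h; rewrite /trunc_ker indicE memNset ?mulr0//= in_itv/=.
by apply/negP; rewrite negb_and -!leNgt h orbT.
Qed.

Lemma trunc_ker_le eta T t : `|trunc_ker eta T t| <= `|F t| * `|K eta t|.
Proof.
rewrite /trunc_ker !normrM ler_piMr ?mulr_ge0// indicE.
by case: (_ \in _); rewrite ?normr0 ?normr1.
Qed.

Let MF0 : 0 <= MF. Proof. exact: le_trans (FM 0). Qed.
Let b0 := ltW beta0.

(** Each difference of products is split as (F - F') K' + F (K - K'): one part carries
    an increment of F, the other gains a factor eta / t from the smoothness of K. *)
Lemma sec_diff_bound eta T t k : 0 < eta -> 2 * eta < t -> t < T - eta ->
  `|K eta (t - eta)| <= k -> `|K eta (t + eta)| <= k ->
  `|sec_diff eta T t| <= k * (`|F t - F (t - eta)| + `|F t - F (t + eta)|) + 8 * beta * eta * (`|F t| * t^-1 ^+ 2).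
Proof.
move=> e0 te tT k1 k2.
have h1 : eta < t - eta by rewrite ltrBrDr -mulr2n -mulr_natl.
have h2 : t < T by rewrite (lt_trans tT)// ltrBlDr ltrDl.
have h3 : eta < t by rewrite (lt_trans h1)// ltrBlDr ltrDl.
have h4 : t + eta < T by rewrite -ltrBrDr.
have h5 : t < t + eta by rewrite ltrDl.
have h6 : t - eta < t by rewrite ltrBlDr ltrDl.
rewrite /sec_diff !trunc_kerE ?h3 ?h1 ?h2 ?h4 ?(lt_trans h3 h5) ?(lt_trans h6 h2)//.
have d1 : `|K eta t - K eta (t - eta)| <= 4 * beta * eta * t^-1 ^+ 2.
  have -> : 4 * beta * eta * t^-1 ^+ 2 = 4 * beta * `|t - (t - eta)| * t^-1 ^+ 2.
    by rewrite opprB addrC subrK (gtr0_norm e0).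
  apply: (ker_diff s_lip s0 e0 (ltW h3) (ltW h1)).
  by move: te; rewrite mulrBr mulr2n !mulrDl !mul1r => te; rewrite lerBrDr lerD2l ltW.
have d2 : `|K eta t - K eta (t + eta)| <= 4 * beta * eta * t^-1 ^+ 2.
  have -> : 4 * beta * eta * t^-1 ^+ 2 = 4 * beta * `|t - (t + eta)| * t^-1 ^+ 2.
    by rewrite opprD addrA subrr sub0r normrN (gtr0_norm e0).
  apply: (ker_diff s_lip s0 e0 (ltW h3) (ltW (lt_trans h3 h5))).
  have t0 := lt_trans e0 h3.
  apply: (le_trans (ltW h5)); apply: ler_peMl; last by rewrite ler1n.
  exact: ltW (lt_trans t0 h5).
move: k1 k2 d1 d2.
move: (K eta (t - eta)) (K eta t) (K eta (t + eta)) (F t) (F (t - eta)) (F (t + eta)) (t^-1 ^+ 2).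
move=> Km K0 Kp G Gm Gp z k1 k2 d1 d2.
have -> : 2 * (G * K0) - Gm * Km - Gp * Kp =
   (G - Gm) * Km + (G - Gp) * Kp + (G * (K0 - Km) + G * (K0 - Kp)) by ring.
have -> : k * (`|G - Gm| + `|G - Gp|) + 8 * beta * eta * (`|G| * z) =
  (`|G - Gm| * k + `|G - Gp| * k) + (`|G| * (4 * beta * eta * z) + `|G| * (4 * beta * eta * z)) by ring.
apply: (le_trans (ler_normD _ _)); apply: lerD; apply: (le_trans (ler_normD _ _)); apply: lerD;
  by rewrite normrM ler_wpM2l.
Qed.

Local Notation W1 := (1 + B).
Let W10 : 0 <= W1. Proof. by rewrite addr_ge0. Qed.

Let bdp g : bb (fun t => F t - F (t + g)). Proof. by apply: bbB => //; exact: bb_shift. Qed.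
Let bdm g : bb (fun t => F t - F (t - g)). Proof. by apply: bbB => //; exact: (bb_shift (- g)). Qed.

Lemma L1_diffp g d : 0 < g -> 0 < d -> itg 0 d (fun t => `|F t - F (t + g)|) <= W1 * w g * d.
Proof. by move=> g0 d0; apply: (mean_L1 (bdp g) r1 d0 (w_gt0 g0)); exact: F_diffp. Qed.
Lemma L1_diffm g d : 0 < g -> 0 < d -> itg 0 d (fun t => `|F t - F (t - g)|) <= W1 * w g * d.
Proof. by move=> g0 d0; apply: (mean_L1 (bdm g) r1 d0 (w_gt0 g0)); exact: F_diffm. Qed.
Lemma L1_mean d : 0 < d -> itg 0 d (fun t => `|F t|) <= W1 * w d * d.
Proof. by move=> d0; apply: (mean_L1 bF r1 d0 (w_gt0 d0)); exact: F_mean. Qed.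

(** Near the origin no cancellation is used: F is of order w eta in mean over [0, 3 eta]
    and the kernel is at most beta / eta there. *)
Lemma region_near eta T e : 0 < eta -> bb e -> (forall t, `|e t| <= 1) ->
  `|itg 0 (2 * eta) (fun t => sec_diff eta T t * e t)| <= 36 * beta * W1 * w eta.
Proof.
move=> e0 be e1; have ba := bb_trunc_ker T e0.
have bna := bb_norm ba.
have bh := bb_sec_diff T e0.
have e3 : 0 < 3 * eta by rewrite mulr_gt0.
pose X := itg (- eta) (3 * eta) (fun t => `|trunc_ker eta T t|).
have XB : X <= 9 * beta * W1 * w eta.
  have h1 : - eta <= eta by rewrite (ge0_cp (ltW e0)).
  have h2 : eta <= 3 * eta by rewrite ler_peMl ?(ltW e0)// ler1n.
  rewrite /X (itg_cat bna h1 h2) [X in X + _](_ : _ = 0) ?add0r; last first.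
    rewrite -[RHS](itg0 (- eta) eta); apply: eq_itg => t /andP[_ te].
    by rewrite trunc_ker_lo// normr0.
  have bnF := bb_norm bF.
  apply: (@le_trans _ _ (itg eta (3 * eta) (fun t => beta / eta * `|F t|))).
    apply: le_itg => //; first by apply: bbM => //; exact: bb_cst.
    move=> t /andP[te _]; rewrite (le_trans (trunc_ker_le _ _ _))// mulrC ler_wpM2r//.
    rewrite (le_trans (ker_le1 s_lip s0 e0 te))// ler_wpM2l//.
    by rewrite lef_pV2 ?posrE// (lt_le_trans e0).
  rewrite itgZ//.
  have h3 : itg eta (3 * eta) (fun t => `|F t|) <= W1 * w (3 * eta) * (3 * eta).
    by apply: (le_trans _ (L1_mean e3)); apply: itg_mono => //; exact: ltW.
  have h4 := modulus_mul w_sub 2 e0.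
  have be0 : 0 <= beta / eta by rewrite divr_ge0// ltW.
  apply: (le_trans (ler_wpM2l be0 h3)).
  have -> : beta / eta * (W1 * w (3 * eta) * (3 * eta)) = 3 * beta * W1 * w (3 * eta).
    by move: W1 (w _) => x y; field; rewrite gt_eqF.
  have -> : 9 * beta * W1 * w eta = 3 * beta * W1 * (3 * w eta).
    by move: W1 (w _) => x y; ring.
  by rewrite ler_wpM2l ?mulr_ge0.
have shiftX c : - eta <= c -> 2 * eta + c <= 3 * eta -> itg 0 (2 * eta) (fun t => `|trunc_ker eta T (t + c)|) <= X.
  move=> c1 c2; rewrite (itg_shift _ _ _ bna) add0r.
  by apply: itg_mono.
apply: (le_trans (itg_norm _ _ (bbM bh be))).
pose a := trunc_ker eta T.
have bs1 : bb (fun t => `|a (t + - eta)|) by apply: bb_norm; exact: bb_shift.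
have bs2 : bb (fun t => `|a (t + eta)|) by apply: bb_norm; exact: bb_shift.
have bs3 : bb (fun t => 2 * `|a (t + 0)|) by apply: bbM; [exact: bb_cst|apply: bb_norm; exact: bb_shift].
apply: (@le_trans _ _ (itg 0 (2 * eta) (fun t => 2 * `|a (t + 0)| + `|a (t + - eta)| + `|a (t + eta)|))).
  apply: le_itg; [by apply: bb_norm; exact: bbM|by apply: bbD => //; exact: bbD|].
  move=> t _; rewrite normrM (le_trans (ler_piMr _ (e1 t)))// /sec_diff -/a addr0.
  rewrite (le_trans (ler_normB _ _))// lerD2r (le_trans (ler_normB _ _))// lerD2r.
  by rewrite normrM gtr0_norm.
rewrite itgD; [|by apply: bbD|by []].
rewrite itgD// itgZ; last by apply: bb_norm; exact: bb_shift.
have -> : 36 * beta * W1 * w eta = 2 * (9 * beta * W1 * w eta) + 9 * beta * W1 * w eta + 9 * beta * W1 * w eta by ring.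
have ee : 2 * eta + eta = 3 * eta by ring.
apply: lerD; [apply: lerD|].
- rewrite ler_wpM2l// (le_trans _ XB)//; apply: shiftX; first by rewrite oppr_le0 ltW.
  by rewrite addr0 ler_pM2r// ler_nat.
- rewrite (le_trans _ XB)//; apply: shiftX => //.
  by rewrite -ee lerD2l (ge0_cp (ltW e0)).
- rewrite (le_trans _ XB)//; apply: shiftX; last by rewrite ee.
  by rewrite (ge0_cp (ltW e0)).
Qed.
(** The truncation at T costs nothing in the limit; T is taken large in terms of eta. *)
Lemma region_end eta T e : 0 < eta -> bb e -> (forall t, `|e t| <= 1) ->
  eta <= T - 3 * eta -> 1 <= T - 3 * eta -> 24 * eta * MF / w eta <= T - 3 * eta ->
  `|itg (T - 2 * eta) (T + eta) (fun t => sec_diff eta T t * e t)| <= w eta.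
Proof.
move=> e0 be e1 T1 T2 T3; have bh := bb_sec_diff T e0; have wp := w_gt0 e0.
set S := T - 3 * eta in T1 T2 T3; have S0 : 0 < S by rewrite (lt_le_trans ltr01).
have aB t : S <= t -> `|trunc_ker eta T t| <= 2 * MF / S.
  move=> St; rewrite (le_trans (trunc_ker_le _ _ _))//.
  apply: (@le_trans _ _ (MF * (2 * t^-1 ^+ 2))).
    by apply: ler_pM => //; apply: (ker_le2 s2 e0); exact: le_trans St.
  rewrite mulrCA -mulrA ler_wpM2l// ler_wpM2l//.
  have t0 : 0 < t := lt_le_trans S0 St.
  apply: (@le_trans _ _ t^-1); last by rewrite lef_pV2 ?posrE.
  by rewrite expr2 ler_piMl ?invr_ge0 ?(ltW t0)// invf_le1// (le_trans T2).
have SE : S = T - 2 * eta - eta by rewrite /S; ring.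
have hB t : T - 2 * eta <= t <= T + eta -> `|sec_diff eta T t * e t| <= 8 * MF / S.
  move=> /andP[t1 _]; rewrite normrM (le_trans (ler_piMr _ (e1 t)))// /sec_diff.
  have -> : 8 * MF / S = 2 * (2 * MF / S) + 2 * MF / S + 2 * MF / S by move: S^-1 => y; ring.
  have St : S <= t - eta by rewrite SE lerD2r.
  have tt : t - eta <= t by rewrite lerBlDr lerDl ltW.
  have tt2 : t <= t + eta by rewrite lerDl ltW.
  rewrite (le_trans (ler_normB _ _))// lerD//; last by rewrite aB// (le_trans St)// (le_trans tt).
  rewrite (le_trans (ler_normB _ _))// lerD//; last by rewrite aB.
  by rewrite normrM gtr0_norm// ler_wpM2l// aB// (le_trans St).
have le1 : T - 2 * eta <= T + eta.
  by rewrite lerD2l (@le_trans _ _ 0)// ?(ltW e0)// oppr_le0 mulr_ge0// ltW.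
apply: (le_trans (itg_bound (bbM bh be) le1 hB)).
have -> : 8 * MF / S * (T + eta - (T - 2 * eta)) = 24 * eta * MF / S.
  by move: S^-1 => y; ring.
by move: T3; rewrite !ler_pdivrMr// [w eta * S]mulrC.
Qed.

(** Beyond one period the weight t^-2 is integrable and the mean increments suffice. *)
Lemma region_far eta T P e : 0 < eta -> bb e -> (forall t, `|e t| <= 1) -> 2 * eta < P -> P <= T - 2 * eta ->
  `|itg P (T - 2 * eta) (fun t => sec_diff eta T t * e t)| <= 64 * W1 * w eta / P + 32 * beta * eta * MF / P.
Proof.
move=> e0 be e1 eP PT; have bh := bb_sec_diff T e0; have wp := w_gt0 e0.
have P0 : 0 < P by rewrite (lt_trans _ eP)// mulr_gt0.
have bw : bb (fun t => (Num.max P t)^-1 ^+ 2) by apply: bbX; exact: bb_maxV.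
pose D1 t := `|F t - F (t - eta)|; pose D2 t := `|F t - F (t + eta)|.
have bD1 : bb D1 by apply: bb_norm; exact: bdm.
have bD2 : bb D2 by apply: bb_norm; exact: bdp.
have bnF := bb_norm bF.
have c8 : bb (fun t => 8 * (D1 t * (Num.max P t)^-1 ^+ 2)) by apply: bbM; [exact: bb_cst|exact: bbM].
have c9 : bb (fun t => 8 * (D2 t * (Num.max P t)^-1 ^+ 2)) by apply: bbM; [exact: bb_cst|exact: bbM].
have c10 : bb (fun t => 8 * beta * eta * (`|F t| * (Num.max P t)^-1 ^+ 2)).
  by apply: bbM; [exact: bb_cst|exact: bbM].
apply: (le_trans (itg_norm _ _ (bbM bh be))).
apply: (@le_trans _ _ (itg P (T - 2 * eta) (fun t => 8 * (D1 t * (Num.max P t)^-1 ^+ 2) +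
   8 * (D2 t * (Num.max P t)^-1 ^+ 2) + 8 * beta * eta * (`|F t| * (Num.max P t)^-1 ^+ 2)))).
  apply: le_itg; [by apply: bb_norm; exact: bbM|by apply: bbD => //; exact: bbD|].
  move=> t /andP[Pt tT]; rewrite normrM (le_trans (ler_piMr _ (e1 t)))// max_r//.
  have t0 : 0 < t := lt_le_trans P0 Pt.
  have te : 2 * eta < t := lt_le_trans eP Pt.
  have h1 : eta < t - eta by rewrite ltrBrDr -mulr2n -mulr_natl.
  have h2 : t / 2 <= t - eta.
    have h : eta <= t / 2 by rewrite ler_pdivlMr// mulrC ltW.
    by rewrite lerBrDr -lerBrDl (_ : t - t / 2 = t / 2)//; field.
  have h3 : t / 2 <= t + eta by rewrite (le_trans h2)// lerD2l (ge0_cp (ltW e0)).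
  have h4 : eta < t + eta by rewrite ltrDr.
  have t20 : 0 < t / 2 by rewrite divr_gt0.
  have kB u : eta < u -> t / 2 <= u -> `|K eta u| <= 8 * t^-1 ^+ 2.
    move=> eu tu; rewrite (le_trans (ker_le2 s2 e0 (ltW eu)))//.
    have -> : 8 * t^-1 ^+ 2 = 2 * (t / 2)^-1 ^+ 2 by field; rewrite gt_eqF.
    have u0 : 0 < u := lt_le_trans t20 tu.
    by rewrite ler_wpM2l// lerXn2r ?nnegrE ?invr_ge0 ?(ltW t20) ?(ltW u0)// lef_pV2 ?posrE.
  have tT2 : t < T - eta.
    by rewrite (le_lt_trans tT)// ltrD2l ltrN2 mulr_natl mulr2n ltrDl.
  apply: (le_trans (sec_diff_bound e0 te tT2 (kB _ h1 h2) (kB _ h4 h3))).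
  rewrite /D1 /D2 lerD2r le_eqVlt; apply/orP; left; apply/eqP.
  by move: (t^-1 ^+ 2) => y; ring.
rewrite itgD; [|by apply: bbD|by []].
rewrite itgD// !itgZ; [|exact: bbM..].
have w0 : 0 <= W1 * w eta by rewrite mulr_ge0// ltW.
have i1 : itg P (T - 2 * eta) (fun t => D1 t * (Num.max P t)^-1 ^+ 2) <= 4 * (W1 * w eta) / P.
  by apply: itg_sqr_tail => // [t|d d0]; [exact: normr_ge0|exact: L1_diffm].
have i2 : itg P (T - 2 * eta) (fun t => D2 t * (Num.max P t)^-1 ^+ 2) <= 4 * (W1 * w eta) / P.
  by apply: itg_sqr_tail => // [t|d d0]; [exact: normr_ge0|exact: L1_diffp].
have i3 : itg P (T - 2 * eta) (fun t => `|F t| * (Num.max P t)^-1 ^+ 2) <= 4 * MF / P.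
  apply: itg_sqr_tail => // d d0.
  apply: (le_trans (ler_norm _)); rewrite -[d in leRHS]subr0; apply: itg_bound => //; first exact: ltW.
  by move=> t _; rewrite normr_id.
have -> : 64 * W1 * w eta / P + 32 * beta * eta * MF / P =
  8 * (4 * (W1 * w eta) / P) + 8 * (4 * (W1 * w eta) / P) + 8 * beta * eta * (4 * MF / P).
  by move: P^-1 => y; ring.
by rewrite lerD ?lerD ?ler_wpM2l// !mulr_ge0// ltW.
Qed.
(** On the i-th dyadic interval, [sec_diff_bound] and the subadditivity of w show that
    the normalised second difference satisfies the hypothesis of [dyadic_wave_bound];
    from one interval to the next, t^-r loses a factor 2^r and the length gains a factor 2,
    whence 2^(1-r). *)
Lemma region_bulk (Q : nat) : (2 <= Q)%N -> exists2 C : R, 0 <= C & forall (eta T phi : R) (m : nat),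
  0 < eta -> (0 < m)%N -> 2 * pi / beta = 4 * m%:R * eta -> 2 * pi / beta <= T - 2 * eta ->
  \sum_(k < m) `|itg (2 * eta) (2 * pi / beta) (fun t => sec_diff eta T t * wave beta phi (m + k) t)| ^+ Q
    <= C * m%:R * w eta ^+ Q.
Proof.
move=> Q2; pose A := (8 * beta) `^ r * 3 `^ r * (2 * B * (2 + 2 `^ r)).
have r0 : 0 <= r by rewrite (le_trans ler01)// ltW.
have rn0 : r != 0 by rewrite gt_eqF// (lt_trans ltr01).
have A0 : 0 <= A.
  apply: mulr_ge0; first by rewrite mulr_ge0// powR_ge0.
  by rewrite mulr_ge0 ?mulr_ge0// addr_ge0// powR_ge0.
have [C C0 hC] := dyadic_wave_bound r1 r2 A0 Q2.
exists C => // eta T phi m e0 m0; set P := 2 * pi / beta => PE PT.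
have W0 := w_gt0 e0; set W := w eta in W0 *.
have mR : 1 <= m%:R :> R by rewrite ler1n.
have eP2 : 2 * eta < P.
  rewrite PE ltr_pM2r// (@lt_le_trans _ _ (4 * 1))//; first by rewrite mulr1 ltr_nat.
  by rewrite ler_wpM2l.
have bh := bb_sec_diff T e0.
have bi : bb (\1_`]2 * eta, P[ : R -> R) by exact: bb_indic.
pose b t := eta / W * (sec_diff eta T t * \1_`]2 * eta, P[ t).
have bbb : bb b by apply: bbM; [exact: bb_cst|exact: bbM].
have P0 : 0 < P by rewrite (lt_trans _ eP2)// mulr_gt0.
have eP : 2 * eta <= P := ltW eP2.
have b_lo t : t <= 2 * eta -> b t = 0.
  move=> h; rewrite /b indicE memNset ?mulr0//= in_itv/=.
  by apply/negP; rewrite negb_and -leNgt h.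
have b_hi t : P <= t -> b t = 0.
  move=> h; rewrite /b indicE memNset ?mulr0//= in_itv/=.
  by apply/negP; rewrite negb_and -!leNgt h orbT.
have b_lo' t : t <= eta -> b t = 0.
  by move=> h; apply: b_lo; rewrite (le_trans h)// ler_peMl ?(ltW e0)// ler1n.
have bE k : itg (2 * eta) P (fun t => sec_diff eta T t * wave beta phi (m + k) t) =
    W / eta * itg 0 P (fun t => b t * wave beta phi (m + k) t).
  have be : bb (wave beta phi (m + k)) by exact: bb_wave.
  have -> : itg 0 P (fun t => b t * wave beta phi (m + k) t) = itg (2 * eta) P (fun t => b t * wave beta phi (m + k) t).
    apply: itg_supp => //; [exact: bbM|by rewrite mulr_ge0// ltW|..].
      by move=> t /b_lo ->; rewrite mul0r.
    by move=> t /b_hi ->; rewrite mul0r.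
  rewrite -itgZ; last exact: bbM.
  rewrite -(itg_open (bbM bh be) eP); apply: eq_itg => t _; rewrite /b.
  by move: (\1__ t) => z; field; rewrite !gt_eqF.
have hb i : itg (2 ^+ i * eta) (2 ^+ i.+1 * eta) (fun t => `|b t| `^ r) <= A * eta * (2 `^ (1 - r)) ^+ i.
  set d := 2 ^+ i.+1 * eta; pose y : R := 2 ^- i.
  have p2 : 0 < (2 : R) ^+ i by rewrite exprn_gt0.
  have y0 : 0 < y by rewrite invr_gt0.
  have d0 : 0 < d by rewrite mulr_gt0// exprn_gt0.
  pose D1 t := `|F t - F (t - eta)| `^ r; pose D2 t := `|F t - F (t + eta)| `^ r.
  pose D3 t := `|F t| `^ r.
  have bD1 : bb D1 by apply: bb_powR => //; exact: bdm.
  have bD2 : bb D2 by apply: bb_powR => //; exact: bdp.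
  have bD3 : bb D3 by exact: bb_powR.
  pose c1 := (8 * beta * y / W) `^ r * 3 `^ r.
  have c10 : 0 <= c1 by rewrite mulr_ge0// powR_ge0.
  have bD4 : bb (fun t => y `^ r * D3 t) by apply: bbM => //; exact: bb_cst.
  have bD5 : bb (fun t => D1 t + D2 t + y `^ r * D3 t) by apply: bbD => //; exact: bbD.
  apply: (@le_trans _ _ (itg (2 ^+ i * eta) d (fun t => c1 * (D1 t + D2 t + y `^ r * D3 t)))).
    apply: le_itg; [exact: bb_powR|by apply: bbM => //; exact: bb_cst|].
    move=> t /andP[t1 _].
    have sum0 : 0 <= D1 t + D2 t + y `^ r * D3 t.
      by rewrite !addr_ge0 ?mulr_ge0// powR_ge0.
    have [th|th] := leP t (2 * eta).
      by rewrite b_lo// normr0 powR0//; exact: mulr_ge0.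
    have [th2|th2] := leP P t.
      by rewrite b_hi// normr0 powR0//; exact: mulr_ge0.
    have ty : t^-1 <= y / eta.
      rewrite -invfM lef_pV2 ?posrE//; last by rewrite mulr_gt0.
      by rewrite (lt_trans _ th)// mulr_gt0.
    have t0 : 0 < t by rewrite (lt_trans _ th)// mulr_gt0.
    have h1 : eta < t - eta by rewrite ltrBrDr -mulr2n -mulr_natl.
    have h2 : t / 2 <= t - eta.
      have h : eta <= t / 2 by rewrite ler_pdivlMr// mulrC ltW.
      by rewrite lerBrDr -lerBrDl (_ : t - t / 2 = t / 2)//; field.
    have h3 : t / 2 <= t + eta by rewrite (le_trans h2)// lerD2l (ge0_cp (ltW e0)).
    have h4 : eta < t + eta by rewrite ltrDr.
    have t20 : 0 < t / 2 by rewrite divr_gt0.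
    have kB u : eta < u -> t / 2 <= u -> `|K eta u| <= 2 * beta * (y / eta).
      move=> eu tu; rewrite (le_trans (ker_le1 s_lip s0 e0 (ltW eu)))//.
      apply: (@le_trans _ _ (2 * beta * t^-1)); last by rewrite ler_wpM2l// mulr_ge0.
      have -> : 2 * beta * t^-1 = beta * (t / 2)^-1 by field; rewrite gt_eqF.
      by rewrite ler_wpM2l// lef_pV2 ?posrE// (lt_le_trans t20).
    have tT2 : t < T - eta.
      rewrite (lt_le_trans th2)// (le_trans PT)// lerD2l lerN2 ler_peMl ?ler1n//.
      exact: ltW.
    have key : `|b t| <= 8 * beta * y / W * (`|F t - F (t - eta)| + `|F t - F (t + eta)| + y * `|F t|).
      have q0 : 0 <= eta / W by rewrite divr_ge0// ltW.
      rewrite /b normrM (ger0_norm q0).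
      apply: (@le_trans _ _ (eta / W * `|sec_diff eta T t|)).
        rewrite ler_wpM2l// normrM ler_piMr// indicE.
        by case: (_ \in _); rewrite ?normr0 ?normr1.
      apply: (le_trans (ler_wpM2l q0 (sec_diff_bound e0 th tT2 (kB _ h1 h2) (kB _ h4 h3)))).
      have -> : 8 * beta * y / W * (`|F t - F (t - eta)| + `|F t - F (t + eta)| + y * `|F t|) =
         eta / W * (8 * beta * (y / eta) * (`|F t - F (t - eta)| + `|F t - F (t + eta)|) +
           8 * beta * eta * (`|F t| * (y / eta) ^+ 2)).
        by clearbody y; move: `|_| `|_| `|_| => z1 z2 z3; field; rewrite !gt_eqF.
      rewrite ler_wpM2l// lerD//.
        rewrite ler_wpM2r ?addr_ge0// ler_wpM2r ?divr_ge0 ?(ltW y0) ?(ltW e0)//.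
        by rewrite ler_wpM2r// ler_nat.
      rewrite ler_wpM2l ?mulr_ge0 ?(ltW e0)// ler_wpM2l//.
      by rewrite lerXn2r ?nnegrE ?invr_ge0 ?divr_ge0 ?(ltW y0) ?(ltW e0) ?(ltW t0).
    have q0 : 0 <= 8 * beta * y / W by rewrite divr_ge0 ?(ltW W0)// !mulr_ge0 ?(ltW y0).
    have y3 : 0 <= y * `|F t| by rewrite mulr_ge0// ltW.
    apply: (@le_trans _ _ ((8 * beta * y / W * (`|F t - F (t - eta)| + `|F t - F (t + eta)| + y * `|F t|)) `^ r)).
      by apply: ge0_ler_powR; rewrite ?nnegrE// mulr_ge0// !addr_ge0.
    rewrite powRM ?addr_ge0// /c1 -[leRHS]mulrA ler_wpM2l ?powR_ge0//.
    apply: (le_trans (powR_add3 r0 (normr_ge0 _) (normr_ge0 _) y3)).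
    by rewrite [(y * _) `^ r]powRM// ltW.
  rewrite itgZ//.
  have d1 : 2 ^+ i * eta <= d by rewrite ler_pM2r// exprS ler_peMl ?(ltW p2)// ler1n.
  have lo0 : 0 <= 2 ^+ i * eta by rewrite mulr_ge0// ltW.
  have mono u : bb u -> (forall t, 0 <= u t) -> itg (2 ^+ i * eta) d u <= itg 0 d u.
    by move=> bu u0; apply: itg_mono.
  rewrite itgD; [|exact: bbD|exact: bD4].
  rewrite itgD// itgZ//.
  have i1 : itg (2 ^+ i * eta) d D1 <= B * d * W `^ r.
    by apply: (le_trans (mono _ bD1 _)) => [t|]; [exact: powR_ge0|exact: F_diffm].
  have i2 : itg (2 ^+ i * eta) d D2 <= B * d * W `^ r.
    by apply: (le_trans (mono _ bD2 _)) => [t|]; [exact: powR_ge0|exact: F_diffp].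
  have wd : w d <= 2 / y * W.
    have h := modulus_mul w_sub (2 ^ i.+1).-1 e0.
    rewrite prednK ?expn_gt0// natrX in h.
    by rewrite /y invrK -exprS.
  have i3 : y `^ r * itg (2 ^+ i * eta) d D3 <= B * d * W `^ r * 2 `^ r.
    have h : itg (2 ^+ i * eta) d D3 <= B * d * (2 / y * W) `^ r.
      apply: (le_trans (mono _ bD3 _)) => [t|]; first exact: powR_ge0.
      apply: (le_trans (F_mean d0)); apply: ler_wpM2l; first by rewrite mulr_ge0// ltW.
      by apply: ge0_ler_powR; rewrite ?nnegrE ?mulr_ge0 ?invr_ge0 ?(ltW y0) ?(ltW W0) ?(ltW (w_gt0 d0)).
    apply: (le_trans (ler_wpM2l (powR_ge0 _ _) h)).
    have -> : y `^ r * (B * d * (2 / y * W) `^ r) = B * d * (y `^ r * (2 / y * W) `^ r) by ring.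
    rewrite -powRM ?(ltW y0)//; last by rewrite !mulr_ge0 ?invr_ge0 ?ltW.
    have -> : y * (2 / y * W) = W * 2 by field; rewrite gt_eqF.
    by rewrite powRM ?(ltW W0)// mulrA.
  apply: (le_trans (ler_wpM2l c10 (lerD (lerD i1 i2) i3))).
  have Wr : 0 < W `^ r by rewrite powR_gt0.
  have yr : y `^ r = (2 `^ (1 - r)) ^+ i * y.
    have -> : (2 `^ (1 - r)) ^+ i = y `^ (r - 1).
      rewrite /y -(powR_mulrn _ (powR_ge0 _ _)) -powRrM -(powR_invn i (ler0n R 2)) -powRrM.
      by congr (_ `^ _); ring.
    by rewrite -[X in _ * X]powRr1 ?(ltW y0)// -powRD ?subrK//; apply/implyP => _; rewrite gt_eqF.
  have c1E : c1 = (8 * beta) `^ r * 3 `^ r * ((2 `^ (1 - r)) ^+ i * y) / W `^ r.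
    have bW : 0 <= 8 * beta by rewrite mulr_ge0.
    rewrite /c1 [(_ / W) `^ r]powRM ?invr_ge0 ?(ltW W0) ?mulr_ge0 ?(ltW y0)//.
    rewrite [(_ * y) `^ r]powRM ?(ltW y0)// yr -powR_inv1 ?(ltW W0)// -powRrM mulN1r powRN.
    by move: (_ `^ r)^-1 => z; ring.
  rewrite c1E /A le_eqVlt; apply/orP; left; apply/eqP.
  have -> : d = 2 / y * eta by rewrite /y invrK -exprS.
  move: Wr y0; clearbody y; move: (_ `^ r) (_ `^ r) (_ `^ r) (_ `^ r) (_ ^+ i) => z1 z2 z3 z4 z5 h1 h2.
  by field; rewrite !gt_eqF.
have := hC beta phi eta m b beta0 e0 m0 PE bbb b_lo' b_hi hb.
rewrite -/P => h.
apply: (@le_trans _ _ (\sum_(k < m) (W / eta) ^+ Q * `|itg 0 P (fun t => b t * wave beta phi (m + k) t)| ^+ Q)).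
  apply: ler_sum => k _; rewrite bE normrM exprMn.
  by rewrite [`|W / eta|]ger0_norm// divr_ge0// ltW.
rewrite -mulr_sumr; have q0 : 0 <= (W / eta) ^+ Q by rewrite exprn_ge0// divr_ge0// ltW.
apply: (le_trans (ler_wpM2l q0 h)); rewrite mulrCA -exprMn divfK// gt_eqF//.
Qed.
Lemma exprn_add3 (n : nat) (x y z : R) : 0 <= x -> 0 <= y -> 0 <= z ->
  (x + y + z) ^+ n <= 3 ^+ n * (x ^+ n + y ^+ n + z ^+ n).
Proof.
move=> x0 y0 z0; have := powR_add3 (ler0n R n) x0 y0 z0.
by rewrite !powR_mulrn// ?addr_ge0.
Qed.

Lemma wave_block (Q : nat) : (2 <= Q)%N -> exists2 C : R, 0 <= C & forall (phi : R) (m : nat), (0 < m)%N ->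
  exists T0, forall T, T0 <= T ->
    \sum_(k < m) `|itg (pi / (2 * beta * m%:R)) T
       (fun t => F t * K (pi / (2 * beta * m%:R)) t * wave beta phi (m + k) t)| ^+ Q
    <= C * m%:R * w (pi / (2 * beta * m%:R)) ^+ Q.
Proof.
move=> Q2; have [Cb Cb0 hCb] := region_bulk Q2.
have aux (p e z u : R) : 0 < p -> 0 < e -> 0 <= z -> p + 3 * e + 1 + e + z <= u ->
    p <= u - 2 * e /\ e <= u - 3 * e /\ 1 <= u - 3 * e /\ z <= u - 3 * e /\ e <= u /\ 2 * e <= u + e.
  by move=> h1 h2 h3 h4; do 5 (split; first lra); lra.
pose P : R := 2 * pi / beta.
pose e1 : R := pi / (2 * beta).
have pi0 := @pi_gt0 R.
have e10 : 0 < e1 by rewrite divr_gt0// mulr_gt0.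
have w1 := w_gt0 e10.
have P0 : 0 < P by rewrite divr_gt0// mulr_gt0.
pose Cr := 36 * beta * W1 + 64 * W1 / P + 32 * beta * (e1 / w e1) * MF / P + 1.
have Cr0 : 0 <= Cr.
  by repeat first [exact: MF0 | exact: W10 | by [] | exact: ltW | (rewrite invr_ge0; exact: ltW)
    | apply: addr_ge0 | apply: mulr_ge0].
exists (3 ^+ Q * (Cb + Cr ^+ Q)).
  by rewrite mulr_ge0 ?exprn_ge0// addr_ge0// exprn_ge0.
move=> phi m m0; set eta := pi / (2 * beta * m%:R).
have mR : 0 < m%:R :> R by rewrite ltr0n.
have mR1 : 1 <= m%:R :> R by rewrite ler1n.
have e0 : 0 < eta by rewrite divr_gt0// !mulr_gt0.
have W0 := w_gt0 e0.
have PE : 2 * pi / beta = 4 * m%:R * eta.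
  by rewrite /eta; move: pi0; move: pi => p p0; field; rewrite !gt_eqF.
have etaE : eta = e1 / m%:R by rewrite /eta /e1 invfM mulrA.
have elin : eta <= e1 / w e1 * w eta by rewrite etaE; exact: modulus_linear.
have eP : 2 * eta < P.
  rewrite /P PE ltr_pM2r// (@lt_le_trans _ _ (4 * 1))//; first by rewrite mulr1 ltr_nat.
  by rewrite ler_wpM2l.
(* The last summand is the threshold of [region_end]. *)
exists (P + 3 * eta + 1 + eta + 24 * eta * MF / w eta) => T T0.
have q24 : 0 <= 24 * eta * MF / w eta by rewrite divr_ge0 ?(ltW W0)// mulr_ge0// mulr_ge0// ltW.
have [t1 [t2 [t3 [t4 [t5 t6]]]]] : P <= T - 2 * eta /\ eta <= T - 3 * eta /\ 1 <= T - 3 * eta /\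
    24 * eta * MF / w eta <= T - 3 * eta /\ eta <= T /\ 2 * eta <= T + eta.
  exact: aux T0.
have ba := bb_trunc_ker T e0; have bh := bb_sec_diff T e0.
have bulk := hCb eta T phi m e0 m0 PE t1.
pose z k := `|itg (2 * eta) P (fun t => sec_diff eta T t * wave beta phi (m + k) t)|.
apply: (@le_trans _ _ (\sum_(k < m) 3 ^+ Q * (z k ^+ Q + (Cr * w eta) ^+ Q + 0 ^+ Q))).
  apply: ler_sum => k _.
  have be : bb (wave beta phi (m + k)) by exact: bb_wave.
  have e_1 := wave_bound beta phi (m + k).
  have bhe := bbM bh be.
  apply: (@le_trans _ _ ((z k + Cr * w eta + 0) ^+ Q)); last first.
    by apply: exprn_add3; rewrite ?normr_ge0 ?mulr_ge0// ltW.
  rewrite addr0; rewrite lerXn2r ?nnegrE ?addr_ge0 ?mulr_ge0 ?normr_ge0 ?(ltW W0)//.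
  have bFe : bb (fun t => F t * K eta t * wave beta phi (m + k) t).
    by apply: bbM => //; apply: bbM => //; exact: bb_ker.
  have -> : itg eta T (fun t => F t * K eta t * wave beta phi (m + k) t) =
      itg 0 T (fun t => trunc_ker eta T t * wave beta phi (m + k) t).
    rewrite -(itg_open bFe t5) (itg_supp (bbM ba be) (ltW e0) t5 (lexx T)).
    - by apply: eq_itg => t _; rewrite /trunc_ker mulrAC.
    - by move=> t h; rewrite trunc_ker_lo// mul0r.
    - by move=> t h; rewrite trunc_ker_hi// mul0r.
  apply: (le_trans (shift_average phi beta0 ba e0 t5 _ _ m0 (ltn_ord k) erefl)).
  - exact: trunc_ker_lo.
  - exact: trunc_ker_hi.
  rewrite -/(sec_diff eta T).
  have o1 : 0 <= 2 * eta by rewrite mulr_ge0// ltW.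
  have o3 : T - 2 * eta <= T + eta.
    by rewrite lerD2l (@le_trans _ _ 0)// ?(ltW e0)// oppr_le0.
  have o2 : P <= T + eta by exact: le_trans o3.
  change (`|itg 0 (T + eta) (fun t => sec_diff eta T t * wave beta phi (m + k) t)| <= z k + Cr * w eta).
  rewrite (itg_cat bhe o1 t6) (itg_cat bhe (ltW eP) o2) (itg_cat bhe t1 o3).
  have r1' := region_near T e0 be e_1.
  have r3 := region_far e0 be e_1 eP t1.
  have r4 := region_end e0 be e_1 t2 t3 t4.
  have CrE : Cr * w eta = 36 * beta * W1 * w eta + (64 * W1 * w eta / P +
     32 * beta * (e1 / w e1 * w eta) * MF / P) + w eta.
    by rewrite /Cr; move: P^-1 (e1 / w e1) W1 => x1 x2 x3; ring.
  have r3' : 64 * W1 * w eta / P + 32 * beta * eta * MF / P <=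
     64 * W1 * w eta / P + 32 * beta * (e1 / w e1 * w eta) * MF / P.
    rewrite lerD2l; apply: ler_wpM2r; first by rewrite invr_ge0 ltW.
    by apply: ler_wpM2r => //; apply: ler_wpM2l => //; rewrite mulr_ge0.
  have {}r3 := le_trans r3 r3'; rewrite CrE /z.
  move: r1' r3 r4; set i1 := itg 0 (2 * eta) _; set i2 := itg (2 * eta) P _.
  set i3 := itg P _ _; set i4 := itg (T - 2 * eta) _ _ => h1 h3 h4.
  rewrite (_ : i1 + (i2 + (i3 + i4)) = i2 + (i1 + i3 + i4)); last by ring.
  rewrite (le_trans (ler_normD _ _))// lerD2l (le_trans (ler_normD _ _))// lerD//.
  by rewrite (le_trans (ler_normD _ _))// lerD.
rewrite -mulr_sumr -[leRHS]mulrA -[leRHS]mulrA ler_wpM2l ?exprn_ge0//.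
rewrite (eq_bigr (fun k : 'I_m => z k ^+ Q + (Cr * w eta) ^+ Q)); last first.
  by move=> k _; rewrite expr0n gtn_eqF ?(leq_trans _ Q2)// addr0.
rewrite big_split /= sumr_const card_ord [leRHS]mulrDl; apply: lerD.
  by rewrite mulrA.
by rewrite exprMn -[leLHS]mulr_natl mulrCA.
Qed.
End SecDiff.
Local Notation W1 := (1 + B).
Let W10 : 0 <= W1. Proof. by rewrite addr_ge0. Qed.

Let lip_cos t u : `|(1 - cos (beta * t)) - (1 - cos (beta * u))| <= beta * `|t - u|.
Proof.
have -> : 1 - cos (beta * t) - (1 - cos (beta * u)) = cos (beta * u) - cos (beta * t) by ring.
by rewrite (le_trans (cos_lip _ _))// -mulrBr normrM (gtr0_norm beta0) distrC.
Qed.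

Let lip_sin t u : `|sin (beta * t) - sin (beta * u)| <= beta * `|t - u|.
Proof. by rewrite (le_trans (sin_lip _ _))// -mulrBr normrM (gtr0_norm beta0). Qed.

Let two_cos t : `|1 - cos (beta * t)| <= 2.
Proof.
rewrite (le_trans (ler_normB _ _))// normr1 [leRHS](_ : 2 = 1 + 1)// lerD2l.
exact: cos_max.
Qed.

Let two_sin t : `|sin (beta * t)| <= 2.
Proof. by rewrite (le_trans (sin_max _))// ler1n. Qed.

Let bcos : bb (fun t => 1 - cos (beta * t)).
Proof. by apply: bbB; [exact: bb_cst|exact: bb_cosx]. Qed.

Let bsin : bb (fun t => sin (beta * t)).
Proof.
by have := bb_sin beta 0; congr bb; apply/funext => t; rewrite addr0.
Qed.

Lemma trapk_waves (k : nat) t : trapk (k%:R * beta) beta t * t ^+ 2 =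
  (1 - cos (beta * t)) * wave beta 0 k t + sin (beta * t) * wave beta (pi / 2) k t.
Proof.
rewrite trapkE ?mulr_ge0 ?(ltW beta0)// /wave subr0.
rewrite [cos (_ - pi / 2)]cosB cos_pihalf sin_pihalf mulr0 add0r mulr1 mulrDl cosD.
by ring.
Qed.

(** Bounding the two waves separately, 1 - cos (beta t) by (beta t)^2 and the sines by
    their arguments, gives the factor k beta^2; the difference of two Fejer bounds would
    give k^2 beta^2. *)
Lemma trapk_near (k : nat) t : t != 0 -> `|trapk (k%:R * beta) beta t| <= k.+1%:R * beta ^+ 2.
Proof.
move=> t0; have t2 : 0 < t ^+ 2 by rewrite exprn_even_gt0.
rewrite -(ler_pM2r t2) -[X in _ * X <= _](gtr0_norm t2) -normrM trapk_waves.
rewrite (le_trans (ler_normD _ _))// -[leRHS]mulrA [k.+1%:R](_ : _ = 1 + k%:R); last by rewrite addrC natr1.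
rewrite [leRHS]mulrDl mul1r lerD//.
  rewrite normrM; apply: (@le_trans _ _ (beta ^+ 2 * t ^+ 2 * 1)); last by rewrite mulr1.
  apply: ler_pM => //; last exact: wave_bound.
  rewrite -(fejerE _ (ltW beta0)) normrM (gtr0_norm t2) ler_wpM2r ?(ltW t2)//.
  exact: fejer_bound (ltW beta0).
rewrite /wave [cos (_ - pi / 2)]cosB cos_pihalf sin_pihalf mulr0 add0r mulr1 normrM.
have h1 := sin_lip (beta * t) 0; have h2 := sin_lip (k%:R * beta * t) 0.
rewrite sin0 !subr0 in h1 h2.
have -> : k%:R * (beta ^+ 2 * t ^+ 2) = `|beta * t| * `|k%:R * beta * t|.
  rewrite -normrM ger0_norm; first by ring.
  have -> : beta * t * (k%:R * beta * t) = k%:R * beta ^+ 2 * t ^+ 2 by ring.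
  by apply: mulr_ge0; [apply: mulr_ge0 => //|]; exact: sqr_ge0.
by apply: ler_pM.
Qed.

(** In mean over a dyadic block of frequencies, the deviation is at most a multiple of
    w at the scale eta of the block. Near the origin the kernel is bounded by m beta^2
    on an interval of length eta; beyond it [trapk_waves] writes it with a cosine and
    a sine wave. *)
Theorem block_estimate (Q : nat) : (2 <= Q)%N -> exists2 C : R, 0 <= C & forall m : nat, (0 < m)%N ->
  exists T0, forall T, T0 <= T ->
    \sum_(k < m) `|itg 0 T (fun t => F t * trapk ((m + k)%:R * beta) beta t)| ^+ Q
    <= C * m%:R * w (pi / (2 * beta * m%:R)) ^+ Q.
Proof.
move=> Q2.
have c0 : 1 - cos (beta * 0) = 0 :> R by rewrite mulr0 cos0 subrr.
have s00 : sin (beta * 0) = 0 :> R by rewrite mulr0 sin0.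
have [C1 C10 hC1] := wave_block bcos two_cos lip_cos c0 Q2.
have [C2 C20 hC2] := wave_block bsin two_sin lip_sin s00 Q2.
have pi0 := @pi_gt0 R.
pose N : R := pi * beta * W1.
have N0 : 0 <= N by rewrite mulr_ge0// mulr_ge0// ltW.
exists (3 ^+ Q * (N ^+ Q + C1 + C2)).
  by rewrite mulr_ge0 ?exprn_ge0// addr_ge0// addr_ge0// exprn_ge0.
move=> m m0; have [T1 h1] := hC1 0 m m0; have [T2 h2] := hC2 (pi / 2) m m0.
move: h1 h2; set eta := pi / (2 * beta * m%:R) => h1 h2.
have mR : 0 < m%:R :> R by rewrite ltr0n.
have e0 : 0 < eta by rewrite divr_gt0// !mulr_gt0.
have W0 := w_gt0 e0.
exists (Num.max eta (Num.max T1 T2)) => T; rewrite !ge_max => /andP[eT /andP[/h1 {}h1 /h2 {}h2]].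
pose z1 k := itg eta T (fun t => F t * ker (fun t => 1 - cos (beta * t)) eta t * wave beta 0 (m + k) t).
pose z2 k := itg eta T (fun t => F t * ker (fun t => sin (beta * t)) eta t * wave beta (pi / 2) (m + k) t).
apply: (@le_trans _ _ (\sum_(k < m) 3 ^+ Q * ((N * w eta) ^+ Q + `|z1 k| ^+ Q + `|z2 k| ^+ Q))).
  apply: ler_sum => k _.
  apply: (@le_trans _ _ ((N * w eta + `|z1 k| + `|z2 k|) ^+ Q)); last first.
    by apply: exprn_add3; rewrite ?mulr_ge0// ltW.
  have NW : 0 <= N * w eta by apply: mulr_ge0 => //; exact: ltW.
  have NWz : 0 <= N * w eta + `|z1 k| + `|z2 k| by apply: addr_ge0 => //; exact: addr_ge0.
  rewrite lerXn2r ?nnegrE//.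
  pose kap := trapk ((m + k)%:R * beta) beta.
  change (`|itg 0 T (fun t => F t * kap t)| <= N * w eta + `|z1 k| + `|z2 k|).
  have bk : bb kap by apply: bb_trapk => //; rewrite mulr_ge0 ?(ltW beta0).
  have bFk : bb (fun t => F t * kap t) by exact: bbM.
  have bn1 : bb (fun t => `|F t * kap t|) by exact: bb_norm.
  rewrite (itg_cat bFk (ltW e0) eT) -addrA (le_trans (ler_normD _ _))// lerD//.
    rewrite (le_trans (itg_norm _ _ bFk))//.
    have bz : bb (\1_(~` [set 0]) : R -> R) by apply: bb_indic; exact: measurableC.
    rewrite (@eq_itg_nz _ 0 eta _ (fun t => `|F t * kap t| * \1_(~` [set 0]) t)) //; last 2 first.
    - exact: bbM.
    - by move=> t /eqP t0; rewrite indicE mem_set ?mulr1.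
    have c2 : 0 <= 2 * m%:R * beta ^+ 2 by rewrite mulr_ge0// ?sqr_ge0// mulr_ge0.
    apply: (@le_trans _ _ (itg 0 eta (fun t => (2 * m%:R * beta ^+ 2) * `|F t|))).
      apply: le_itg; [exact: bbM|by apply: bbM; [exact: bb_cst|exact: bb_norm]|].
      move=> t _; have [->|t0] := eqVneq t 0.
        rewrite indicE memNset ?mulr0; [exact: mulr_ge0|].
        by move=> /= h; apply: h.
      rewrite indicE mem_set ?mulr1; last by move=> /= /eqP; apply/negP.
      rewrite normrM mulrC ler_wpM2r// (le_trans (trapk_near _ t0))// ler_wpM2r ?sqr_ge0//.
      by rewrite -natrM ler_nat mul2n -addnn -addnS leq_add2l.
    rewrite itgZ; last exact: bb_norm.
    apply: (le_trans (ler_wpM2l c2 (L1_mean e0))).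
    rewrite /N le_eqVlt; apply/orP; left; apply/eqP.
    move: (w eta) W1 => x y; rewrite /eta; move: pi0; move: pi => p p0.
    by field; rewrite !gt_eqF.
  have bK1 := bb_ker bcos e0; have bK2 := bb_ker bsin e0.
  have bw p : bb (wave beta p (m + k)) by exact: bb_wave.
  have -> : itg eta T (fun t => F t * kap t) = z1 k + z2 k.
    rewrite /z1 /z2 -itgD; [|by apply: bbM => //; exact: bbM..].
    apply: eq_itg => t /andP[et _].
    have t0 : 0 < t by exact: lt_le_trans et.
    rewrite !kerE//.
    have -> : kap t = kap t * t ^+ 2 * t^-1 ^+ 2 by field; rewrite gt_eqF.
    by rewrite /kap trapk_waves; ring.
  exact: ler_normD.
rewrite -mulr_sumr -[leRHS]mulrA -[leRHS]mulrA ler_wpM2l ?exprn_ge0//.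
rewrite big_split /= big_split /= sumr_const card_ord.
have -> : (N ^+ Q + C1 + C2) * (m%:R * w eta ^+ Q) =
  m%:R * (N ^+ Q * w eta ^+ Q) + C1 * m%:R * w eta ^+ Q + C2 * m%:R * w eta ^+ Q by ring.
by rewrite -exprMn -[(_ ^+ Q) *+ m]mulr_natl lerD// lerD.
Qed.
End WaveBlock.

(** * From blocks to weighted sums *)

Section Summation.
Context {R : realType}.

(** Summation by parts, as an induction in which the last weight multiplies the whole
    partial sum. *)
Lemma abel_sum (a d : nat -> R) : (forall k, 0 <= a k) -> (forall k, a k.+1 <= a k) ->
  (forall N, 0 <= \sum_(k < N) d k) -> forall N, 0 <= \sum_(k < N) a k * d k.
Proof.
move=> a0 a1 d0 [|N]; first by rewrite big_ord0.
apply: (@le_trans _ _ (a N * \sum_(k < N.+1) d k)); first exact: mulr_ge0.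
elim: N => [|N ih]; first by rewrite !big_ord1.
rewrite big_ord_recr [leRHS]big_ord_recr /= mulrDr lerD2r (le_trans _ ih)//.
by apply: ler_wpM2r => //; exact: d0.
Qed.

(** Halve N: the upper half of the sum is part of the block starting at m, the rounded
    up half of N, and y on [m, N) is at least its value at 2m - 1. *)
Lemma dyadic_partial (x y : nat -> R) (C : R) : 0 <= C -> (forall k, 0 <= x k) ->
  (forall k, 0 <= y k) -> (forall k, y k.+1 <= y k) -> x 0 <= C * y 0 ->
  (forall m, (0 < m)%N -> \sum_(k < m) x (m + k)%N <= C * m%:R * y (2 * m).-1) ->
  forall N, \sum_(k < N) x k <= 2 * C * \sum_(k < N) y k.
Proof.
move=> C0 x0 y0 ymono xy0 hb.
have yle i j : (i <= j)%N -> y j <= y i.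
  elim: j => [|j ih]; first by rewrite leqn0 => /eqP ->.
  by rewrite leq_eqVlt => /predU1P[->//|/ih]; apply: le_trans.
elim/ltn_ind => N ih.
have [N0|N0] := leqP N 1.
  have [->|->] : N = 0%N \/ N = 1%N by move: N N0 {ih} => [|[|]]// _; [left|right].
    by rewrite !big_ord0 mulr0.
  rewrite !big_ord1 (le_trans xy0)// ler_wpM2r// ler_peMl// ler1n//.
pose m := uphalf N; pose h := N./2.
have NE : N = (m + h)%N by rewrite /m /h uphalf_half -addnA addnn odd_double_half.
have mN : (m < N)%N by rewrite NE -addn1 leq_add2l half_gt0.
have mh : (h <= m <= h.*2)%N.
  by rewrite /m /h uphalf_half leq_addl -addnn leq_add2r (leq_trans (leq_b1 _))// half_gt0.
have m0 : (0 < m)%N by rewrite uphalf_gt0 ltnW.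
have split_ (u : nat -> R) : \sum_(k < N) u k = \sum_(k < m) u k + \sum_(k < h) u (m + k)%N.
  by rewrite NE big_split_ord.
rewrite !split_ mulrDr lerD ?ih//.
apply: (@le_trans _ _ (C * m%:R * y (2 * m).-1)).
  apply: le_trans (hb m m0).
  have /subnK <- := (andP mh).1; rewrite addnC big_split_ord /= lerDl.
  by apply: sumr_ge0.
apply: (@le_trans _ _ (2 * C * (h%:R * y (2 * m).-1))).
  rewrite [leRHS](_ : _ = C * (2 * h)%:R * y (2 * m).-1); last by rewrite natrM; ring.
  by rewrite ler_wpM2r// ler_wpM2l// ler_nat mul2n; case/andP: mh.
rewrite ler_wpM2l ?mulr_ge0//.
have -> : h%:R * y (2 * m).-1 = \sum_(k < h) y (2 * m).-1.
  by rewrite sumr_const card_ord mulr_natl.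
apply: ler_sum => k _; apply: yle.
rewrite -ltnS prednK ?muln_gt0// mul2n -addnn ltn_add2l.
by apply: (leq_trans (ltn_ord k)); case/andP: mh.
Qed.

Lemma powR_le_expn (u W q : R) (Q : nat) : 0 <= u -> 0 < W -> 0 < q -> q <= Q%:R ->
  u `^ q <= W `^ q * (1 + (u / W) ^+ Q).
Proof.
move=> u0 W0 q0 qQ; pose z := u / W.
have z0 : 0 <= z by rewrite divr_ge0// ltW.
have -> : u = W * z by rewrite mulrC divfK// gt_eqF.
rewrite powRM ?(ltW W0)// ler_wpM2l ?powR_ge0// [W * z]mulrC mulfK ?gt_eqF//.
have [h|h] := leP z 1.
  apply: (@le_trans _ _ 1); last by rewrite lerDl exprn_ge0.
  have := @ge0_ler_powR R q (ltW q0) z 1; rewrite powR1; apply; rewrite ?nnegrE//.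
rewrite -powR_mulrn//; apply: (@le_trans _ _ (z `^ Q%:R)); last by rewrite lerDr.
by apply: ler_powR => //; exact: ltW.
Qed.

Section Limits.
Variables (w : R -> R) (beta : R).
Hypothesis w_gt0 : forall d : R, 0 < d -> (0 : R) < w d.
Hypothesis w_mono : forall d e : R, 0 < d -> d <= e -> w d <= w e.
Hypothesis w_sub : forall d e : R, 0 < d -> 0 < e -> w (d + e) <= w d + w e.
Hypothesis beta0 : (0 : R) < beta.

(** The truncation error tends to 0, so for large T it is below w at the scale of the
    block, for the m frequencies at once. *)
Lemma block_limit (I : nat -> R -> R) (L : nat -> R) (Q : nat) (C : R) : 0 <= C ->
  (forall m, (0 < m)%N -> exists T0, forall T, T0 <= T ->
     \sum_(k < m) `|I (m + k)%N T| ^+ Q <= C * m%:R * w (pi / (2 * beta * m%:R)) ^+ Q) ->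
  (forall k, exists c, forall T, 0 < T -> `|I k T - L k| <= c / T) ->
  forall m, (0 < m)%N -> \sum_(k < m) `|L (m + k)%N| ^+ Q <=
    2 ^+ Q * (C + 1) * m%:R * w (pi / (2 * beta * m%:R)) ^+ Q.
Proof.
move=> C0 hI hL m m0; have [T0 hT0] := hI m m0.
set W := w _ in hT0 *.
have mR : 0 < m%:R :> R by rewrite ltr0n.
have W0 : 0 < W by apply: w_gt0; rewrite divr_gt0 ?pi_gt0// !mulr_gt0.
have [c hc] := choice hL.
pose cc := \sum_(k < m) `|c (m + k)%N|.
have cc0 : 0 <= cc by apply: sumr_ge0.
pose T := Num.max T0 (1 + cc / W).
have T1 : 1 + cc / W <= T by rewrite /T le_max lexx orbT.
have Tp : 0 < T.
  by apply: lt_le_trans T1; rewrite ltr_pwDl// divr_ge0// ltW.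
have hT : T0 <= T by rewrite /T le_max lexx.
apply: (@le_trans _ _ (\sum_(k < m) 2 ^+ Q * (`|I (m + k)%N T| ^+ Q + W ^+ Q))).
  apply: ler_sum => k _.
  have h : `|L (m + k)%N| <= `|I (m + k)%N T| + W.
    rewrite -[L _](subrK (I (m + k)%N T)) addrC (le_trans (ler_normD _ _))// lerD2l.
    rewrite distrC (le_trans (hc _ _ Tp))// ler_pdivrMr//.
    apply: (@le_trans _ _ cc).
      rewrite /cc (bigD1 k)//= (le_trans (ler_norm _))// lerDl; exact: sumr_ge0.
    by rewrite mulrC -ler_pdivrMr// (le_trans _ T1)// lerDr.
  apply: (@le_trans _ _ ((`|I (m + k)%N T| + W) ^+ Q)).
    by rewrite lerXn2r ?nnegrE ?addr_ge0 ?(ltW W0).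
  set u := `|I _ _|; have u0 : 0 <= u by exact: normr_ge0.
  have [uW|uW] := leP u W.
    apply: (@le_trans _ _ ((2 * W) ^+ Q)).
      rewrite lerXn2r ?nnegrE ?addr_ge0 ?mulr_ge0 ?(ltW W0)//.
      by rewrite mulr_natl mulr2n lerD2r.
    by rewrite exprMn ler_wpM2l ?exprn_ge0// lerDr exprn_ge0.
  apply: (@le_trans _ _ ((2 * u) ^+ Q)).
    rewrite lerXn2r ?nnegrE ?addr_ge0 ?mulr_ge0 ?(ltW W0)//.
    by rewrite mulr_natl mulr2n lerD2l ltW.
  by rewrite exprMn ler_wpM2l ?exprn_ge0// lerDl exprn_ge0// ltW.
rewrite -mulr_sumr -!mulrA ler_wpM2l ?exprn_ge0// big_split /= sumr_const card_ord mulrDl mul1r.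
by rewrite -[(_ ^+ Q) *+ m]mulr_natl lerD// mulrA hT0.
Qed.

Lemma block_to_power (L : nat -> R) (Q : nat) (C q : R) : 0 < q -> q <= Q%:R -> 0 <= C ->
  (forall m, (0 < m)%N -> \sum_(k < m) `|L (m + k)%N| ^+ Q <= C * m%:R * w (pi / (2 * beta * m%:R)) ^+ Q) ->
  exists2 C' : R, 0 <= C' & forall m, (0 < m)%N ->
    \sum_(k < m) `|L (m + k)%N| `^ q <= C' * m%:R * w (pi / (2 * m)%:R) `^ q.
Proof.
move=> q0 qQ C0 hL.
(* n + 1 >= 1 / beta compares the scale of the block with pi / (2 m). *)
pose n := Num.truncn beta^-1.
have nb : beta^-1 <= n.+1%:R by apply: ltW; exact: truncnS_gt.
exists (1 + C * n.+1%:R ^+ Q); first by rewrite addr_ge0// mulr_ge0.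
move=> m m0; have mR : 0 < m%:R :> R by rewrite ltr0n.
have pi0 := @pi_gt0 R.
have d0 : 0 < pi / (2 * m)%:R :> R by rewrite divr_gt0// ltr0n muln_gt0.
have W0 := w_gt0 d0; set W := w (pi / (2 * m)%:R) in W0 *.
have wle : w (pi / (2 * beta * m%:R)) <= n.+1%:R * W.
  apply: (le_trans _ (modulus_mul w_sub n d0)); apply: w_mono.
    by rewrite divr_gt0// !mulr_gt0.
  have -> : pi / (2 * beta * m%:R) = beta^-1 * (pi / (2 * m)%:R).
    by rewrite natrM; move: pi0; move: pi => p p0; field; rewrite !gt_eqF.
  by rewrite ler_wpM2r// ltW.
apply: (@le_trans _ _ (\sum_(k < m) W `^ q * (1 + (`|L (m + k)%N| / W) ^+ Q))).
  by apply: ler_sum => k _; exact: powR_le_expn.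
rewrite -mulr_sumr mulrC ler_wpM2r ?powR_ge0// big_split /= sumr_const card_ord mulrDl mul1r lerD//.
have -> : \sum_(k < m) (`|L (m + k)%N| / W) ^+ Q = (\sum_(k < m) `|L (m + k)%N| ^+ Q) / W ^+ Q.
  by rewrite mulr_suml; apply: eq_bigr => k _; rewrite expr_div_n.
rewrite ler_pdivrMr ?exprn_gt0//; apply: (le_trans (hL m m0)).
have -> : C * n.+1%:R ^+ Q * m%:R * W ^+ Q = C * m%:R * (n.+1%:R * W) ^+ Q by rewrite exprMn; ring.
rewrite ler_wpM2l ?mulr_ge0// lerXn2r ?nnegrE ?mulr_ge0 ?(ltW W0)//.
by apply: ltW; apply: w_gt0; rewrite divr_gt0// !mulr_gt0.
Qed.
End Limits.
End Summation.

(** * Deviation of the partial sums *)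

Section StrongSum.
Context {R : realType}.
Notation itg := (@integral_on R).
Notation citg := (@cintegral_on R).
Notation bbc := (@bounded_borelc R).
Notation bb := (@bounded_borel R).
Notation normc := (@ComplexField.Normc.normc R).

Lemma citg_refl a b (u : R -> R[i]) : bbc u -> citg a b (fun t => u (- t)) = citg (- b) (- a) u.
Proof. by case=> u1 u2; rewrite /cintegral_on (itg_refl _ _ u1) (itg_refl _ _ u2). Qed.

Lemma bbc_refl (u : R -> R[i]) c : bbc u -> bbc (fun t => u (c - t)).
Proof. by case=> u1 u2; split; [exact: (bb_refl c u1)|exact: (bb_refl c u2)]. Qed.

Variables (g : R -> R[i]) (M : R).
Hypothesis bg : bbc g.
Hypothesis gM : forall t, normc (g t) <= M.
Hypothesis gap : mean_ap g.
Variable A : R -> R[i].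
Hypothesis hA : forall l (e : R), 0 < e -> exists L0, forall L, L0 <= L ->
  normc (fint g l 0 L - L%:C * A l) <= e * L.
Variables (x : R) (y : R[i]).

Definition second_diff t : R[i] := g (x + t) + g (x - t) - y *+ 2.

Lemma bbc_second_diff : bbc second_diff.
Proof.
apply: bbcB; last exact: bbc_cst.
by apply: bbcD; [exact: bbc_shiftl|exact: bbc_refl].
Qed.

Variable c0 : R.
Hypothesis c0_gt0 : (0 : R) < c0.
Hypothesis hc0 : forall a T, 0 <= a -> 0 < T -> `|itg 0 T (fejer a) - a * c0| <= 2 / T.

(** The kernel is even, so the convolution at x is the integral over [0, T] of the
    symmetric sum g (x + t) + g (x - t); the mass of the kernel turns 2 y into the
    second difference. *)
Lemma sum_representation (gm b : R) (s : seq R) : 0 <= gm -> 0 < b -> uniq s ->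
  (forall l, l \in s -> `|l| <= gm) -> (forall l, l \notin s -> A l = 0 \/ gm + b <= `|l|) ->
  exists C : R, forall T, 0 < T ->
    normc (citg 0 T (fun t => second_diff t * (trapk gm b t)%:C) -
           (2 * (b * c0))%:C * (trig_sum A s x - y)) <= C / T.
Proof.
move=> gm0 b0 us s1 s2; set kern := trapk gm b.
have bk : bb kern by exact: bb_trapk.
have kN t : kern (- t) = kern t by exact: trapkN.
pose Q l := (`|gm + b + l| + `|gm + b - l| - `|gm + l| - `|gm - l|) / 2 * c0.
have kF l T : 0 < T -> `|itg 0 T (fun t => kern t * cos (l * t)) - Q l| <= 4 / T.
  exact: trapk_fourier.
have Qin l : l \in s -> Q l = b * c0 by move=> /s1 h; rewrite /Q (trap_in b0 h).
have Qout l : l \notin s -> A l = 0 \/ Q l = 0.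
  by move=> /s2[|h]; [left|right; rewrite /Q (trap_out gm0 b0 h) mul0r].
have conv := convolution_trig bg gM gap hA bk kN (trapkC_gt0 gm b) (trapk_decay gm0 b0)
  (trapk_diff gm0 b0) kF us Qin Qout x.
exists (4 * trapkC gm b * M + 2 * normc y * 4) => T T0.
have bkc : bbc (fun t => (kern t)%:C) by exact: bbc_real.
have bu : bbc (fun t => g (x + t) * (kern t)%:C) by apply: bbcM => //; exact: bbc_shiftl.
have bu2 : bbc (fun t => g (x - t) * (kern t)%:C) by apply: bbcM => //; exact: bbc_refl.
have T0' : 0 <= T := ltW T0.
have nT0 : - T <= 0 by rewrite oppr_le0.
have E : citg 0 T (fun t => second_diff t * (kern t)%:C) =
    conv_on g kern T x - (y *+ 2) * (itg 0 T kern)%:C.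
  rewrite /conv_on (citg_cat bu nT0 T0').
  have -> : citg (- T) 0 (fun t => g (x + t) * (kern t)%:C) = citg 0 T (fun t => g (x - t) * (kern t)%:C).
    by have := citg_refl 0 T bu; rewrite oppr0 => <-; apply: eq_citg => t _; rewrite kN.
  have -> : (itg 0 T kern)%:C = citg 0 T (fun t => (kern t)%:C).
    by rewrite /cintegral_on /= itg0.
  rewrite -citgZ// -citgD// -citgB//; last 2 first.
  - exact: bbcD.
  - by apply: bbcM => //; exact: bbc_cst.
  by apply: eq_citg => t _; rewrite /second_diff; ring.
have k0 : `|itg 0 T kern - b * c0| <= 4 / T.
  have := kF 0 T T0; rewrite /Q (trap_in b0 _) ?normr0//.
  by rewrite (_ : (fun t => kern t * cos (0 * t)) = kern)//; apply/funext => t; rewrite mul0r cos0 mulr1.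
rewrite E.
have -> : conv_on g kern T x - y *+ 2 * (itg 0 T kern)%:C - (2 * (b * c0))%:C * (trig_sum A s x - y) =
  (conv_on g kern T x - (2 * (b * c0))%:C * trig_sum A s x) - (2 * (itg 0 T kern - b * c0))%:C * y.
  rewrite !rmorphM rmorphB rmorphM /= [2%:C](_ : _ = 2); last by rewrite rmorph_nat.
  by ring.
apply: (le_trans (normcB _ _)); rewrite [leRHS]mulrDl lerD ?conv// normcM normcR normrM (@ger0_norm _ 2)//.
apply: (le_trans (ler_wpM2r (normc_ge0 y) (ler_wpM2l (ler0n _ 2) k0))).
by rewrite le_eqVlt; apply/orP; left; apply/eqP; ring.
Qed.
Lemma rate_unique (h : R -> R) (a b c d : R) : (forall T, 0 < T -> `|h T - a| <= c / T) ->
  (forall T, 0 < T -> `|h T - b| <= d / T) -> a = b.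
Proof.
move=> ha hb; apply/eqP; rewrite -subr_eq0 -normr_le0; apply/ler_addgt0Pr => e e0; rewrite add0r.
have c1 : 0 <= c by have := ha 1 ltr01; rewrite divr1; apply: le_trans.
have d1 : 0 <= d by have := hb 1 ltr01; rewrite divr1; apply: le_trans.
pose T := 1 + (c + d) / e.
have T0 : 0 < T by rewrite ltr_pwDl// divr_ge0 ?addr_ge0// ltW.
apply: (@le_trans _ _ (c / T + d / T)).
  have -> : a - b = (h T - b) - (h T - a) by ring.
  by rewrite (le_trans (ler_normB _ _))// addrC lerD ?ha ?hb.
rewrite -mulrDl ler_pdivrMr// /T mulrDr mulr1 mulrCA mulfV ?gt_eqF// mulr1.
by rewrite lerDr ltW.
Qed.

Variable beta : R.
Hypothesis beta0 : (0 : R) < beta.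

Lemma kernel_limit (F : R -> R) : bb F -> exists L : nat -> R, forall k, exists c, forall T, 0 < T ->
  `|itg 0 T (fun t => F t * trapk (k%:R * beta) beta t) - L k| <= c / T.
Proof.
move=> bF; have [MF FM] := bF.2.
have MF0 : 0 <= MF by exact: le_trans (FM 0).
suff /choice[L hL] : forall k : nat, exists a : R, exists c, forall T, 0 < T ->
  `|itg 0 T (fun t => F t * trapk (k%:R * beta) beta t) - a| <= c / T by exists L.
move=> k; set kern := trapk _ _.
have gm0 : 0 <= k%:R * beta by rewrite mulr_ge0// ltW.
have bk : bb kern by exact: bb_trapk.
have bu : bb (fun t => F t * kern t) by exact: bbM.
have [a ha] : exists a, forall T, 0 < T -> `|itg 0 T (fun t => F t * kern t) - a| <= (MF * 2) / T.
  apply: cvg_rate => s t s0 st; rewrite (itg_cat bu (ltW s0) st) addrAC subrr add0r.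
  apply: (le_trans (itg_norm _ _ bu)); apply: itg_tail => // v _.
  rewrite normrM -mulrA; apply: ler_pM (FM v) (trapk_sqr gm0 beta0 v) => //.
  by rewrite mulr_ge0// sqr_ge0.
by exists a, (MF * 2).
Qed.

(** The three conditions that define the class, for real functions and with the
    exponent r that the estimates use. *)
Definition mean_modulus (r B : R) (w u : R -> R) : Prop :=
  [/\ forall h d : R, 0 < h -> 0 < d -> itg 0 d (fun t => `|u t - u (t + h)| `^ r) <= B * d * w h `^ r,
      forall h d : R, 0 < h -> 0 < d -> itg 0 d (fun t => `|u t - u (t - h)| `^ r) <= B * d * w h `^ r &
      forall d : R, 0 < d -> itg 0 d (fun t => `|u t| `^ r) <= B * d * w d `^ r].

Section Weighted.
Variables (w : R -> R) (r B q : R).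
Hypothesis w_gt0 : forall d : R, 0 < d -> (0 : R) < w d.
Hypothesis w_mono : forall d e : R, 0 < d -> d <= e -> w d <= w e.
Hypothesis w_sub : forall d e : R, 0 < d -> 0 < e -> w (d + e) <= w d + w e.
Hypothesis r1 : (1 : R) < r.
Hypothesis r2 : r <= 2.
Hypothesis B0 : (0 : R) <= B.
Hypothesis q0 : (0 : R) < q.

Lemma kernel_power_sum (F : R -> R) (L : nat -> R) : bb F -> mean_modulus r B w F ->
  (forall k, exists c, forall T, 0 < T -> `|itg 0 T (fun t => F t * trapk (k%:R * beta) beta t) - L k| <= c / T) ->
  exists2 C : R, 0 <= C & forall N, \sum_(k < N) `|L k| `^ q <= C * \sum_(k < N) w (pi / k.+1%:R) `^ q.
Proof.
move=> bF [h1 h2 h3] hL; have [MF FM] := bF.2.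
pose Q := (Num.truncn q).+2.
have Q2 : (2 <= Q)%N by [].
have qQ : q <= Q%:R.
  by apply: ltW; apply: (lt_le_trans (truncnS_gt q)); rewrite ler_nat.
have [C C0 hC] := block_estimate bF FM w_gt0 w_sub r1 r2 B0 h1 h2 h3 beta0 Q2.
pose I (k : nat) (T : R) := itg 0 T (fun t => F t * trapk (k%:R * beta) beta t).
have hbl := @block_limit R w beta w_gt0 beta0 I L Q C C0 hC hL.
have C1 : 0 <= 2 ^+ Q * (C + 1) by rewrite mulr_ge0 ?exprn_ge0// addr_ge0.
have [C' C'0 hC'] := @block_to_power R w beta w_gt0 w_mono w_sub beta0 L Q _ q q0 qQ C1 hbl.
pose y_ (k : nat) := w (pi / k.+1%:R) `^ q.
have d0 (k : nat) : 0 < pi / k.+1%:R :> R by rewrite divr_gt0 ?pi_gt0.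
have y00 : 0 < y_ 0 by rewrite powR_gt0// w_gt0// d0.
have l0 : 0 <= `|L 0| `^ q / y_ 0 by apply: divr_ge0; [exact: powR_ge0|exact: ltW].
pose C2 := C' + `|L 0| `^ q / y_ 0.
have C20 : 0 <= C2 by exact: addr_ge0.
exists (2 * C2); first exact: mulr_ge0.
apply: (@dyadic_partial R (fun k => `|L k| `^ q) y_ C2 C20).
- by move=> k; exact: powR_ge0.
- by move=> k; exact: powR_ge0.
- move=> k; apply: ge0_ler_powR; rewrite ?nnegrE ?(ltW q0)//; [exact: ltW (w_gt0 (d0 _))..|].
  apply: w_mono => //; rewrite ler_pM2l ?pi_gt0// lef_pV2 ?posrE ?ltr0Sn// ler_nat //.
- by rewrite mulrDl divfK ?gt_eqF// lerDr mulr_ge0// ltW.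
move=> m m0; apply: (le_trans (hC' m m0)); rewrite /y_ prednK ?muln_gt0//.
rewrite ler_wpM2r ?powR_ge0// ler_wpM2r// lerDl//.
Qed.

Variable sp : R -> seq R.
Hypothesis sp_uniq : forall gm, uniq (sp gm).
Hypothesis sp_le : forall gm l, l \in sp gm -> `|l| <= gm.
Hypothesis sp_nz : forall gm l, l \in sp gm -> A l != 0.
Hypothesis sp_out : forall gm l, l \notin sp gm -> A l = 0 \/ gm < `|l|.
Hypothesis sp_gap : forall l l', A l != 0 -> A l' != 0 -> 0 < `|l| -> `|l| < `|l'| -> 2 * beta <= `|l'| - `|l|.
Hypothesis mm_Re : mean_modulus r B w (fun t => complex.Re (second_diff t)).
Hypothesis mm_Im : mean_modulus r B w (fun t => complex.Im (second_diff t)).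

Let err k := normc (trig_sum A (sp (k%:R * beta)) x - y).

(** The slopes of two neighbouring trapezoids together have length 2 beta, the minimal
    distance of positive exponents: one of the two slopes is free of exponents, and
    the corresponding trapezoid reproduces the partial sum. *)
Lemma plateau (k : nat) : exists2 j, (j = k.+1 \/ j = k) &
  forall l, (l \in sp (k.+1%:R * beta) -> `|l| <= j%:R * beta) /\
   (l \notin sp (k.+1%:R * beta) -> A l = 0 \/ j%:R * beta + beta <= `|l|).
Proof.
have bS (n : nat) : n.+1%:R * beta = n%:R * beta + beta by rewrite -natr1 mulrDl mul1r.
have [h|h] := pselect (forall l, A l != 0 -> k.+1%:R * beta < `|l| -> k.+1%:R * beta + beta <= `|l|).
  exists k.+1; first by left.
  move=> l; split=> [|/sp_out[->|h']]; [exact: sp_le|by left|].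
  by have [->|nz] := eqVneq (A l) 0; [left|right; exact: h].
exists k; first by right.
have [l0 [nz0 h1 h2]] : exists l0, [/\ A l0 != 0, k.+1%:R * beta < `|l0| & `|l0| < k.+1%:R * beta + beta].
  apply: contrapT => h'; apply: h => l nz hl; rewrite leNgt; apply/negP => hl2.
  by apply: h'; exists l.
move=> l; split=> [lin|/sp_out[->|h']]; [|by left|by right; rewrite -bS ltW].
rewrite leNgt; apply/negP => hl.
have kb0 : 0 <= k%:R * beta by rewrite mulr_ge0// ltW.
have := sp_gap (sp_nz lin) nz0 (le_lt_trans kb0 hl) (le_lt_trans (sp_le lin) h1).
move: h2 hl; rewrite bS; move: `|l0| `|l| (k%:R * beta) => u v z h2 hl h3.
have b2 : 2 * beta = beta + beta by rewrite mulr_natl mulr2n.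
have : beta + beta < beta + beta; last by rewrite ltxx.
rewrite -{1}b2 (le_lt_trans h3)//.
by rewrite ltrBlDr (lt_trans h2)// -addrA addrC ltrD2l.
Qed.

Theorem strong_sum : exists2 K : R, 0 <= K & forall N,
  \sum_(k < N) err k `^ q <= K * \sum_(k < N) w (pi / k.+1%:R) `^ q.
Proof.
have [bR bI] := bbc_second_diff.
have [L1 hL1] := kernel_limit bR; have [L2 hL2] := kernel_limit bI.
have [C1 C10 hC1] := kernel_power_sum bR mm_Re hL1.
have [C2 C20 hC2] := kernel_power_sum bI mm_Im hL2.
pose c := 2 * (beta * c0); have cp : 0 < c by rewrite !mulr_gt0.
pose e k := `|L1 k| `^ q + `|L2 k| `^ q.
have e0 k : 0 <= e k by rewrite addr_ge0// powR_ge0.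
pose D := (c^-1) `^ q * 3 `^ q; have D0 : 0 <= D by rewrite mulr_ge0// powR_ge0.
have errS k : err k.+1 `^ q <= D * (e k.+1 + e k).
  have [j hj hp] := plateau k.
  have gm0 : 0 <= j%:R * beta by rewrite mulr_ge0// ltW.
  have [C hC] := sum_representation gm0 beta0 (sp_uniq _) (fun l => (hp l).1) (fun l => (hp l).2).
  set Z := trig_sum A _ x - y in hC.
  have bk : bbc (fun t => (trapk (j%:R * beta) beta t)%:C) by apply: bbc_real; exact: bb_trapk.
  have ReE T : complex.Re (citg 0 T (fun t => second_diff t * (trapk (j%:R * beta) beta t)%:C)) =
      itg 0 T (fun t => complex.Re (second_diff t) * trapk (j%:R * beta) beta t).
    by apply: eq_itg => t _; rewrite cReM /= mulr0 subr0.
  have ImE T : complex.Im (citg 0 T (fun t => second_diff t * (trapk (j%:R * beta) beta t)%:C)) =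
      itg 0 T (fun t => complex.Im (second_diff t) * trapk (j%:R * beta) beta t).
    by apply: eq_itg => t _; rewrite cImM /= mulr0 add0r.
  have l1 : c * complex.Re Z = L1 j.
    have [c1 hc1] := hL1 j; apply: rate_unique hc1 => T T0.
    rewrite -ReE; apply: le_trans (hC T T0).
    have -> : c * complex.Re Z = complex.Re ((2 * (beta * c0))%:C * Z) by rewrite cReM /= mul0r subr0.
    by rewrite -cReB normc_Re.
  have l2 : c * complex.Im Z = L2 j.
    have [c1 hc1] := hL2 j; apply: rate_unique hc1 => T T0.
    rewrite -ImE; apply: le_trans (hC T T0).
    have -> : c * complex.Im Z = complex.Im ((2 * (beta * c0))%:C * Z) by rewrite cImM /= mul0r addr0.
    by rewrite -cImB normc_Im.
  have errle : err k.+1 <= c^-1 * (`|L1 j| + `|L2 j| + 0).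
    rewrite -l1 -l2 [`|c * complex.Re Z|]normrM [`|c * complex.Im Z|]normrM (gtr0_norm cp) addr0 -mulrDr mulKf ?gt_eqF//.
    exact: normc_ReIm.
  have ci : 0 <= c^-1 by rewrite invr_ge0 ltW.
  apply: (@le_trans _ _ ((c^-1 * (`|L1 j| + `|L2 j| + 0)) `^ q)).
    apply: ge0_ler_powR errle; rewrite ?nnegrE ?(ltW q0) ?normc_ge0//.
    by apply: mulr_ge0 => //; rewrite addr0 addr_ge0.
  have s0 : 0 <= `|L1 j| + `|L2 j| + 0 by rewrite addr0 addr_ge0.
  rewrite powRM// /D -[leRHS]mulrA ler_wpM2l ?powR_ge0//.
  apply: (le_trans (powR_add3 (ltW q0) (normr_ge0 _) (normr_ge0 _) (lexx 0))).
  rewrite ler_wpM2l ?powR_ge0// powR0 ?gt_eqF// addr0.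
  by case: hj => ->; [rewrite -/(e k.+1) lerDl|rewrite -/(e k) lerDr].
pose Y N := \sum_(k < N) w (pi / k.+1%:R) `^ q.
have d0 (k : nat) : 0 < pi / k.+1%:R :> R by rewrite divr_gt0 ?pi_gt0.
have y00 : 0 < w (pi / 1%:R) `^ q by rewrite powR_gt0// w_gt0.
pose E0 := err 0 `^ q / w (pi / 1%:R) `^ q.
have E00 : 0 <= E0 by rewrite divr_ge0 ?powR_ge0.
exists (E0 + 2 * D * (C1 + C2)).
  by apply: addr_ge0 => //; apply: mulr_ge0; [exact: mulr_ge0|exact: addr_ge0].
move=> [|N]; first by rewrite !big_ord0 mulr0.
rewrite big_ord_recl -/(Y N.+1).
have eN : \sum_(k < N.+1) e k <= (C1 + C2) * Y N.+1.
  by rewrite big_split /= mulrDl lerD ?hC1 ?hC2.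
have e1 : \sum_(k < N) e k.+1 <= \sum_(k < N.+1) e k.
  by rewrite [leRHS]big_ord_recl lerDr.
have e2 : \sum_(k < N) e k <= \sum_(k < N.+1) e k.
  by rewrite [leRHS]big_ord_recr lerDl.
rewrite [leRHS]mulrDl lerD//.
  rewrite /E0 mulrAC ler_pdivlMr// ler_wpM2l ?powR_ge0// /Y big_ord_recl lerDl.
  by apply: sumr_ge0 => k _; exact: powR_ge0.
apply: (@le_trans _ _ (\sum_(k < N) D * (e k.+1 + e k))).
  by apply: ler_sum => k _; exact: errS.
rewrite -mulr_sumr big_split /=.
have -> : 2 * D * (C1 + C2) * Y N.+1 = D * ((C1 + C2) * Y N.+1 + (C1 + C2) * Y N.+1).
  by clearbody D; move: (Y _) => v; ring.
rewrite ler_wpM2l//.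
by rewrite lerD// (le_trans _ eN).
Qed.
End Weighted.

Lemma list_gap (s : seq R) (gm : R) : exists2 b : R, 0 < b & forall l, l \in s -> `|l| <= gm \/ gm + b <= `|l|.
Proof.
elim: s => [|l0 s [b b0 hb]]; first by exists 1.
exists (if `|l0| <= gm then b else Num.min b (`|l0| - gm)).
  by case: ifPn => //; rewrite -ltNge => h; rewrite lt_min b0 subr_gt0.
move=> l; rewrite in_cons => /predU1P[->|/hb[h|h]]; [|by left|right].
  case: ifPn => h; [by left|right]; rewrite addrC -lerBrDr.
  by rewrite ge_min lexx orbT.
apply: le_trans h; rewrite lerD2l; case: ifP => // _.
by rewrite ge_min lexx.
Qed.

(** Every frequency has a gap of some width b to its right; with the second difference
    equal to 0, the representation over that gap says that the sum equals y. *)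
Lemma degenerate_sum (sp : R -> seq R) (gm : R) : (forall gm, uniq (sp gm)) ->
  (forall gm l, l \in sp gm -> `|l| <= gm) ->
  (forall gm l, l \notin sp gm -> A l = 0 \/ gm < `|l|) ->
  (forall (kern : R -> R) T, bb kern -> citg 0 T (fun t => second_diff t * (kern t)%:C) = 0) ->
  0 <= gm -> trig_sum A (sp gm) x = y.
Proof.
move=> us sle sout hz gm0.
have [b1 b10 hb1] := list_gap (sp (gm + 1)) gm.
pose b := Num.min b1 1; have b0 : 0 < b by rewrite lt_min b10 ltr01.
have out l : l \notin sp gm -> A l = 0 \/ gm + b <= `|l|.
  move=> /sout[->|h]; first by left.
  have [/hb1[h1|h1]|/sout[->|h1]] := boolP (l \in sp (gm + 1)); last 2 first.
  - by left.
  - by right; rewrite (le_trans _ (ltW h1))// lerD2l ge_min lexx orbT.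
  - by move: h; rewrite ltNge h1.
  - by right; rewrite (le_trans _ h1)// lerD2l ge_min lexx.
have [C hC] := sum_representation gm0 b0 (us gm) (sle gm) out.
set Z := trig_sum A _ x - y in hC; have bk := bb_trapk gm0 b0.
have Z0 : normc ((2 * (b * c0))%:C * Z) = 0.
  apply: (@rate_unique (fun _ => normc ((2 * (b * c0))%:C * Z)) _ _ 0 C) => T T0.
    by rewrite subrr normr0 mul0r.
  by have := hC T T0; rewrite hz// sub0r normcN subr0 ger0_norm// normc_ge0.
move/eqP: Z0; rewrite normc_eq0 mulf_eq0 => /orP[|].
  by move=> /eqP[] /eqP; rewrite gt_eqF// !mulr_gt0.
by rewrite subr_eq0 => /eqP.
Qed.

End StrongSum.

(** * Changing functions on null sets *)

Section AlmostEverywhere.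
Context {R : realType}.
Notation mu := (@lebesgue_measure R).
Notation citg := (@cintegral_on R).
Notation bbc := (@bounded_borelc R).
Notation normc := (@ComplexField.Normc.normc R).

Lemma integral_mono0 (u v : R -> \bar R) : (forall t, 0 <= u t)%E -> (forall t, u t <= v t)%E ->
  (\int[mu]_t u t <= \int[mu]_t v t)%E.
Proof.
move=> u0 uv; have v0 t : (0 <= v t)%E by exact: le_trans (uv t).
rewrite !ge0_integralTE//; apply: le_ereal_sup => _ [h hh <-]; exists h => // t.
exact: le_trans (uv t).
Qed.

(** The integral of an arbitrary nonnegative function is a supremum over simple functions,
    hence monotone. So u is squeezed between v cut to 0 and v raised to +oo on a Borel
    null set, two functions with the integral of v. *)
Lemma integral_ae0 (u v : R -> \bar R) : (forall t, 0 <= u t)%E -> (forall t, 0 <= v t)%E ->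
  measurable_fun [set: R] v -> (\forall t \ae mu, u t = v t) ->
  (\int[mu]_t u t = \int[mu]_t v t)%E.
Proof.
move=> u0 v0 mv [N [mN N0 hN]].
have uv t : ~ N t -> u t = v t.
  by move=> nt; apply: contrapT => h; apply: nt; apply: hN.
pose i1 t : \bar R := ((\1_(~` N) : R -> R) t)%:E.
pose i2 t : \bar R := ((\1_N : R -> R) t)%:E.
have m1 : measurable_fun [set: R] i1 by apply/measurable_EFinP; apply: measurable_indic; exact: measurableC.
have m2 : measurable_fun [set: R] i2 by apply/measurable_EFinP; exact: measurable_indic.
have mv1 : measurable_fun [set: R] (fun t => v t * i1 t)%E by exact: emeasurable_funM.
have mv2 : measurable_fun [set: R] (fun t => v t + +oo * i2 t)%E.
  by apply: emeasurable_funD => //; exact: measurable_funeM.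
have i1E t : (N t /\ i1 t = 0%E /\ i2 t = 1%E) \/ (~ N t /\ i1 t = 1%E /\ i2 t = 0%E).
  rewrite /i1 /i2 !indicE; have [nt|nt] := pselect (N t); [left|right].
    by rewrite (mem_set nt) memNset//=; move=> /= h; exact: h.
  by rewrite (memNset nt) mem_set.
have aeN (P : R -> Prop) : (forall t, ~ N t -> P t) -> \forall t \ae mu, P t.
  by move=> hP; exists N; split => // t /= nP; apply: contrapT => nN; exact: nP (hP _ nN).
have v10 t : (0 <= v t * i1 t)%E by case: (i1E t) => [[_ [-> _]]|[_ [-> _]]]; rewrite ?mule0 ?mule1.
have v20 t : (0 <= v t + +oo * i2 t)%E.
  by case: (i1E t) => [[_ [_ ->]]|[_ [_ ->]]]; rewrite ?mule0 ?mule1 ?adde0// adde_ge0.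
have E1 : (\int[mu]_t v t = \int[mu]_t (v t * i1 t))%E.
  apply: ge0_ae_eq_integral => //; apply: aeN => t nN _.
  by case: (i1E t) => [[]//|[_ [-> _]]]; rewrite mule1.
have E2 : (\int[mu]_t v t = \int[mu]_t (v t + +oo * i2 t))%E.
  apply: ge0_ae_eq_integral => //; apply: aeN => t nN _.
  by case: (i1E t) => [[]//|[_ [_ ->]]]; rewrite mule0 adde0.
apply/eqP; rewrite eq_le; apply/andP; split; [rewrite E2|rewrite E1]; apply: integral_mono0 => // t.
  case: (i1E t) => [[_ [_ ->]]|[nt [_ ->]]]; last by rewrite mule0 adde0 uv.
  by rewrite mule1 addey ?leey// gt_eqF// (lt_le_trans _ (v0 t)).
by case: (i1E t) => [[_ [-> _]]|[nt [-> _]]]; rewrite ?mule0// mule1 uv.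
Qed.

Lemma ge0_integral_ae (D : set R) (u v : R -> \bar R) : measurable D ->
  (forall t, 0 <= u t)%E -> (forall t, 0 <= v t)%E ->
  measurable_fun [set: R] v -> (\forall t \ae mu, u t = v t) ->
  (\int[mu]_(t in D) u t = \int[mu]_(t in D) v t)%E.
Proof.
move=> mD u0 v0 mv uv; rewrite integral_mkcond [RHS]integral_mkcond.
apply: integral_ae0.
- by move=> t; rewrite /patch; case: ifP.
- by move=> t; rewrite /patch; case: ifP.
- by apply/(measurable_restrictT _ mD); exact: measurable_funS mv.
- by apply: (@filterS _ _ (ae_filter_ringOfSetsType mu) _ _ _ uv) => t /= h; rewrite /patch h.
Qed.

Lemma integral_ae (D : set R) (u v : R -> \bar R) : measurable D ->
  measurable_fun [set: R] v -> (\forall t \ae mu, u t = v t) ->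
  (\int[mu]_(t in D) u t = \int[mu]_(t in D) v t)%E.
Proof.
move=> mD mv uv; rewrite integralE [RHS]integralE; congr (_ - _)%E; apply: ge0_integral_ae => //.
- exact: measurable_funepos.
- by apply: (@filterS _ _ (ae_filter_ringOfSetsType mu) _ _ _ uv) => t /= h; rewrite !funeposE h.
- exact: measurable_funeneg.
- by apply: (@filterS _ _ (ae_filter_ringOfSetsType mu) _ _ _ uv) => t /= h; rewrite !funenegE h.
Qed.

Lemma cintegral_ae (a b : R) (h h' : R -> R[i]) : bbc h' -> (\forall t \ae mu, h t = h' t) ->
  cintegral `[a, b] h = citg a b h'.
Proof.
move=> [[m1 _] [m2 _]] hh; rewrite citgE /cintegral /Rintegral.
congr (fine _ +i* fine _); apply: integral_ae => //; try exact/measurable_EFinP;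
  by apply: (@filterS _ _ (ae_filter_ringOfSetsType mu) _ _ _ hh) => t /= ->.
Qed.

Lemma ae_shift (P : R -> Prop) (c : R) : (\forall t \ae mu, P t) -> \forall t \ae mu, P (t + c).
Proof.
move=> [N [mN N0 hN]]; exists ((fun t => t + c) @^-1` N); split.
- have mf : measurable_fun [set: R] (fun t => t + c) by exact: measurable_funD.
  by rewrite -[_ @^-1` _]setTI; exact: mf.
- by rewrite -N0; have := lebesgue_measure_shift c mN.
- by move=> t /= ht; apply: hN.
Qed.

Lemma ae_refl (P : R -> Prop) (c : R) : (\forall t \ae mu, P t) -> \forall t \ae mu, P (c - t).
Proof.
move=> h; have [N [mN N0 hN]] := ae_shift c h; exists (-%R @^-1` N); split.
- by rewrite -[_ @^-1` _]setTI; exact: (@oppr_measurable R).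
- by rewrite -N0; have := @lebesgue_measureN R _ mN.
- by move=> t /= ht; apply: hN => /=; rewrite addrC.
Qed.

End AlmostEverywhere.

(** * Power means *)

Section PowerMeans.
Context {R : realType}.
Notation mu := (@lebesgue_measure R).
Notation itg := (@integral_on R).
Notation bbc := (@bounded_borelc R).
Notation bb := (@bounded_borel R).
Notation normc := (@ComplexField.Normc.normc R).

(** Large exponents, and p = +oo, are reduced to 2, for which Bessel's inequality is
    available. *)
Definition low_exponent (p : \bar R) : R := if p is r%:E then Num.min r 2 else 2.

Lemma low_exponent_gt1 p : (1 < p)%E -> 1 < low_exponent p.
Proof. by case: p => [r| |]//= h; rewrite ?lt_min ?ltr1n// ?andbT -?lte_fin. Qed.

Lemma low_exponent_le2 p : low_exponent p <= 2.
Proof. by case: p => [r| |]//=; rewrite ge_min lexx orbT. Qed.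

(** The analogue of [young_split] that passes from the exponent r to a smaller s. *)
Lemma powR_lower (s r y W : R) : 0 < s -> s <= r -> 0 <= y -> 0 < W ->
  y `^ s <= W `^ s + W `^ (s - r) * y `^ r.
Proof.
move=> s0 sr y0 W0; have [h|h] := leP y W.
  rewrite -[leLHS]addr0 lerD ?mulr_ge0 ?powR_ge0//.
  by apply: ge0_ler_powR; rewrite ?nnegrE ?(ltW s0) ?(ltW W0).
have y1 : 0 < y by exact: lt_trans h.
rewrite -[leLHS]add0r lerD ?powR_ge0//.
have -> : y `^ s = y `^ (s - r) * y `^ r.
  by rewrite -powRD ?subrK//; apply/implyP => _; rewrite gt_eqF.
apply: ler_wpM2r; first exact: powR_ge0.
rewrite -[s - r]opprB !powRN lef_pV2 ?posrE ?powR_gt0//.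
by apply: ge0_ler_powR; rewrite ?nnegrE ?(ltW W0) ?(ltW y1) ?(ltW h)// subr_ge0.
Qed.

Lemma pmean_mean (p : \bar R) (u d W W' : R) (h h' : R -> R[i]) : (1 < p)%E -> 0 < d ->
  bbc h' -> (\forall t \ae mu, h t = h' t) -> (pmean p u d h <= W%:E)%E -> 0 < W' -> W <= W' ->
  itg u (u + d) (fun t => normc (h' t) `^ low_exponent p) <= 2 * d * W' `^ low_exponent p.
Proof.
move=> p1 d0 bh' hh; set s := low_exponent p; move=> hp W0 WW.
have s1 : 1 < s by exact: low_exponent_gt1.
have s0 : 0 < s by exact: lt_trans s1.
have bn : bb (fun t => normc (h' t)) by exact: bbc_norm.
have pw (r : R) : 0 <= r -> bb (fun t => normc (h' t) `^ r).
  move=> r0; have := bb_powR r0 bn; congr bb; apply/funext => t.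
  by rewrite ger0_norm// normc_ge0.
have ud : u <= u + d by rewrite lerDl ltW.
case: p p1 @s s1 s0 hp => [r| |] // p1 s s1 s0 /= hp.
  have r1 : 1 < r by rewrite -lte_fin.
  have r0 : 0 < r by exact: lt_trans r1.
  have sr : s <= r by rewrite /s /= ge_min lexx.
  have br := pw r (ltW r0); have bs := pw s (ltW s0).
  set I := itg u (u + d) (fun t => normc (h' t) `^ r).
  have IE : (\int[mu]_(t in `[u, (u + d)%R]) (normc (h t) `^ r)%:E = I%:E)%E.
    rewrite (@ge0_integral_ae R _ _ (fun t => (normc (h' t) `^ r)%:E)) //.
    - rewrite /I /integral_on /Rintegral fineK//.
      by apply: integrable_fin_num => //; exact: bb_itg.
    - by move=> t; rewrite lee_fin powR_ge0.
    - by move=> t; rewrite lee_fin powR_ge0.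
    - by apply/measurable_EFinP; case: br.
    - by apply: (@filterS _ _ (ae_filter_ringOfSetsType mu) _ _ _ hh) => t /= ->.
  move: hp; rewrite IE -EFinM poweR_EFin lee_fin => hp.
  have I0 : 0 <= d^-1 * I.
    by rewrite mulr_ge0 ?invr_ge0 ?(ltW d0)//; apply: itg_ge0 => t _; exact: powR_ge0.
  have I1 : I <= d * W' `^ r.
    rewrite -ler_pdivrMl// -[leLHS](powRr1 I0) -(mulVf (lt0r_neq0 r0)) powRrM.
    by apply: ge0_ler_powR; rewrite ?nnegrE ?powR_ge0 ?(ltW r0) ?(ltW W0)// (le_trans hp).
  apply: (@le_trans _ _ (itg u (u + d) (fun t => W' `^ s + W' `^ (s - r) * normc (h' t) `^ r))).
    apply: le_itg => //; first by apply: bbD; [exact: bb_cst|apply: bbM => //; exact: bb_cst].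
    by move=> t _; apply: powR_lower => //; exact: normc_ge0.
  rewrite itgD; [|exact: bb_cst|by apply: bbM => //; exact: bb_cst].
  rewrite itg_cst// itgZ// addrAC subrr add0r -/I.
  have -> : 2 * d * W' `^ s = W' `^ s * d + d * W' `^ s by ring.
  rewrite lerD2l; apply: (le_trans (ler_wpM2l (powR_ge0 _ _) I1)).
  rewrite mulrCA -powRD ?subrK//; by apply/implyP => _; rewrite gt_eqF.
have bs := pw s (ltW s0).
rewrite -(itg_open bs ud).
pose cut : R -> R := \1_`]-oo, W'].
have bcut : bb (fun t => cut (normc (h' t))).
  by apply: (@bb_comp _ cut (fun t => normc (h' t))); [case: bn|exact: bb_indic].
have bo : bb (fun t => normc (h' t) `^ s * \1_`]u, (u + d)[ t) by apply: bbM => //; exact: bb_indic.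
rewrite (@eq_itg_ae _ _ _ _ (fun t => normc (h' t) `^ s * \1_`]u, (u + d)[ t * cut (normc (h' t))))//; last 2 first.
- exact: bbM.
- have /ess_supP hp2 := hp.
  have hf := @filterI _ _ (ae_filter_ringOfSetsType mu) _ _ hh hp2.
  apply: (@filterS _ _ (ae_filter_ringOfSetsType mu) _ _ _ hf) => t /= [E le].
  rewrite !indicE; have [tin|tin] := pselect (`]u, (u + d)[%classic t); last first.
    by rewrite (memNset tin) mulr0 mul0r.
  move: le; rewrite /patch (mem_set tin) lee_fin E => le.
  rewrite [X in _ = _ * X](_ : _ = 1) ?mulr1//.
  by rewrite /cut indicE mem_set//= in_itv/= (le_trans le).
apply: (@le_trans _ _ (itg u (u + d) (fun=> W' `^ s))).
  apply: le_itg; [exact: bbM|exact: bb_cst|move=> t _].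
  rewrite /cut; have [cin|cin] := leP (normc (h' t)) W'; last first.
    rewrite [X in _ * X <= _](_ : _ = 0) ?mulr0 ?powR_ge0// indicE memNset//=.
    by rewrite in_itv/=; apply/negP; rewrite -ltNge.
  rewrite [X in _ * X <= _](_ : _ = 1) ?mulr1; last by rewrite indicE mem_set//= in_itv.
  apply: (@le_trans _ _ (normc (h' t) `^ s)).
    by apply: ler_piMr; [exact: powR_ge0|rewrite indicE; case: (_ \in _)].
  by apply: ge0_ler_powR; rewrite ?nnegrE ?(ltW s0) ?(ltW W0) ?normc_ge0.
rewrite itg_cst// addrAC subrr add0r mulrC ler_wpM2r ?powR_ge0// ler_peMl ?(ltW d0)// ler1n//.
Qed.

End PowerMeans.

(** * Borel representatives *)

Section Representative.
Context {R : realType}.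
Notation mu := (@lebesgue_measure R).
Notation itg := (@integral_on R).
Notation bbc := (@bounded_borelc R).
Notation bb := (@bounded_borel R).
Notation normc := (@ComplexField.Normc.normc R).
Notation aeF := (ae_filter_ringOfSetsType mu).

Lemma normrC (z : R[i]) : `|z| = (normc z)%:C.
Proof. by case: z. Qed.

Lemma truncate_bb (u : R -> R) (M : R) : measurable_fun [set: R] u ->
  bb (fun t => u t * (\1_`[- M, M] : R -> R) (u t)).
Proof.
move=> mu_; have mc : measurable_fun [set: R] (fun t => (\1_`[- M, M] : R -> R) (u t)).
  by apply: (@measurableT_comp _ _ _ _ _ _ (\1_`[- M, M] : R -> R) _ u) => //; exact: measurable_indic.
split; first exact: measurable_funM.
exists `|M| => t; rewrite indicE; have [h|h] := boolP (_ \in _); last by rewrite mulr0 normr0.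
rewrite /= mulr1; move: h; rewrite inE/= in_itv/= -ler_norml => h.
by rewrite (le_trans h)// ler_norm.
Qed.

(** For finite p, the Borel function equal to f almost everywhere is cut off at the
    bound of f; for p = +oo, f itself is continuous. *)
Lemma borel_representative (p : \bar R) (f : R -> R[i]) (M : R) : stepanov_class p f ->
  (forall t, normc (f t) <= M) -> exists2 g, bbc g & \forall t \ae mu, f t = g t.
Proof.
move=> [h _] fM; case: p h => [r [[g [m1 m2 fg]] _]|fc|//].
  exists (fun t => (complex.Re (g t) * (\1_`[- M, M] : R -> R) (complex.Re (g t))) +i*
                   (complex.Im (g t) * (\1_`[- M, M] : R -> R) (complex.Im (g t)))).
    by split; exact: truncate_bb.
  apply: (@filterS _ _ aeF _ _ _ fg) => t /= E; rewrite -E.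
  have h1 := le_trans (normc_Re (f t)) (fM t); have h2 := le_trans (normc_Im (f t)) (fM t).
  rewrite !indicE !mem_set ?mulr1/=; [by case: (f t)|by rewrite in_itv/= -ler_norml..].
have key t (e : R) : 0 < e -> \forall s \near t, normc (f t - f s) < e.
  move=> e0; have eC : 0 < e%:C :> R[i]^o by rewrite ltcR.
  have /cvgrPdist_lt /(_ _ eC) := fc t.
  by apply: filterS => s; rewrite normrC ltcR.
exists f; last by apply: (@filterE _ _ aeF).
split.
  apply: (@bb_cont _ _ M) => [t|t]; last exact: le_trans (normc_Re _) (fM t).
  apply/cvgrPdist_lt => e e0; apply: filterS (key t e e0) => s.
  by apply: le_lt_trans; rewrite -cReB normc_Re.
apply: (@bb_cont _ _ M) => [t|t]; last exact: le_trans (normc_Im _) (fM t).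
apply/cvgrPdist_lt => e e0; apply: filterS (key t e e0) => s.
by apply: le_lt_trans; rewrite -cImB normc_Im.
Qed.

Lemma pmean_L1 (p : \bar R) (u d W W' : R) (h h' : R -> R[i]) : (1 < p)%E -> 0 < d ->
  bbc h' -> (\forall t \ae mu, h t = h' t) -> (pmean p u d h <= W%:E)%E -> 0 < W' -> W <= W' ->
  itg u (u + d) (fun t => normc (h' t)) <= 3 * d * W'.
Proof.
move=> p1 d0 bh' hh hp W0 WW; have := pmean_mean p1 d0 bh' hh hp W0 WW.
have s1 := low_exponent_gt1 p1; set s := low_exponent p in s1 *; move=> hs.
have s0 : 0 <= s by rewrite (le_trans ler01)// ltW.
have bn : bb (fun t => normc (h' t)) by exact: bbc_norm.
have bs : bb (fun t => normc (h' t) `^ s).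
  have := bb_powR s0 bn; congr bb; apply/funext => t.
  by rewrite ger0_norm// normc_ge0.
apply: (@le_trans _ _ (itg u (u + d) (fun t => W' + W' `^ (1 - s) * normc (h' t) `^ s))).
  apply: le_itg => //; first by apply: bbD; [exact: bb_cst|apply: bbM => //; exact: bb_cst].
  by move=> t _; apply: young_split => //; exact: normc_ge0.
rewrite itgD; [|exact: bb_cst|by apply: bbM => //; exact: bb_cst].
rewrite itg_cst ?lerDl ?(ltW d0)// itgZ// addrAC subrr add0r.
apply: (le_trans (lerD (lexx _) (ler_wpM2l (powR_ge0 _ _) hs))).
rewrite mulrCA -powRD; last by apply/implyP => _; rewrite gt_eqF.
rewrite subrK powRr1 ?(ltW W0)// le_eqVlt; apply/orP; left; apply/eqP; ring.
Qed.

Lemma stepanov_pmean (p : \bar R) (h : R -> R[i]) (e u : R) : 0 <= e ->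
  (stepanov_norm p h <= e%:E)%E -> (pmean p u pi h <= e%:E)%E.
Proof.
move=> e0; case: p => [r| |] /= hs; last by rewrite lee_fin.
  by apply: le_trans hs; apply: ereal_sup_ubound; exists u.
apply/ess_supP; apply: (@filterE _ _ aeF) => t; rewrite /patch; case: ifP => _; last by rewrite lee_fin.
by apply: le_trans hs; apply: ereal_sup_ubound; exists t.
Qed.

(** Translation numbers for the Stepanov norm serve in the mean as well, because the unit
    interval is contained in an interval of length pi. *)
Lemma mean_ap_representative (p : \bar R) (f g : R -> R[i]) : (1 < p)%E -> bbc g ->
  (\forall t \ae mu, f t = g t) -> stepanov_class p f -> mean_ap g.
Proof.
move=> p1 bg fg [_ hf] e e0; have pi0 := @pi_gt0 R.
have e'0 : 0 < e / (3 * pi) by rewrite divr_gt0// mulr_gt0.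
have [l [l0 hl]] := hf _ e'0; exists l; split => // a.
have [tau [ht hs]] := hl a; exists tau; split => // y /=.
have bd : bbc (fun t => g (t + tau) - g t) by apply: bbcB => //; exact: bbc_shift.
have dd : \forall t \ae mu, f (t + tau) - f t = g (t + tau) - g t.
  have h := @filterI _ _ aeF _ _ fg (ae_shift tau fg).
  by apply: (@filterS _ _ aeF _ _ _ h) => t /= [-> ->].
have := pmean_L1 p1 pi0 bd dd (stepanov_pmean y (ltW e'0) hs) e'0 (lexx _).
have -> : 3 * pi * (e / (3 * pi)) = e by rewrite mulrC divfK// gt_eqF// mulr_gt0.
apply: le_trans; apply: itg_mono => //; first exact: bbc_norm.
  by move=> t _; exact: normc_ge0.
by rewrite lerD2l (le_trans _ (@pi_ge2 R))// ler1n.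
Qed.

Lemma second_diff_ae (f g : R -> R[i]) (x : R) : (\forall t \ae mu, f t = g t) ->
  \forall t \ae mu, symm_diff2 f x t = second_diff g x (f x) t.
Proof.
move=> fg; have h := @filterI _ _ aeF _ _ (ae_shift x fg) (ae_refl x fg).
apply: (@filterS _ _ aeF _ _ _ h) => t /= [h1 h2].
by rewrite /symm_diff2 /second_diff h2 [x + t]addrC h1.
Qed.

Lemma fourier_coef_representative (f g : R -> R[i]) (l : R) (z : R[i]) : bbc g ->
  (\forall t \ae mu, f t = g t) ->
  (forall e : R, 0 < e -> exists L0, forall L, L0 <= L -> normc (fint g l 0 L - L%:C * z) <= e * L) ->
  fourier_coef f l = z.
Proof.
move=> bg fg hz; rewrite /fourier_coef.
have E L : cintegral `[0, L] (fun t => f t * expi (- (l * t))) = fint g l 0 L.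
  apply: cintegral_ae; first exact: bbc_fexp.
  by apply: (@filterS _ _ aeF _ _ _ fg) => t /= ->.
have cv : ((L^-1)%:C * cintegral `[0, L] (fun t => f t * expi (- (l * t))) : R[i]^o)
    @[L --> +oo%R] --> (z : R[i]^o).
  apply/cvgrPdist_le => e e0.
  have e0' : 0 < complex.Re e by move: e0; rewrite ltcE/= => /andP[].
  have eE : e = (complex.Re e)%:C.
    by apply: complex_eq => //=; move: e0; rewrite ltcE/= => /andP[/eqP].
  have [L0 hL0] := hz _ e0'.
  have h1 : \forall L \near +oo%R, Num.max 1 L0 <= L by apply: nbhs_pinfty_ge; exact: num_real.
  apply: filterS h1 => L; rewrite ge_max => /andP[L1 hL].
  have Lp : 0 < L by exact: lt_le_trans L1.
  rewrite eE normrC lecR E.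
  have -> : z - (L^-1)%:C * fint g l 0 L = (L^-1)%:C * (L%:C * z - fint g l 0 L).
    by rewrite mulrBr mulrA -rmorphM/= mulVf ?gt_eqF// rmorph1 mul1r.
  rewrite normcZ normcBC ger0_norm ?invr_ge0 ?(ltW Lp)// ler_pdivrMl// [leRHS]mulrC.
  exact: hL0.
exact: (cvg_lim (@norm_hausdorff _ (R[i]^o)) cv).
Qed.

Lemma mean_modulus_representative (p : \bar R) (f g : R -> R[i]) (x C : R) (w : R -> R) (part : R[i] -> R) :
  (1 < p)%E -> bbc g -> (\forall t \ae mu, f t = g t) -> 0 < C ->
  (forall d : R, 0 < d -> (0 : R) < w d) ->
  (forall z, `|part z| <= normc z) -> (forall z1 z2, part (z1 - z2) = part z1 - part z2) ->
  (forall u : R -> R[i], bbc u -> bb (fun t => part (u t))) ->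
  (forall gamma delta : R, 0 < gamma -> 0 < delta ->
      let phi := symm_diff2 f x in
      [/\ (pmean p 0 delta (fun t => (phi t - phi (t + gamma))%R) <= (C * w gamma)%:E)%E,
          (pmean p 0 delta (fun t => (phi t - phi (t - gamma))%R) <= (C * w gamma)%:E)%E &
          (local_modulus p f x delta <= (C * w delta)%:E)%E]) ->
  mean_modulus (low_exponent p) (2 * C `^ low_exponent p) w (fun t => part (second_diff g x (f x) t)).
Proof.
move=> p1 bg fg C0 w0 partn partB partb hC; set sd := second_diff g x (f x).
have bsd : bbc sd by exact: bbc_second_diff.
have sdae := second_diff_ae x fg.
have s1 := low_exponent_gt1 p1; have s0 : 0 <= low_exponent p by rewrite (le_trans ler01)// ltW.
have bound d W (h h' : R -> R[i]) : 0 < d -> 0 < W -> bbc h' -> (\forall t \ae mu, h t = h' t) ->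
    (pmean p 0 d h <= (C * W)%:E)%E ->
    itg 0 d (fun t => `|part (h' t)| `^ low_exponent p) <= 2 * C `^ low_exponent p * d * W `^ low_exponent p.
  move=> d0 W0 bh hh hp; have CW : 0 < C * W by rewrite mulr_gt0.
  have := pmean_mean p1 d0 bh hh hp CW (lexx _); rewrite add0r.
  have -> : 2 * d * (C * W) `^ low_exponent p = 2 * C `^ low_exponent p * d * W `^ low_exponent p.
    by rewrite powRM ?(ltW C0) ?(ltW W0)//; ring.
  apply: le_trans; apply: le_itg.
  - by apply: bb_powR => //; exact: partb.
  - have := bb_powR s0 (bbc_norm bh); congr bb; apply/funext => t.
    by rewrite ger0_norm// normc_ge0.
  - by move=> t _; apply: ge0_ler_powR; rewrite ?nnegrE ?normc_ge0.
split=> [h d h0 d0|h d h0 d0|d d0].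
- have [hp _ _] := hC h d h0 d0.
  have E : (fun t => `|part (sd t) - part (sd (t + h))| `^ low_exponent p) =
    (fun t => `|part (sd t - sd (t + h))| `^ low_exponent p).
    by apply/funext => t; rewrite (partB (sd t)).
  rewrite E; apply: (bound d (w h) _ (fun t => sd t - sd (t + h)) d0 (w0 h h0) (bbcB bsd (bbc_shift h bsd)) _ hp).
  have hI := @filterI _ _ aeF _ _ sdae (ae_shift h sdae).
  by apply: (@filterS _ _ aeF _ _ _ hI) => t /= [-> ->].
- have [_ hp _] := hC h d h0 d0.
  have E : (fun t => `|part (sd t) - part (sd (t - h))| `^ low_exponent p) =
    (fun t => `|part (sd t - sd (t - h))| `^ low_exponent p).
    by apply/funext => t; rewrite (partB (sd t)).
  rewrite E; apply: (bound d (w h) _ (fun t => sd t - sd (t - h)) d0 (w0 h h0) (bbcB bsd (bbc_shift (- h) bsd)) _ hp).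
  have hI := @filterI _ _ aeF _ _ sdae (ae_shift (- h) sdae).
  by apply: (@filterS _ _ aeF _ _ _ hI) => t /= [-> ->].
- have [_ _ hp] := hC d d d0 d0.
  exact: (bound d (w d) _ sd d0 (w0 d d0) bsd sdae hp).
Qed.

End Representative.

(** * The spectrum and the weighted series *)

Section Spectrum.
Context {R : realType}.
Notation normc := (@ComplexField.Normc.normc R).
Variables (f : R -> R[i]) (lam : int -> R).
Hypothesis hlam : fourier_exponents f lam.

Lemma exponents_step (n : nat) : lam n%:Z < lam n.+1%:Z.
Proof.
have [[l0 l1 _ _] _] := hlam; case: n => [|n]; last by have /andP[] := l1 n.+1 isT.
by rewrite l0; have /andP[] := l1 1%N isT.
Qed.

Lemma exponents_lt (m n : nat) : (m < n)%N -> lam m%:Z < lam n%:Z.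
Proof.
elim: n => // n ih; rewrite ltnS leq_eqVlt => /predU1P[->|/ih h]; first exact: exponents_step.
exact: lt_trans (exponents_step n).
Qed.

Lemma exponents_abs (nu : int) : `|lam nu| = lam (absz nu)%:Z.
Proof.
have [[l0 _ _ lN] _] := hlam.
have pos (n : nat) : 0 <= lam n%:Z.
  by case: n => [|n]; rewrite ?l0// -l0 ltW// exponents_lt.
case: nu => n; first by rewrite ger0_norm.
by rewrite NegzE lN normrN abszN absz_nat ger0_norm.
Qed.

Lemma exponents_lt_abs (mu nu : int) : `|lam mu| < `|lam nu| -> (absz mu < absz nu)%N.
Proof.
rewrite !exponents_abs => h; rewrite ltnNge; apply/negP; rewrite leq_eqVlt => /predU1P[e|/exponents_lt h2].
  by move: h; rewrite e ltxx.
by have := lt_trans h h2; rewrite ltxx.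
Qed.

Lemma exponents_inj : injective lam.
Proof.
have [[l0 _ _ lN] _] := hlam.
move=> i j e; have ea : absz i = absz j.
  have [h|h|//] := ltngtP (absz i) (absz j); have := exponents_lt h; rewrite -!exponents_abs e ltxx//.
have [//|/eqP ij] := eqVneq i j.
have {ij} ij : i = - j.
  by move: ea ij; case: i {e} => m; case: j => n /= ea //; rewrite ?NegzE; move: ea; lia.
move: e; rewrite ij lN => /eqP; rewrite eq_sym -subr_eq0 opprK -mulr2n mulrn_eq0 /= => /eqP j0.
have : `|lam j| = 0 by rewrite j0 normr0.
rewrite exponents_abs; case aj: (absz j) => [|n].
  by move=> _; move: aj; lia.
by have := exponents_lt (ltn0Sn n); rewrite l0 => h1 h2; move: h1; rewrite h2 ltxx.
Qed.

(** The indices of the partial sum are few enough to be listed. Exponents with zero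
    coefficient, which occur because only one of A_nu and A_(-nu) need be nonzero,
    are dropped. *)
Lemma spectrum_list (gm : R) : exists s : seq R, [/\ uniq s, forall l, l \in s -> `|l| <= gm,
  forall l, l \in s -> fourier_coef f l != 0,
  forall l, l \notin s -> fourier_coef f l = 0 \/ gm < `|l| &
  forall x, partial_sum f lam gm x = trig_sum (fourier_coef f) s x].
Proof.
have [[_ _ linf _] [_ lall]] := hlam.
have [N hN] : exists N : nat, forall n, (N <= n)%N -> gm < lam n%:Z.
  by have /cvgryPgt/(_ gm) [N _ hN] := linf; exists N.
pose zs : seq int := [seq Posz k | k <- iota 0 N] ++ [seq Negz k | k <- iota 0 N].
have zs_in nu : `|lam nu| <= gm -> nu \in zs.
  rewrite exponents_abs => h; have hn : (absz nu < N)%N.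
    by rewrite ltnNge; apply/negP => /hN; rewrite ltNge h.
  rewrite mem_cat; case: nu h hn => n _ hn; apply/orP; [left|right]; apply/mapP; exists n => //;
    by rewrite mem_iota add0n/=; move: hn => /=; lia.
have zs_uniq : uniq zs.
  rewrite cat_uniq !map_inj_uniq ?iota_uniq ?andbT//=; try by move=> i j [].
  by apply/hasPn => nu /mapP[k _ ->]; apply/negP => /mapP[].
pose ns := [seq nu <- zs | `|lam nu| <= gm].
have ns_uniq : uniq ns by exact: filter_uniq.
have nsE nu : (nu \in ns) = (`|lam nu| <= gm).
  by rewrite mem_filter; apply: andb_idr; exact: zs_in.
exists [seq l <- map lam ns | fourier_coef f l != 0]; split.
- by rewrite filter_uniq// map_inj_uniq//; exact: exponents_inj.
- by move=> l; rewrite mem_filter => /andP[_ /mapP[nu]]; rewrite nsE => h ->.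
- by move=> l; rewrite mem_filter => /andP[].
- move=> l; rewrite mem_filter negb_and negbK => /orP[/eqP ->|h]; first by left.
  have [->|nz] := eqVneq (fourier_coef f l) 0; first by left.
  right; have [nu le] := lall l nz; rewrite ltNge; apply/negP => h2.
  by move: h => /mapP; apply; exists nu => //; rewrite nsE -le.
move=> x; rewrite /partial_sum /trig_sum big_filter [RHS]big_mkcond big_map.
have -> : [set nu : int | `|lam nu| <= gm] = [set` ns].
  by apply/seteqP; split => nu /=; rewrite nsE.
rewrite -fsbig_seq//; apply: eq_bigr => nu _.
by case: ifPn => // /negPn/eqP ->; rewrite mul0r.
Qed.
End Spectrum.

Section WeightedSeries.
Context {R : realType}.

(** Partial sums suffice on the left; [abel_sum] brings in the decreasing weights, and E
    only enlarges the right-hand side. *)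
Lemma weighted_series (a e W : nat -> R) (E : nat -> \bar R) (q K : R) : 0 < q -> 0 <= K ->
  (forall k, 0 <= a k) -> (forall k, a k.+1 <= a k) -> (forall k, 0 <= W k) ->
  (forall k, 0 <= E k)%E ->
  (forall N, \sum_(k < N) e k `^ q <= K * \sum_(k < N) W k `^ q) ->
  ((\sum_(0 <= k <oo) (a k * e k `^ q)%:E) `^ q^-1 <=
   ((K + 1) `^ q^-1)%:E * (\sum_(0 <= k <oo) (a k)%:E * ((W k)%:E + E k) `^ q) `^ q^-1)%E.
Proof.
move=> q0 K0 a0 a1 W0 E0 h.
have K1 : 0 <= K + 1 by rewrite addr_ge0.
have t0 k : (0 <= (a k * e k `^ q)%:E)%E by rewrite lee_fin mulr_ge0 ?powR_ge0.
have t1 k : (0 <= (a k)%:E * ((W k)%:E + E k) `^ q)%E by rewrite mule_ge0 ?poweR_ge0// lee_fin.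
have s1 : (0 <= \sum_(0 <= k <oo) (a k)%:E * ((W k)%:E + E k) `^ q)%E by exact: nneseries_ge0.
have qi : 0 <= q^-1 by rewrite invr_ge0 ltW.
rewrite -poweR_EFin -poweRM ?lee_fin//.
apply: gt0_ler_poweR => //.
- by rewrite in_itv/= leey nneseries_ge0.
- by rewrite in_itv/= leey mule_ge0// lee_fin.
apply: lime_le; first exact: is_cvg_nneseries.
apply: nearW => N.
have part : \sum_(k < N) a k * e k `^ q <= K * \sum_(k < N) a k * W k `^ q.
  rewrite -subr_ge0 mulr_sumr -sumrB.
  rewrite (eq_bigr (fun k : 'I_N => a k * (K * W k `^ q - e k `^ q))); last first.
    by move=> k _; ring.
  apply: (@abel_sum R a (fun k => K * W k `^ q - e k `^ q)) => // n.
  by rewrite sumrB -mulr_sumr subr_ge0.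
rewrite big_mkord sumEFin.
apply: (@le_trans _ _ (K%:E * (\sum_(k < N) a k * W k `^ q)%:E)%E); first by rewrite -EFinM lee_fin.
apply: (@le_trans _ _ ((K + 1)%:E * (\sum_(k < N) a k * W k `^ q)%:E)%E).
  rewrite -!EFinM lee_fin ler_wpM2r ?lerDl//.
  by apply: sumr_ge0 => k _; rewrite mulr_ge0 ?powR_ge0.
apply: lee_wpmul2l; first by rewrite lee_fin.
rewrite -sumEFin -(big_mkord xpredT (fun k => (a k * W k `^ q)%:E)).
apply: (@le_trans _ _ (\sum_(0 <= k < N) (a k)%:E * ((W k)%:E + E k) `^ q)%E); last first.
  by apply: nneseries_lim_ge => k _ _; exact: t1.
apply: lee_sum => k _; rewrite EFinM lee_wpmul2l ?lee_fin// -poweR_EFin.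
apply: gt0_ler_poweR; rewrite ?(ltW q0)//.
- by rewrite in_itv/= leey lee_fin W0.
- by rewrite in_itv/= leey adde_ge0// lee_fin.
by rewrite leeDl.
Qed.
End WeightedSeries.

Section Final.
Context {R : realType}.
Notation normc := (@ComplexField.Normc.normc R).

Lemma stepanov_norm_ge0 (p : \bar R) (h : R -> R[i]) : (0 <= stepanov_norm p h)%E.
Proof.
case: p => [r| |]//=; last first.
  by apply: (@le_trans _ _ (normc (h 0))%:E); [rewrite lee_fin normc_ge0|apply: ereal_sup_ubound; exists 0].
apply: (@le_trans _ _ (pmean r%:E 0 pi h)); first exact: poweR_ge0.
by apply: ereal_sup_ubound; exists 0.
Qed.

Lemma best_approx_ge0 (p : \bar R) (sigma : R) (h : R -> R[i]) : (0 <= best_approx p sigma h)%E.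
Proof. by apply: le_ereal_inf_tmp => _ [g _ <-]; exact: stepanov_norm_ge0. Qed.

End Final.

(** * The estimate for the class *)

Section Main.
Context {R : realType}.
Notation itg := (@integral_on R).
Notation citg := (@cintegral_on R).
Notation normc := (@ComplexField.Normc.normc R).

(** The case where w vanishes at a positive point is separate: then w is 0 on the whole half line,
    the second difference is 0 almost everywhere, and the partial sums equal f x. *)
Theorem strong_partial_sums (alpha : R) (p : \bar R) (x : R) (w : R -> R) (f : R -> R[i]) (lam : int -> R) (q : R) :
  0 < alpha -> (1 < p)%E -> modulus_type w -> Omega_w alpha p x w f -> fourier_exponents f lam -> 0 < q ->
  exists2 K : R, 0 <= K & forall N : nat,
    \sum_(k < N) normc (partial_sum f lam (alpha * k%:R / 2) x - f x) `^ q <=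
    K * \sum_(k < N) w (pi / k.+1%:R) `^ q.
Proof.
move=> alpha0 p1 [_ w0 wmono wsub] [[st [M fM] [lam' hlam' halpha]] [C C0 hC]] hlam q0.
have [g bg fg] := borel_representative st fM.
have [M' gM] : exists M', forall t, normc (g t) <= M'.
  have [[_ [M1 h1]] [_ [M2 h2]]] := bg; exists (M1 + M2) => t.
  by rewrite (le_trans (normc_ReIm _))// lerD.
have gap := mean_ap_representative p1 bg fg st.
pose A l := fourier_coef f l.
have hA l (e : R) : 0 < e -> exists L0, forall L, L0 <= L -> normc (fint g l 0 L - L%:C * A l) <= e * L.
  have [z hz] := mean_exists bg gM gap l.
  by rewrite /A (fourier_coef_representative bg fg hz); exact: hz.
have [sp hsp] := choice (spectrum_list hlam).
have us gm : uniq (sp gm) by have [] := hsp gm.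
have sle gm l : l \in sp gm -> `|l| <= gm by have [_ h _ _ _] := hsp gm; exact: h.
have snz gm l : l \in sp gm -> A l != 0 by have [_ _ h _ _] := hsp gm; exact: h.
have sout gm l : l \notin sp gm -> A l = 0 \/ gm < `|l| by have [_ _ _ h _] := hsp gm; exact: h.
have sE gm : partial_sum f lam gm x = trig_sum A (sp gm) x by have [_ _ _ _ h] := hsp gm; exact: h.
pose beta := alpha / 2; have beta0 : 0 < beta by rewrite divr_gt0.
have b2 : 2 * beta = alpha by rewrite /beta mulrC divfK.
have sgap l l' : A l != 0 -> A l' != 0 -> 0 < `|l| -> `|l| < `|l'| -> 2 * beta <= `|l'| - `|l|.
  have [[l'0 _ _ _] [_ lall]] := hlam'.
  move=> /lall[i ->] /lall[j ->] i0 ij; rewrite b2.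
  have aij := exponents_lt_abs hlam' ij.
  rewrite !(exponents_abs hlam') in i0 *.
  have ai : (0 < absz i)%N.
    by rewrite lt0n; apply/negP => /eqP e; move: i0; rewrite e l'0 ltxx.
  apply: (le_trans (halpha _ ai)); rewrite lerB//.
  have := aij; rewrite leq_eqVlt => /predU1P[<-//|h].
  exact: ltW (exponents_lt hlam' h).
have [c0 c00 hc0] := @fejer_mass R.
have d0 (k : nat) : 0 < pi / k.+1%:R :> R by rewrite divr_gt0 ?pi_gt0.
have wge0 (d : R) : 0 < d -> 0 <= w d by move=> dp; rewrite -w0 wmono// ltW.
have errE k : partial_sum f lam (alpha * k%:R / 2) x = trig_sum A (sp (k%:R * beta)) x.
  by rewrite sE; congr (trig_sum _ (sp _) _); rewrite /beta; ring.
have wsub' (d e : R) : 0 < d -> 0 < e -> w (d + e) <= w d + w e.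
  by move=> dp ep; apply: wsub; exact: ltW.
have [wpos|] := pselect (forall d : R, 0 < d -> (0 : R) < w d).
  have wmono' (d e : R) : 0 < d -> d <= e -> w d <= w e by move=> dp; apply: wmono; exact: ltW.
  have B0 : (0 : R) <= 2 * C `^ low_exponent p by rewrite mulr_ge0// powR_ge0.
  have mR := @mean_modulus_representative R p f g x C w (@complex.Re R) p1 bg fg C0 wpos
    (@normc_Re R) (@cReB R) (fun u h => h.1) hC.
  have mI := @mean_modulus_representative R p f g x C w (@complex.Im R) p1 bg fg C0 wpos
    (@normc_Im R) (@cImB R) (fun u h => h.2) hC.
  have [K K0 hK] := strong_sum bg gM gap hA c00 hc0 beta0 wpos wmono' wsub' (low_exponent_gt1 p1)
    (low_exponent_le2 p) B0 q0 us sle snz sout sgap mR mI.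
  exists K => // N; apply: le_trans (hK N).
  by apply: ler_sum => k _; rewrite errE.
move=> /existsNP[d1 /not_implyP[d10 /negP]]; rewrite -leNgt => wd1.
have wz (d : R) : 0 < d -> w d = 0.
  move=> dp; apply/eqP; rewrite eq_le wge0// andbT.
  (* By subadditivity w d <= w ((n + 1) d1) <= (n + 1) w d1 = 0. *)
  pose n := Num.truncn (d / d1).
  have dn : d <= n.+1%:R * d1 by rewrite -ler_pdivrMr// ltW// truncnS_gt.
  apply: (le_trans (wmono _ _ (ltW dp) dn)); apply: (le_trans (modulus_mul wsub' n d10)).
  by rewrite pmulr_rle0.
have bsd := bbc_second_diff bg x (f x).
have hz (kern : R -> R) T : bounded_borel kern ->
    citg 0 T (fun t => second_diff g x (f x) t * (kern t)%:C) = 0.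
  move=> bk; have [T0|T0|<-] := ltgtP T 0; last exact: citg_point.
    by rewrite /cintegral_on !itg_gt.
  have bkc : bounded_borelc (fun t => (kern t)%:C) by exact: bbc_real.
  have bn : bounded_borel (fun t => normc (second_diff g x (f x) t)) by exact: bbc_norm.
  have [Mk hk] := bk.2.
  have I0 : itg 0 T (fun t => normc (second_diff g x (f x) t)) <= 0.
    apply/ler_addgt0Pr => e e0; rewrite add0r.
    have [_ _ hp] := hC T T T0 T0; rewrite wz// mulr0 in hp.
    have e1 : 0 < e / (3 * T) by rewrite divr_gt0// mulr_gt0.
    have := pmean_L1 p1 T0 bsd (second_diff_ae x fg) hp e1 (ltW e1); rewrite add0r.
    by rewrite (_ : 3 * T * (e / (3 * T)) = e)// mulrC divfK// gt_eqF// mulr_gt0.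
  apply/eqP; rewrite -normc_eq0 eq_le normc_ge0 andbT.
  apply: (le_trans (citg_norm _ _ (bbcM bsd bkc))).
  apply: (@le_trans _ _ (itg 0 T (fun t => `|Mk| * normc (second_diff g x (f x) t)))).
    apply: le_itg; [by apply: bbc_norm; exact: bbcM|by apply: bbM => //; exact: bb_cst|].
    move=> t _; rewrite normcM normcR mulrC ler_wpM2r ?normc_ge0//.
    by rewrite (le_trans (hk t))// ler_norm.
  by rewrite itgZ// mulr_ge0_le0.
exists 0 => // N; rewrite mul0r big1// => k _; rewrite errE.
have gm0 : 0 <= k%:R * beta by rewrite mulr_ge0// ltW.
rewrite (degenerate_sum bg gM gap hA c00 hc0 us sle sout hz gm0) subrr.
by rewrite ComplexField.Normc.normc0 powR0// gt_eqF.
Qed.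

End Main.

Theorem theorem6 (R : realType) (alpha : R) (p : \bar R) (x : R) (w : R -> R)
    (a : nat -> nat -> R) (f : R -> R[i]) (lam : int -> R) (q : R)
    (halpha : 0 < alpha) (hp : (1 < p)%E)
    (hw : modulus_type w)
    (hne : Omega_w alpha p x w !=set0)
    (ha0 : forall n k, 0 <= a n k)
    (ha1 : forall n, series (a n) @ \oo --> (1 : R))
    (hacol : a n 0%N @[n --> \oo] --> (0 : R))
    (haMS : forall n, MS (a n))
    (hf : Omega_w alpha p x w f)
    (hlam : fourier_exponents f lam)
    (hq : 0 < q) :
  exists2 K : R, 0 < K & forall n : nat,
    ((\sum_(0 <= k <oo)
        (a n k * ComplexField.Normc.normc
           (partial_sum f lam (alpha * k%:R / 2) x - f x)%R `^ q)%:E) `^ q^-1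
     <= K%:E *
        (\sum_(0 <= k <oo)
           (a n k)%:E *
           ((w (pi / k.+1%:R))%:E + best_approx p (alpha * k%:R / 2) f) `^ q)
          `^ q^-1)%E.
Proof.
have [K K0 hK] := strong_partial_sums halpha hp hw hf hlam hq.
exists ((K + 1) `^ q^-1); first by rewrite powR_gt0// ltr_wpDl.
have [_ w0 wmono _] := hw.
move=> n; apply: (@weighted_series R (a n)
  (fun k => ComplexField.Normc.normc (partial_sum f lam (alpha * k%:R / 2) x - f x))
  (fun k => w (pi / k.+1%:R)) (fun k => best_approx p (alpha * k%:R / 2) f)) => //.
- by move=> k; have [_ h] := haMS n; exact: h.
- by move=> k; rewrite -w0 wmono// divr_ge0// ltW// pi_gt0.
- by move=> k; exact: best_approx_ge0.
Qed.
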